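(* Let $\Bbbk$ be a field of characteristic zero and let $\sim$ be a uniformly algebraic word relation. The following are equivalent: (a) The image of $\widehat{\mathbf K}_{\mathsf P}^{(\sim)}$ under $\tilde\psi_{\le}$ is contained in $\widehat{\mathsf{Sym}}$. (b) The image of $\widehat{\mathbf K}_{\mathsf P}^{(\sim)}$ under $\tilde\psi_{>}$ is contained in $\widehat{\mathsf{Sym}}$. (c) The relation $\sim$ extends Knuth equivalence or $K$-Knuth equivalence. Moreover, if these conditions hold and $E$ is any $\sim$-equivalence class of packed words, then the symmetric functions $\tilde\psi_{\le}(\kappa_E)$ and $\tilde\psi_{>}(\kappa_E)$ are both Schur positive.
   Context: Words. $[n]=\{1,\dots,n\}$; $\mathbb P$ is the set of positive integers. A word is a finite sequence of positive integers; $\ell(w)$ is its length. $w\cap S$ is the subword formed by omitting letters not in $S$. If the set of letters of $w$ has $m$ elements and $\phi$ is the order-preserving bijection from it to $[m]$, then $\mathrm{fl}(w)=\phi(w_1)\phi(w_2)\cdots$; $w$ is packed if $w=\mathrm{fl}(w)$. $\mathbb W_{\mathsf P}$ is the set of packed words. Word relations. A word relation is an equivalence relation on words such that $v\sim w$ only if $v,w$ have the same set of letters (multiplicities may differ). It is uniformly algebraic if for all words $v,w$: (a) $v\sim v'$, $w\sim w'$ imply $vw\sim v'w'$; (b) if $v\sim w$ and $I\subset\mathbb P$ is a set of consecutive integers then $v\cap I\sim w\cap I$; (c) if $v\sim w$ then $\phi(v)\sim\phi(w)$ for any order-preserving injection $\phi:[\min(v),\max(v)]\to\mathbb P$ (integer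 interval; applied letterwise). A relation $\sim$ extends a relation $\approx$ if $v\approx w$ implies $v\sim w$. Knuth equivalence is the smallest equivalence relation on words which is a congruence for concatenation and satisfies $bac\sim bca$, $acb\sim cab$, $aba\sim baa$, $bab\sim bba$ for all positive integers $a<b<c$. $K$-Knuth equivalence is the smallest such congruence with $bac\sim bca$, $acb\sim cab$, $aba\sim bab$, $a\sim aa$ for all positive integers $a<b<c$. Spaces. $\widehat{\mathbf W}_{\mathsf P}$ is the $\Bbbk$-vector space of possibly infinite formal linear combinations of packed words, with the product topology (each coefficient line discrete). For a $\sim$-equivalence class $E\subset\mathbb W_{\mathsf P}$ let $\kappa_E=\sum_{w\in E}w\in\widehat{\mathbf W}_{\mathsf P}$; $\widehat{\mathbf K}_{\mathsf P}^{(\sim)}\subset\widehat{\mathbf W}_{\mathsf P}$ is the space of all possibly infinite linear combinations of the $\kappa_E$. Quasi-symmetric functions. A composition $\alpha=(\alpha_1,\dots,\alpha_l)\vDash n$ is a sequence of positive integers with sum $n$, and $I(\alpha)=\{\alpha_1,\alpha_1+\alpha_2,\dots,\alpha_1+\cdots+\alpha_{l-1}\}\subset[n-1]$. $M_\alpha=\sum_{i_1<\cdots<i_l}x_{i_1}^{\alpha_1}\cdots x_{i_l}^{\alpha_l}$ ($M_\emptyset=1$), and $L_\alpha=\sum_{\beta\vDash n,\,I(\alpha)\subseteq I(\beta)}M_\beta$. $\widehat{\mathsf{QSym}}\subset\Bbbk[[x_1,x_2,\dots]]$ is the space of possibly infinite linear combinations of the $M_\alpha$, with the product topology; $\widehat{\mathsf{Sym}}\subset\widehat{\mathsf{QSym}}$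 is the subspace of (possibly infinite) linear combinations of monomial symmetric functions, i.e. its symmetric elements. An element of $\widehat{\mathsf{Sym}}$ is Schur positive if it is a possibly infinite linear combination of Schur functions with nonnegative integer coefficients. The maps. $\tilde\psi_{\le},\tilde\psi_{>}:\widehat{\mathbf W}_{\mathsf P}\to\widehat{\mathsf{QSym}}$ are the continuous linear maps given on a packed word $w$ of length $n$ with $\mathrm{Des}(w)=\{i\in[n-1]:w_i>w_{i+1}\}=I(\alpha)$, $\alpha\vDash n$, by $\tilde\psi_{\le}(w)=L_\alpha$ and $\tilde\psi_{>}(w)=L_{\alpha^{\mathsf c}}$, where $\alpha^{\mathsf c}\vDash n$ has $I(\alpha^{\mathsf c})=[n-1]\setminus I(\alpha)$. (Equivalently, they are the canonical morphisms of linearly compact combinatorial bialgebras to $\widehat{\mathsf{QSym}}$ associated to the characters $\widehat{\mathbf W}_{\mathsf P}\to\Bbbk[[t]]$ sending $w\mapsto t^{\ell(w)}$ if $w$ is weakly increasing, respectively strictly decreasing, and $w\mapsto0$ otherwise.) *)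

(* Defs.v *)
From HB Require Import structures.
From mathcomp Require Import all_boot all_order all_algebra finmap multiset.
From mathcomp Require Import boolp classical_sets functions cardinality fsbigop.
From mathcomp Require Import reals topology.

Set Implicit Arguments.
Unset Strict Implicit.
Unset Printing Implicit Defensive.

Import GRing.Theory.

Local Open Scope classical_set_scope.
Local Open Scope nat_scope.

Definition is_word (w : seq nat) : bool := 0 \notin w.

Definition fl_word (w : seq nat) : seq nat :=
  [seq (index x (sort leq (undup w))).+1 | x <- w].

Definition packed (w : seq nat) : bool := w == fl_word w.

Definition pword := {w : seq nat | packed w}.

(* A relation on words is a relation on [seq nat] that only relates words. *)
Record word_relation (R : seq nat -> seq nat -> Prop) : Prop := {
  wrel_word : forall v w, R v w -> is_word v /\ is_word w;
  wrel_refl : forall w, is_word w -> R w w;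
  wrel_sym : forall v w, R v w -> R w v;
  wrel_trans : forall u v w, R u v -> R v w -> R u w;
  wrel_letters : forall v w, R v w -> v =i w }.

Definition consecutive (I : pred nat) : Prop :=
  (forall i, I i -> 0 < i) /\
  (forall i j k, I i -> I k -> i <= j <= k -> I j).

(* Minimal and maximal letters; their values on the empty word play no role,
   since [map phi [::] = [::]]. *)
Definition wmin (w : seq nat) : nat := \big[minn/head 0 w]_(i <- w) i.
Definition wmax (w : seq nat) : nat := \max_(i <- w) i.

(* An order-preserving injection [min(v), max(v)] -> P is represented by any
   function on [nat] that restricts to one on that interval. *)
Definition order_injection (m M : nat) (phi : nat -> nat) : Prop :=
  (forall a, m <= a <= M -> 0 < phi a) /\
  (forall a b, m <= a -> a < b -> b <= M -> phi a < phi b).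

Record uniformly_algebraic (R : seq nat -> seq nat -> Prop) : Prop := {
  ualg_cat : forall v v' w w', R v v' -> R w w' -> R (v ++ w) (v' ++ w');
  ualg_restrict : forall (I : pred nat) v w, consecutive I -> R v w ->
    R [seq i <- v | I i] [seq i <- w | I i];
  ualg_map : forall (phi : nat -> nat) v w,
    order_injection (wmin v) (wmax v) phi -> R v w -> R (map phi v) (map phi w)
}.

Definition extends (R S : seq nat -> seq nat -> Prop) : Prop :=
  forall v w, S v w -> R v w.

Inductive congruence_closure (G : seq nat -> seq nat -> Prop) :
    seq nat -> seq nat -> Prop :=
| cc_step v w of G v w : congruence_closure G v w
| cc_refl w of is_word w : congruence_closure G w w
| cc_sym v w of congruence_closure G v w : congruence_closure G w v
| cc_trans u v w of congruence_closure G u v & congruence_closure G v w :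
    congruence_closure G u w
| cc_cat v v' w w' of congruence_closure G v v' & congruence_closure G w w' :
    congruence_closure G (v ++ w) (v' ++ w').

Inductive knuth_step : seq nat -> seq nat -> Prop :=
| knuth_bac a b c of 0 < a & a < b & b < c :
    knuth_step [:: b; a; c] [:: b; c; a]
| knuth_acb a b c of 0 < a & a < b & b < c :
    knuth_step [:: a; c; b] [:: c; a; b]
| knuth_aba a b of 0 < a & a < b : knuth_step [:: a; b; a] [:: b; a; a]
| knuth_bab a b of 0 < a & a < b : knuth_step [:: b; a; b] [:: b; b; a].

Definition knuth : seq nat -> seq nat -> Prop := congruence_closure knuth_step.

Inductive kknuth_step : seq nat -> seq nat -> Prop :=
| kknuth_bac a b c of 0 < a & a < b & b < c :
    kknuth_step [:: b; a; c] [:: b; c; a]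
| kknuth_acb a b c of 0 < a & a < b & b < c :
    kknuth_step [:: a; c; b] [:: c; a; b]
| kknuth_aba a b of 0 < a & a < b : kknuth_step [:: a; b; a] [:: b; a; b]
| kknuth_aa a of 0 < a : kknuth_step [:: a] [:: a; a].

Definition kknuth : seq nat -> seq nat -> Prop :=
  congruence_closure kknuth_step.

Definition is_class (R : seq nat -> seq nat -> Prop) (E : set pword) : Prop :=
  exists w : pword, E = [set v | R (val w) (val v)].

Definition composition (a : seq nat) : bool := 0 \notin a.

Definition comp_set (a : seq nat) : seq nat :=
  [seq sumn (take j a) | j <- iota 1 (size a).-1].

(* The unique composition of [n] with [I(a) = S], for [S] a subset of
   {1, .., n-1}: see [comp_of_setP] and [comp_set_inj]. *)
Definition comp_of_set (n : nat) (S : seq nat) : seq nat :=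
  xget [::] [set a | [/\ composition a, sumn a = n & comp_set a =i S]].

Definition comp_compl (a : seq nat) : seq nat :=
  comp_of_set (sumn a) [seq i <- iota 1 (sumn a).-1 | i \notin comp_set a].

(* Positions are counted from 1, so [w_i] is [nth 0 w i.-1]. *)
Definition descents (w : seq nat) : seq nat :=
  [seq i <- iota 1 (size w).-1 | nth 0 w i.-1 > nth 0 w i].

Definition descent_comp (w : seq nat) : seq nat :=
  comp_of_set (size w) (descents w).

Definition is_partition (l : seq nat) : bool :=
  sorted geq l && (0 \notin l).

(* Tableaux are lists of rows in English notation. *)
Definition semistandard (l : seq nat) (T : seq (seq nat)) : Prop :=
  [/\ shape T = l,
      all (sorted leq) T
    & forall i j, i.+1 < size T -> j < size (nth [::] T i.+1) ->
        nth 0 (nth [::] T i) j < nth 0 (nth [::] T i.+1) j].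

(* Monomials in the commuting variables x_0, x_1, ... are multisets of
   indices; the variables (and so the entries of semistandard tableaux) are
   indexed from 0. *)
Notation monomial := {mset nat}%mset.

Definition monomial_of (i a : seq nat) : monomial :=
  seq_mset (flatten [seq nseq p.2 p.1 | p <- zip i a]).

Local Open Scope ring_scope.

Section Series.
Variable k : fieldType.

(* Elements of the completed space with (pseudo)basis [I] are functions
   [I -> k], giving the coefficients; in particular those of k[[x_0, x_1, ..]]
   are functions on monomials. *)
Definition wseries := pword -> k.
Definition pseries := monomial -> k.

(* The possibly infinite linear combination of the [u i], for [i] in [J], with
   coefficients [c i]. It is computed coefficientwise, and is only used for
   families such that each coefficient is nonzero for finitely many [i]
   (otherwise [fsbig] would return the junk value 0): see [kappa_finite],
   [msym_finite], [schur_finite], [psi_le_finite] and [psi_gt_finite]. *)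
Definition formal_sum (I : choiceType) (X : Type) (J : set I)
    (c : I -> k) (u : I -> X -> k) : X -> k :=
  fun x => \sum_(i \in J) c i * u i x.

Definition kappa (E : set pword) : wseries := fun w => (`[< E w >]%:R : k).

Definition Khat (R : seq nat -> seq nat -> Prop) : set wseries :=
  [set f | exists c : set pword -> k, f = formal_sum (is_class R) c kappa].

Definition Mqsym (a : seq nat) : pseries := fun m =>
  \sum_(i \in [set i : seq nat | sorted ltn i /\ size i = size a])
    ((m == monomial_of i a)%:R : k).

Definition Lqsym (a : seq nat) : pseries := fun m =>
  \sum_(b \in [set b | [/\ composition b, sumn b = sumn a
                         & {subset comp_set a <= comp_set b}]]) Mqsym b m.

Definition msym (l : seq nat) : pseries := fun m =>
  ((perm_eq [seq m i | i <- finsupp m] l)%:R : k).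

Definition Symhat : set pseries :=
  [set f | exists c : seq nat -> k, f = formal_sum is_partition c msym].

Definition schur (l : seq nat) : pseries := fun m =>
  \sum_(T \in [set T | semistandard l T]) ((m == seq_mset (flatten T))%:R : k).

Definition schur_positive (f : pseries) : Prop :=
  exists c : seq nat -> nat,
    f = formal_sum is_partition (fun l => (c l)%:R) schur.

(* The continuous linear maps sending a packed word [w] to [L_a], respectively
   [L_{a^c}], where [a] is the descent composition of [w]: see [psi_leP] and
   [psi_gtP] below, which characterize them by continuity, linearity and these
   values. *)
Definition psi_le (f : wseries) : pseries :=
  formal_sum setT f (fun w : pword => Lqsym (descent_comp (val w))).

Definition psi_gt (f : wseries) : pseries :=
  formal_sum setT f
    (fun w : pword => Lqsym (comp_compl (descent_comp (val w)))).

End Series.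

Arguments kappa k E : clear implicits.
Arguments Khat k R : clear implicits.
Arguments Symhat k : clear implicits.
Arguments psi_le k f : clear implicits.
Arguments psi_gt k f : clear implicits.

Local Open Scope nat_scope.

Lemma finite_seqs (n N : nat) :
  finite_set [set s : seq nat | size s <= n /\ all (gtn N) s].
Proof.
pose f (t : {k : 'I_n.+1 & k.-tuple 'I_N}) : seq nat := map val (tagged t).
apply: (@sub_finite_set _ _ (f @` setT)); last first.
  exact/finite_image/finite_finset.
move=> s [/= sz sN].
have hs : size (pmap insub s : seq 'I_N) == size s.
  by rewrite size_pmap_sub; rewrite -all_count.
have hk : size s < n.+1 by [].
exists (@Tagged _ (Ordinal hk) (fun k : 'I_n.+1 => k.-tuple 'I_N) (Tuple hs)) => //.
rewrite /f /=; elim: s sN {sz hs hk} => //= x s IHs /andP[xN sN].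
by rewrite insubT /= IHs.
Qed.

Lemma composition_size (a : seq nat) : composition a -> size a <= sumn a.
Proof.
rewrite /composition; elim: a => //= x a IHa; rewrite inE negb_or => /andP[x0 /IHa].
by rewrite -addn1 addnC; apply: leq_add; rewrite lt0n eq_sym.
Qed.

Lemma sumn_geq (a : seq nat) x : x \in a -> x <= sumn a.
Proof.
elim: a => //= y a IHa; rewrite inE => /orP[/eqP->|/IHa]; first exact: leq_addr.
by move=> h; apply: leq_trans h (leq_addl _ _).
Qed.

Lemma finite_compositions (n : nat) :
  finite_set [set a : seq nat | composition a /\ sumn a = n].
Proof.
apply: (@sub_finite_set _ _ _ _ (finite_seqs n n.+1)) => a [/= ca <-].
by split; [exact: composition_size | apply/allP => x; exact: sumn_geq].
Qed.

Lemma finite_pwords (n : nat) :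
  finite_set [set w : pword | size (val w) = n].
Proof.
have -> : [set w : pword | size (val w) = n] = val @^-1` [set s : seq nat | packed s /\ size s = n].
  by apply/seteqP; split=> w /=; [split=> //; exact: (valP w) | case].
apply: finite_preimage; first by move=> ? ? _ _; exact: val_inj.
apply: (@sub_finite_set _ _ _ _ (finite_seqs n n.+1)) => s [/= /eqP ps <-].
split=> //; rewrite [in all _ _]ps all_map; apply/allP => x xs /=.
rewrite ltnS; apply: (@leq_trans (size (sort leq (undup s)))).
  by rewrite index_mem mem_sort mem_undup.
by rewrite size_sort -ps size_undup.
Qed.

Lemma sumn_pairmap x s : path leq x s ->
  forall j, j < size s ->
  x + sumn (take j.+1 (pairmap (fun y z => z - y) x s)) = nth 0 s j.
Proof.
elim: s x => //= y s IHs x /andP[xy pys] [|j] js.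
  by rewrite take0 /= addn0 subnKC.
by rewrite addnA subnKC // IHs.
Qed.

Lemma composition_pairmap x s :
  path ltn x s -> composition (pairmap (fun y z => z - y) x s).
Proof.
rewrite /composition; elim: s x => //= y s IHs x /andP[xy /IHs h].
by rewrite inE negb_or h andbT eq_sym -lt0n subn_gt0.
Qed.

Lemma comp_of_setP (n : nat) (S : seq nat) :
  (forall i, i \in S -> 0 < i < n) ->
  [/\ composition (comp_of_set n S), sumn (comp_of_set n S) = n
    & comp_set (comp_of_set n S) =i S].
Proof.
move=> hS; apply: (@xgetPex _ [::] [set a | [/\ composition a, sumn a = n & comp_set a =i S]]).
have [n0|n0] := posnP n.
  exists [::]; split => //.
  by move=> i; rewrite in_nil; apply/esym/negP => /hS; rewrite n0 ltn0 andbF.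
pose s := rcons (sort leq (undup S)) n.
have ps : path ltn 0 s.
  rewrite /s rcons_path; apply/andP; split; last first.
    case E : (sort _ _) => [|x t] //=.
    have : last x t \in S by rewrite -mem_undup -(mem_sort leq) E mem_last.
    by case/hS/andP.
  rewrite path_min_sorted.
    by rewrite ltn_sorted_uniq_leq sort_uniq undup_uniq sort_sorted //; exact: leq_total.
  by apply/allP => i; rewrite mem_sort mem_undup => /hS /andP[].
have pl : path leq 0 s by apply: sub_path ps => i j; exact: ltnW.
exists (pairmap (fun y z => z - y) 0 s); split.
- exact: composition_pairmap.
- have := @sumn_pairmap 0 s pl (size s).-1.
  rewrite prednK ?size_rcons // take_oversize ?size_pairmap ?size_rcons //.
  by move=> /(_ (ltnSn _)); rewrite nth_rcons /= ltnn eqxx.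
- move=> i; rewrite /comp_set size_pairmap size_rcons /=.
  rewrite -[RHS]mem_undup -[RHS](mem_sort leq); congr (i \in _).
  apply: (@eq_from_nth _ 0); first by rewrite size_map size_iota.
  move=> j; rewrite size_map size_iota => hj.
  rewrite (nth_map 0) ?size_iota // nth_iota // add1n.
  rewrite -[sumn _]add0n sumn_pairmap //; last by rewrite size_rcons ltnS ltnW.
  by rewrite nth_rcons hj.
Qed.


Lemma sumn_take_lt (a : seq nat) i j : composition a -> i < j -> j <= size a ->
  sumn (take i a) < sumn (take j a).
Proof.
rewrite /composition; elim: a i j => [|x a IHa] [|i] [|j] //=; rewrite inE negb_or eq_sym ?lt0n.
  by case/andP=> /negPf x0 _ _ _; rewrite addn_eq0 x0.
by case/andP=> _ ca ij ja; rewrite ltn_add2l IHa.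
Qed.

Lemma comp_set_sorted a : composition a -> sorted ltn (comp_set a).
Proof.
move=> ca; apply/(sortedP 0) => i; rewrite size_map size_iota => hi.
rewrite !(nth_map 0) ?size_iota ?(ltnW hi) // !nth_iota ?(ltnW hi) // !add1n.
apply: sumn_take_lt => //; move: hi; case: (size a) => //= n.
exact: leqW.
Qed.

Lemma comp_set_inj a b : composition a -> composition b ->
  sumn a = sumn b -> comp_set a =i comp_set b -> a = b.
Proof.
move=> ca cb sab eab.
have {}eab : comp_set a = comp_set b.
  by apply: (irr_sorted_eq ltn_trans ltnn) => //; exact: comp_set_sorted.
have size0 c : composition c -> (size c == 0) = (sumn c == 0).
  case: c => //= x c; rewrite /composition inE negb_or eq_sym.
  by case/andP=> /negPf x0 _; rewrite addn_eq0 x0.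
have sz : size a = size b.
  have := congr1 size eab; rewrite !size_map !size_iota.
  have := size0 a ca; have := size0 b cb; rewrite sab => <-.
  by case: (size a) (size b) => [|n] [|m] //= _ ->.
have ps j : j <= size a -> sumn (take j a) = sumn (take j b).
  case: j => [|j] hj; first by rewrite !take0.
  have [hj'|hj'] := ltnP j (size a).-1; last first.
    have -> : j.+1 = size a.
      by apply/eqP; rewrite eqn_leq hj; move: hj'; case: (size a).
    by rewrite take_size sz take_size.
  have := congr1 (nth 0 ^~ j) eab.
  by rewrite !(nth_map 0) ?size_iota -?sz // !nth_iota -?sz // add1n.
apply: (@eq_from_nth _ 0) => // j hj.
have := ps _ hj; rewrite (take_nth 0) // (take_nth 0) -?sz //.
by rewrite !sumn_rcons ps 1?ltnW // => /addnI.
Qed.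

Lemma comp_of_descents w : [/\ composition (descent_comp w),
  sumn (descent_comp w) = size w & comp_set (descent_comp w) =i descents w].
Proof.
apply: comp_of_setP => i; rewrite mem_filter mem_iota add1n => /andP[_].
by case: (size w) => //=; rewrite andbC; case: i.
Qed.

Lemma comp_complP a : [/\ composition (comp_compl a),
  sumn (comp_compl a) = sumn a
  & comp_set (comp_compl a) =i
    [seq i <- iota 1 (sumn a).-1 | i \notin comp_set a]].
Proof.
apply: comp_of_setP => i; rewrite mem_filter mem_iota add1n => /andP[_].
by case: (sumn a) => //=; rewrite andbC; case: i.
Qed.

Lemma size_seq_mset (s : seq nat) : size (seq_mset s : monomial) = size s.
Proof. exact/perm_size/perm_eq_seq_mset. Qed.

Lemma size_monomial_of i a : size i = size a -> size (monomial_of i a) = sumn a.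
Proof.
rewrite size_seq_mset size_flatten /shape -map_comp; elim: i a => [|x i IHi] [|y a] //= [/IHi <-].
by rewrite size_nseq.
Qed.

Section Finiteness.
Local Open Scope ring_scope.
Variable k : fieldType.

Definition pointwise_finite (I X : Type) (J : set I) (u : I -> X -> k) : Prop :=
  forall x, finite_set [set i | J i /\ u i x != 0].

Lemma kappa_finite R : word_relation R -> pointwise_finite (is_class R) (kappa k).
Proof.
move=> hR w; apply: (@sub_finite_set _ _ _ _
  (finite_set1 [set v : pword | R (val w) (val v)])) => E [/= [v ->]].
rewrite /kappa /=; case: asboolP => [/= vw _|]; last by rewrite eqxx.
apply/seteqP; split=> u /=.
  exact/(wrel_trans hR)/(wrel_sym hR).
exact: (wrel_trans hR).
Qed.

Lemma msym_finite : pointwise_finite is_partition (@msym k).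
Proof.
move=> m; apply: (@sub_finite_set _ _ _ _
  (finite_seq (permutations [seq m i | i <- finsupp m]))) => l [/= _].
rewrite /msym mem_permutations perm_sym; by case: perm_eq => //; rewrite eqxx.
Qed.

Lemma tableaux_finite l (m : monomial) :
  finite_set [set T | semistandard l T /\ m = seq_mset (flatten T)].
Proof.
apply: (@sub_finite_set _ _ _ _
  (finite_image (reshape l) (finite_seq (permutations m)))) => T [[sT _ _] /= mT].
exists (flatten T); rewrite /= -?sT ?flattenK // mem_permutations mT perm_sym.
exact: perm_eq_seq_mset.
Qed.

Lemma schur_finite : pointwise_finite is_partition (@schur k).
Proof.
move=> m; apply: (@sub_finite_set _ _ _ _ (finite_compositions (size m))) => l.
move=> /= [/andP[_ l0] /eqP sl]; split=> //; apply: contra_notP sl => ml.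
apply: fsbig1 => T [sT _ _]; case: eqP => // mT; case: ml.
by rewrite mT size_seq_mset size_flatten sT.
Qed.

Lemma Mqsym_index_finite a (m : monomial) : composition a ->
  finite_set [set i : seq nat |
    [/\ sorted ltn i, size i = size a & m = monomial_of i a]].
Proof.
move=> ca; apply: (@sub_finite_set _ _ _ _
  (finite_seqs (size a) (sumn (enum_mset m)).+1)) => i [/= _ sz mi].
rewrite sz; split=> //; apply/allP => x xi /=; rewrite ltnS; apply: sumn_geq.
rewrite mi (perm_mem (perm_eq_seq_mset _)); elim: i a sz ca xi {mi} => [|y i IHi] [|z a] //= [sz].
rewrite /composition inE negb_or mem_cat mem_nseq => /andP[z0 ca].
rewrite inE => /orP[/eqP->|/(IHi _ sz ca) ->]; last by rewrite orbT.
by rewrite eqxx andbT lt0n eq_sym z0.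
Qed.

Lemma Mqsym_size a m : @Mqsym k a m != 0 -> size m = sumn a.
Proof.
move=> /eqP ma; apply: contra_notP ma => ma; apply: fsbig1 => i [_ sz].
by case: eqP => // mi; case: ma; rewrite mi size_monomial_of.
Qed.

Lemma Lqsym_size a m : @Lqsym k a m != 0 -> size m = sumn a.
Proof.
move=> /eqP ma; apply: contra_notP ma => ma; apply: fsbig1 => b [_ sb _].
by apply/eqP; apply: contra_notT ma => /Mqsym_size ->.
Qed.

Lemma psi_le_finite : pointwise_finite setT
  (fun w : pword => @Lqsym k (descent_comp (val w))).
Proof.
move=> m; apply: (@sub_finite_set _ _ _ _ (finite_pwords (size m))) => w [/= _].
by move=> /Lqsym_size ->; case: (comp_of_descents (val w)).
Qed.

Lemma psi_gt_finite : pointwise_finite setT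
  (fun w : pword => @Lqsym k (comp_compl (descent_comp (val w)))).
Proof.
move=> m; apply: (@sub_finite_set _ _ _ _ (finite_pwords (size m))) => w [/= _].
move=> /Lqsym_size ->; case: (comp_of_descents (val w)) => _ <- _.
by case: (comp_complP (descent_comp (val w))).
Qed.
End Finiteness.

Section Continuity.
Local Open Scope ring_scope.
Variable k : fieldType.

(* Functions into k, with the product of the discrete topologies. *)
Definition disc_ptws (X : Type) : topologicalType :=
  prod_topology (fun _ : X => discrete_topology k).

Definition cont_linear (I X : Type) (Phi : (I -> k) -> (X -> k)) : Prop :=
  (forall a f g, Phi (fun i => a * f i + g i) =
     fun x => a * Phi f x + Phi g x) /\
  continuous (Phi : disc_ptws I -> disc_ptws X).

Definition basis_elt (I : eqType) (i : I) : I -> k := fun j => (j == i)%:R.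

Lemma ptws_cvgE (X : eqType) (F : set_system (X -> k)) (f : X -> k) : Filter F ->
  ((F : set_system (disc_ptws X)) --> (f : disc_ptws X)) <-> (forall x, F [set g | g x = f x]).
Proof.
move=> FF; rewrite cvg_sup; split=> h x.
  apply: (h x); exists [set g : X -> k | g x = f x]; split=> //.
  by exists [set f x] => //; exact: discrete_open.
move=> A [B [[C oC <-] Cfx] /filterS]; apply.
by apply: filterS (h x) => g /= ->.
Qed.

Lemma formal_sumE (I : choiceType) (X : Type) (u : I -> X -> k) (f : I -> k) x (s : seq I) :
  uniq s -> (forall i, u i x != 0 -> i \in s) ->
  formal_sum setT f u x = \sum_(i <- s) f i * u i x.
Proof.
move=> us hs; rewrite /formal_sum fsbig_supp (fsbig_fwiden s) //.
- move=> i [_ /= /eqP fui]; apply: hs; apply: contraNneq fui => ->.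
  by rewrite mulr0.
- by move=> i [/= _ /not_andP[//|/contrapT]].
Qed.

Lemma formal_sum_cont_linear (I : choiceType) (X : eqType) (u : I -> X -> k) :
  pointwise_finite setT u ->
  cont_linear (fun f => formal_sum setT f u) /\
  forall i, formal_sum setT (basis_elt i) u = u i.
Proof.
move=> fu.
have supp x : {s : seq I | uniq s & forall i, u i x != 0 -> i \in s}.
  have h := fu x; exists (fset_set [set i | setT i /\ u i x != 0]); first exact: fset_uniq.
  by move=> i ui; rewrite in_fset_set // inE.
split; first split.
- move=> a f g; apply/funext => x; have [s us hs] := supp x.
  rewrite !(formal_sumE _ us hs) mulr_sumr -big_split; apply: eq_bigr => i _.
  by rewrite mulrDl mulrA.
- move=> f.
  have FF : Filter (nbhs (f : disc_ptws I)) := nbhs_filter (f : disc_ptws I).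
  apply/(@ptws_cvgE X) => x.
  have /ptws_cvgE cf : (nbhs (f : disc_ptws I) : set_system (disc_ptws I)) --> (f : disc_ptws I) by exact: cvg_id.
  have [s us hs] := supp x.

  have : \forall g \near (f : disc_ptws I), forall i, i \in s -> (g : I -> k) i = f i.
    elim: {us hs} s => [|i s IHs]; first exact: filterE.
    apply: filterS2 (cf i) IHs => g gi gs j; rewrite inE => /orP[/eqP->//|/gs //].
  apply: filterS => g gs /=; rewrite !(formal_sumE _ us hs).
  by rewrite big_seq [RHS]big_seq; apply: eq_bigr => i /gs ->.
- move=> i; apply/funext => x; have [s us hs] := supp x.
  rewrite (formal_sumE _ us hs) /basis_elt.
  have [iS|iS] := boolP (i \in s).
    rewrite (bigD1_seq i) //= eqxx mul1r big1 ?addr0 // => j /negPf ->.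
    by rewrite mul0r.
  rewrite big1_seq => [|j /= js].
    by apply/esym/eqP; apply: contraNT iS => /hs.
  by case: eqP => [ji|]; rewrite ?mul0r //; rewrite -ji js in iS.
Qed.

Lemma cont_linear_ext (I : countType) (X : eqType) (Phi Psi : (I -> k) -> (X -> k)) :
  cont_linear Phi -> cont_linear Psi ->
  (forall i, Phi (basis_elt i) = Psi (basis_elt i)) -> Phi = Psi.
Proof.
move=> [lPhi cPhi] [lPsi cPsi] eqb.
have lin0 (Th : (I -> k) -> (X -> k)) : (forall a f g, Th (fun i => a * f i + g i) =
     fun x => a * Th f x + Th g x) -> Th (fun=> 0) = fun=> 0.
  move=> /(_ (-1) (fun=> 0) (fun=> 0)); rewrite mulr0 addr0 => h.
  by apply/funext => x; rewrite h mulN1r addNr.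
have eqfin (s : seq I) : forall h : I -> k, (forall i, i \notin s -> h i = 0) -> Phi h = Psi h.
  elim: s => [|i s IHs] h hs.
    have -> : h = fun=> 0 by apply/funext => i; rewrite hs.
    by rewrite !lin0.
  pose h' j := if j == i then 0 else h j.
  have -> : h = (fun j => h i * basis_elt i j + h' j).
    apply/funext => j; rewrite /h' /basis_elt; case: eqP => [->|_].
      by rewrite mulr1 addr0.
    by rewrite mulr0 add0r.
  rewrite lPhi lPsi eqb IHs // => j js; rewrite /h'; case: eqP => // /eqP ji.
  by rewrite hs // inE negb_or ji.
apply/funext => f; apply/funext => x.
pose h (n : nat) : disc_ptws I := fun i => if (choice.pickle i < n)%N then f i else 0.
have hcvg : h n @[n --> \oo] --> (f : disc_ptws I).
  apply/ptws_cvgE => i; exists (choice.pickle i).+1 => // n /= hn.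
  by rewrite /h hn.
have hP := cvg_comp _ _ hcvg (cPhi f); have hQ := cvg_comp _ _ hcvg (cPsi f).
move/ptws_cvgE : hP => /(_ x) [N1 _ hN1]; move/ptws_cvgE : hQ => /(_ x) [N2 _ hN2].
rewrite -(hN1 (maxn N1 N2)) /= ?leq_maxl // -(hN2 (maxn N1 N2)) /= ?leq_maxr //.
congr (_ x); apply: (eqfin (pmap choice.unpickle (iota 0 (maxn N1 N2)))) => i.
apply: contraNeq; rewrite /h; case: ifP => [hi _|]; last by rewrite eqxx.
by rewrite mem_pmap; apply/mapP; exists (choice.pickle i); rewrite ?choice.pickleK // mem_iota.
Qed.

Lemma psi_leP (Phi : wseries k -> pseries k) : Phi = psi_le k <->
  cont_linear Phi /\
  forall w : pword, Phi (basis_elt w) = Lqsym k (descent_comp (val w)).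
Proof.
have [cl bas] := formal_sum_cont_linear (@psi_le_finite k).
split=> [->|[cP bP]]; first by split.
by apply: cont_linear_ext => // w; rewrite bP; exact: (esym (bas w)).
Qed.

Lemma psi_gtP (Phi : wseries k -> pseries k) : Phi = psi_gt k <->
  cont_linear Phi /\
  forall w : pword,
    Phi (basis_elt w) = Lqsym k (comp_compl (descent_comp (val w))).
Proof.
have [cl bas] := formal_sum_cont_linear (@psi_gt_finite k).
split=> [->|[cP bP]]; first by split.
by apply: cont_linear_ext => // w; rewrite bP; exact: (esym (bas w)).
Qed.
End Continuity.

(* Main.v *)
From HB Require Import structures.
Require Import Defs.
From mathcomp Require Import all_boot all_fingroup all_order all_algebra.
From mathcomp Require Import finmap multiset.
From mathcomp Require Import boolp classical_sets functions cardinality fsbigop.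
From mathcomp Require Import zify ring lra.

(** The proof rests on the Fomin-Greene theory of noncommutative Schur functions.

    Let the letters act on functions on words modulo the relation, by right
    multiplication; call u_a the operator of the letter a. Let e_k be the sum of
    the operators of all strictly decreasing words of length k, and h_k the same
    sum over weakly increasing words. The image of a word under [psi_gt] contains
    the monomial with exponents b_1, ..., b_l, in the order of the variables,
    exactly when the word is a concatenation of strictly decreasing blocks of
    lengths b_1, ..., b_l, and then the coefficient is 1. So for a function g that
    is constant on classes, this coefficient in [psi_gt] of g is the value of g on
    e_{b_1} ... e_{b_l} ([psi_gt_value]); for [psi_le] it is the value on
    h_{b_1} ... h_{b_l} ([psi_le_value]).

    Symmetry. For a < b < c the operators satisfy bac = bca, acb = cab and
    aba + bba = baa + bab ([fomin_greene]). For Knuth equivalence the last identity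
    holds because aba = baa and bba = bab; for K-Knuth equivalence it holds because
    aba = bab and bba = ba = baa. These identities suffice for the e_k to commute
    ([elem_comm]), hence also the h_k, which are polynomials in the e_k
    ([hom_elem]). So the coefficients do not depend on the order of the exponents.

    Schur positivity. For a partition f let J_f = det (e_{f_i + j - i}). These
    determinants obey the Pieri rule: J_f e_k is the sum of the J_g such that g / f
    is a horizontal strip with k boxes ([pieri_strip]). A semistandard tableau of
    shape f is a chain of horizontal strips, so e_{b_1} ... e_{b_l} is the sum of
    the J_f, each counted with the number of semistandard tableaux of shape f and
    content b ([elem_expansion], [schur_chains]). The same holds for the h_k with
    J_{f'} in place of J_f, f' being the conjugate of f ([hom_expansion]). The image
    of g is thus the sum over f of the value of g on J_f (respectively J_{f'}) times
    the Schur function of f. Finally J_f is a sum of operators of words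
    ([jacobi_trudi_positive]), one for each semistandard tableau read by columns, so
    that the value of the indicator of a class on J_f is a natural number.

    Converse. If the images of the classes of three-letter words are symmetric, then
    their coefficients at x_0 x_1^2 and x_0^2 x_1 agree. Within each class this gives
    as many words among 132, 231 as among 213, 312, and as many among 121, 221 as
    among 211, 212. The few ways of satisfying these equations lead to Knuth or
    K-Knuth equivalence ([extends_of_counts]). *)

Set Implicit Arguments.
Unset Strict Implicit.
Unset Printing Implicit Defensive.

Import Order.TTheory GRing.Theory Num.Theory.

Local Open Scope ring_scope.

(** * Noncommutative elementary symmetric functions commute *)

Section FG.
Variable A : nzRingType.
Variable u : nat -> A.

(** The sum of u_{a_1} ... u_{a_k} over n > a_1 > ... > a_k. The index is an
    integer, and the value is zero outside of [0, n], so that the recursion has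
    no boundary cases and so that [elem] can be the entry of a determinant. *)
Fixpoint elem (n : nat) (k : int) : A :=
  if n is n'.+1 then u n' * elem n' (k - 1) + elem n' k else (k == 0)%:R.

Lemma elem_neg n k : k < 0 -> elem n k = 0.
Proof.
elim: n k => [|n IHn] k k0 /=; first by rewrite lt_eqF.
rewrite !IHn ?mulr0 ?addr0 //; lia.
Qed.

Lemma elem0 n : elem n 0 = 1.
Proof.
by elim: n => [|n IHn] //=; rewrite elem_neg // mulr0 add0r.
Qed.

Lemma elem_gt n (k : int) : n%:Z < k -> elem n k = 0.
Proof.
elim: n k => [|n IHn] k nk /=; first by rewrite gt_eqF //.
rewrite !IHn ?mulr0 ?addr0 //; lia.
Qed.

(** The third relation is the common consequence of the two-letter Knuth and
    K-Knuth relations: it equates sums of two terms without saying which of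
    them match. *)
Definition fomin_greene (N : nat) : Prop :=
  [/\ forall a b c, (a < b < c)%N -> (c < N)%N ->
        u b * u a * u c = u b * u c * u a,
      forall a b c, (a < b < c)%N -> (c < N)%N ->
        u a * u c * u b = u c * u a * u b
    & forall a b, (a < b < N)%N ->
        u a * u b * u a + u b * u b * u a = u b * u a * u a + u b * u a * u b].

Variable N : nat.
Hypothesis hFG : fomin_greene N.

Definition commutator (x y : A) := x * y - y * x.

(** The relation bac = bca moves a large letter c to the left through a
    decreasing word one letter at a time, as long as some letter b between that
    word and c stays in front. *)
Lemma elem_pass b c n k : (n <= b < c)%N -> (c < N)%N ->
  u b * (elem n k * u c) = u b * (u c * elem n k).
Proof.
case: hFG => h1 _ _; elim: n b k => [|n IHn] b k /= hb cN.
  by case: (k == 0); rewrite ?mul0r ?mulr0 ?mul1r ?mulr1.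
rewrite mulrDl mulrDr IHn //; last by lia.
rewrite [u c * (_ + _)]mulrDr [RHS]mulrDr; congr (_ + _).
by rewrite -mulrA IHn; [rewrite !mulrA h1 //; lia | lia | lia].
Qed.

(** Moving u c to the left through a decreasing word is free until it reaches the
    first letter, by [elem_pass]; only passing that letter costs a commutator. *)
Lemma elem_commutator n c k : (n <= c < N)%N ->
  commutator (elem n k) (u c) = \sum_(i < n) commutator (u i) (u c) * elem i (k - 1).
Proof.
elim: n k => [|n IHn] k hc /=.
  by rewrite big_ord0 /commutator; case: (k == 0); rewrite ?mul0r ?mulr0 ?mul1r ?mulr1 subrr.
rewrite big_ord_recr /= -IHn; last by lia.
rewrite /commutator mulrDl -mulrA elem_pass; [|lia|lia].
rewrite [X in _ - X]mulrDr opprD addrACA addrC; congr (_ + _).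
by rewrite mulrBl !mulrA.
Qed.

(** This is the relation acb = cab. *)
Lemma commutator_kill a b c : (a < c < b)%N -> (b < N)%N -> commutator (u a) (u b) * u c = 0.
Proof.
case: hFG => _ h2 _ h bN; rewrite /commutator mulrBl h2 ?subrr //.
Qed.

(** The letters strictly between a and b are killed by the commutator of u a and
    u b, so only the letters up to a matter. *)
Lemma commutator_elem a b n k : (a < n <= b)%N -> (b < N)%N ->
  commutator (u a) (u b) * elem n k = commutator (u a) (u b) * elem a.+1 k.
Proof.
elim: n => [|n IHn] h bN; first by lia.
have [->//|an] : a = n \/ (a < n)%N by lia.
rewrite -IHn //; last by lia.
by rewrite [elem n.+1 k]/= mulrDr mulrA commutator_kill ?mul0r ?add0r //; lia.
Qed.

(** A rearrangement of the relation aba + bba = baa + bab. *)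
Lemma commutator_slide a b : (a < b < N)%N ->
  u b * commutator (u a) (u b) = commutator (u a) (u b) * u a.
Proof.
case: hFG => _ _ h3 /h3 h; rewrite /commutator mulrBr mulrBl !mulrA.
by apply/eqP; rewrite subr_eq addrAC eq_sym subr_eq h addrC.
Qed.

(** By [commutator_slide] the two summands for a letter i become the two terms of
    the recursion for [elem i.+1 (k - 1)], and [commutator_elem] then replaces the
    bound i.+1 by n, the same for all i. *)
Lemma elem_commutator_sum n k : (n < N)%N ->
  u n * commutator (elem n (k - 1)) (u n) + commutator (elem n k) (u n) =
  (\sum_(i < n) commutator (u i) (u n)) * elem n (k - 1).
Proof.
move=> nN; rewrite !elem_commutator ?leqnn //= mulr_sumr -big_split mulr_suml /=.
apply: eq_bigr => i _; have := ltn_ord i => hi.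
rewrite mulrA commutator_slide; last by lia.
by rewrite -mulrA -mulrDr [RHS]commutator_elem; [|lia|lia].
Qed.

(** Expand both factors at the largest letter. By [elem_commutator_sum] the
    commutators that appear add up to a fixed element times
    [elem n (p - 1) * elem n (q - 1)], so that by induction every term of the
    expansion is symmetric in p and q. *)
Lemma elem_comm n p q : (n <= N)%N -> elem n p * elem n q = elem n q * elem n p.
Proof.
elim: n p q => [|n IHn] p q nN.
  by rewrite /=; case: (p == 0); case: (q == 0); rewrite ?mul0r ?mulr0 ?mul1r ?mulr1.
pose G := \sum_(i < n) commutator (u i) (u n).
have key r s : elem n.+1 r * elem n.+1 s =
  u n * u n * (elem n (r - 1) * elem n (s - 1)) + G * (elem n (r - 1) * elem n (s - 1))
  + (u n * (elem n (r - 1) * elem n s) + u n * (elem n r * elem n (s - 1)))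
  + elem n r * elem n s.
  rewrite /= [G * _]mulrA -elem_commutator_sum // /commutator.
  rewrite !(mulrDl, mulrDr, mulrBl, mulrBr) !mulrA.
  set a1 := _ * u n * elem n (s - 1).
  set a2 := u n * elem n (r - 1) * elem n s.
  set a3 := u n * u n * _ * _.
  set a4 := elem n r * u n * _.
  set a5 := u n * elem n r * _.
  rewrite !(mulrN, mulNr) !mulrA -/a3 -/a5.
  by rewrite [a3 + _]addrA [a3 + _]addrC subrK [in RHS]addrACA subrK addrA.
rewrite !key ![elem n (p - 1) * _]IHn ?(ltnW nN) // ![elem n p * _]IHn ?(ltnW nN) //.
by rewrite [u n * _ + u n * _]addrC.
Qed.
End FG.

(** * Determinants with noncommuting entries *)

Section OrderedDet.
Variables (A : nzRingType) (r : nat).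
Implicit Types y : nat -> nat -> A.

(** The Leibniz formula, with the factors multiplied in the order of the rows. *)
Definition ordered_det y : A :=
  \sum_(s : 'S_r) (-1) ^+ s * \prod_(j < r) y j (s j).

Lemma eq_ordered_det y y' :
  (forall j p, (j < r)%N -> y j p = y' j p) -> ordered_det y = ordered_det y'.
Proof.
move=> h; apply: eq_bigr => s _; congr (_ * _).
by apply: eq_bigr => j _; rewrite h.
Qed.

Lemma prod_split (z : 'I_r -> A) (i : 'I_r) :
  \prod_(j < r) z j =
  \prod_(j < r | (j < i)%N) z j * (z i * \prod_(j < r | (i < j)%N) z j).
Proof.
pose Z k := if insub k is Some j then z j else 1.
have ZE (j : 'I_r) : z j = Z j by rewrite /Z valK.
have E P : \prod_(j < r | P (val j)) z j = \prod_(0 <= k < r | P k) Z k.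
  by rewrite big_mkord; apply: eq_bigr => j _.
rewrite (E (fun k => k < i)%N) (E (fun k => i < k)%N) (E (fun k => true)).
have ir := ltn_ord i.
rewrite (@big_cat_nat _ _ _ i) ?(ltnW ir) //= (@big_ltn _ _ _ i r) // -ZE.
congr (_ * (_ * _)).
  rewrite [RHS](@big_cat_nat _ _ _ i) ?(ltnW ir) //=.
  rewrite [X in _ = _ * X]big1_seq ?mulr1; last first.
    by move=> k; rewrite mem_index_iota; lia.
  by rewrite big_nat_cond [RHS]big_nat_cond; apply: eq_bigl => k; lia.
rewrite [RHS](@big_cat_nat _ _ _ i.+1) //=.
rewrite [X in _ = X * _]big1_seq ?mul1r; last first.
  by move=> k; rewrite mem_index_iota; lia.
by rewrite big_nat_cond [RHS]big_nat_cond; apply: eq_bigl => k; lia.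
Qed.

Lemma ordered_det_add y y1 y2 i : (i < r)%N ->
  (forall p, y i p = y1 i p + y2 i p) ->
  (forall j p, j != i -> y1 j p = y j p) ->
  (forall j p, j != i -> y2 j p = y j p) ->
  ordered_det y = ordered_det y1 + ordered_det y2.
Proof.
move=> ir hi h1 h2; rewrite -big_split; apply: eq_bigr => s _ /=.
rewrite -mulrDr; congr (_ * _).
rewrite (prod_split (fun j : 'I_r => y j (s j)) (Ordinal ir)).
rewrite (prod_split (fun j : 'I_r => y1 j (s j)) (Ordinal ir)).
rewrite (prod_split (fun j : 'I_r => y2 j (s j)) (Ordinal ir)) /=.
have e (P : pred 'I_r) y' : (forall j p, j != i -> y' j p = y j p) ->
    (forall j, P j -> j != i :> nat) ->
    \prod_(j < r | P j) y' j (s j) = \prod_(j < r | P j) y j (s j).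
  by move=> hy hP; apply: eq_bigr => j /hP ji; rewrite hy.
rewrite !(e _ y1) ?(e _ y2) //; try by move=> j; lia.
by rewrite hi mulrDl mulrDr.
Qed.

(** Only the exchange of two adjacent rows makes sense here, because other
    transpositions move factors past the ones in between. *)
Lemma ordered_det_alt y i : (i.+1 < r)%N ->
  (forall p q, y i p * y i.+1 q = y i q * y i.+1 p) -> ordered_det y = 0.
Proof.
move=> ir h; pose i1 := Ordinal (ltnW ir); pose i2 := Ordinal ir.
pose t := tperm i1 i2.
have oddMt s : (t * s)%g = ~~ s :> bool.
  by rewrite odd_permM odd_tperm -val_eqE /= neq_ltn ltnSn.
rewrite [ordered_det y](bigID (@odd_perm _)) /=.
apply: canLR (subrK _) _; rewrite add0r -sumrN.
rewrite (reindex_inj (mulgI t)); apply: eq_big => //= s.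
rewrite oddMt => /negPf->; rewrite mulN1r mul1r; congr (- _).
rewrite (prod_split _ i1) [RHS](prod_split _ i1); congr (_ * _).
  apply: eq_bigr => j ji; rewrite permM tpermD //; rewrite -val_eqE /=; move: ji => /=; lia.
have e (z : 'I_r -> A) : \prod_(j < r | (i1 < j)%N) z j
    = z i2 * \prod_(j < r | (i2 < j)%N) z j.
  have := prod_split (fun j => if (i1 < j)%N then z j else 1) i2.
  rewrite -big_mkcond /= => ->; rewrite big1 ?mul1r.
    rewrite ltnSn; congr (_ * _); apply: eq_bigr => j ij; rewrite (ltnW ij) //.
  by move=> j; case: ltngtP => //; lia.
rewrite !e !mulrA permM tpermL permM tpermR h; congr (_ * _ * _).
apply: eq_bigr => j ji; rewrite permM tpermD //; rewrite -val_eqE /=; move: ji => /=; lia.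
Qed.
End OrderedDet.

(** * Jacobi-Trudi determinants are sums of words *)

Section Positivity.
Variables (A : nzRingType) (u : nat -> A).

Definition uword (w : seq nat) : A := \prod_(a <- w) u a.

Lemma uword_cat v w : uword (v ++ w) = uword v * uword w.
Proof. exact: big_cat. Qed.

Lemma uword_cons a w : uword (a :: w) = u a * uword w.
Proof. exact: big_cons. Qed.

(** The evaluation of the indicator of a class of words on such an element counts
    words, and so is a natural number. *)
Definition word_positive (x : A) : Prop :=
  exists W : seq (seq nat), x = \sum_(w <- W) uword w.

Lemma word_positive0 : word_positive 0.
Proof. by exists [::]; rewrite big_nil. Qed.

Lemma word_positiveD x y :
  word_positive x -> word_positive y -> word_positive (x + y).
Proof. by move=> [V ->] [W ->]; exists (V ++ W); rewrite big_cat. Qed.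

Lemma word_positive_uword w : word_positive (uword w).
Proof. by exists [:: w]; rewrite big_seq1. Qed.

Variable N : nat.
Hypothesis hFG : fomin_greene u N.

Lemma elem_pass_word b y n k d : path gtn b y -> (n <= last b y)%N ->
  (b < d < N)%N ->
  u b * (uword y * elem u n k * u d) = u b * (u d * (uword y * elem u n k)).
Proof.
case: (hFG) => h1 _ _.
elim: y b => [|c y IHy] b /=.
  by rewrite /uword big_nil !mul1r => _ nb /andP[bd dN]; rewrite (elem_pass hFG) ?nb.
move=> /andP[cb py] ny bdN; rewrite uword_cons -!mulrA.
have := IHy c py ny; rewrite -!mulrA => ->; last by lia.
by rewrite !mulrA h1 //; lia.
Qed.

(** If the columns x and c, of equal length, satisfy x_i < c_i, then the largest
    letter of c moves left through everything except the largest letter of x, and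
    induction applies to the remaining letters. Nothing of c is left behind [elem],
    so the latter becomes adjacent to whatever follows c. *)
Lemma column_pass n x c : sorted ltn x -> all (leq n) x -> all2 ltn x c ->
  all (gtn N) c ->
  exists X, forall k,
    uword (rev x) * elem u n k * uword (rev c) = X * elem u n k.
Proof.
elim/last_ind: x c => [|x b IHx] c.
  by case: c => // _ _ _ _; exists 1 => k; rewrite /uword big_nil mulr1.
case/lastP: c => [|c d]; first by case: x {IHx}.
move=> sx nx h cN.
have [xc bd] : all2 ltn x c /\ (b < d)%N.
  move: h; rewrite !all2E !size_rcons eqSS => /andP[/eqP sz].
  by rewrite zip_rcons // all_rcons sz eqxx /= => /andP[].
move: cN nx; rewrite !all_rcons => /andP[/= dN cN] /andP[nb nx].
have sx' : sorted ltn x.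
  by move: sx; rewrite -cats1 => /cat_sorted2 [].
have [X hX] := IHx c sx' nx xc cN.
exists (u b * u d * X) => k.
rewrite !rev_rcons !uword_cons.
have py : path gtn b (rev x).
  by move: sx; rewrite -rev_sorted rev_rcons.
have nl : (n <= last b (rev x))%N.
  have := mem_last b (rev x); rewrite inE => /orP[/eqP->//|].
  by rewrite mem_rev => /(allP nx).
have := elem_pass_word k py nl (d := d); rewrite bd dN => /(_ isT) E.
transitivity (u b * (uword (rev x) * elem u n k * u d) * uword (rev c)).
  by rewrite !mulrA.
by rewrite E -!mulrA -hX !mulrA.
Qed.

Variable r : nat.

(** Rows of the determinant are indexed by the columns j of a tableau that is being
    filled from its largest letters down. The list [w j] holds, in increasing
    order, the letters already placed in column j; there remain [a j] boxes, which
    receive letters smaller than [ns j]. *)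
Definition col_entry (a : nat -> int) (w : nat -> seq nat) (ns : nat -> nat)
  (j p : nat) : A := uword (rev (w j)) * elem u (ns j) (a j + p%:Z - j%:Z).

Definition upd T (f : nat -> T) i x := fun j => if j == i then x else f j.

(** The letters placed so far form the outer part of a semistandard tableau whose
    remaining boxes have column lengths [a]: the letter number m of column j is in
    row a_j + m, and [cs_row] compares it with its neighbour in column j.+1. *)
Record column_state (a : nat -> nat) (w : nat -> seq nat) : Prop := {
  cs_part : forall j, (a j.+1 <= a j)%N;
  cs_out : forall j, (r <= j)%N -> a j = 0%N /\ w j = [::];
  cs_sorted : forall j, sorted ltn (w j);
  cs_lt : forall j, all (gtn N) (w j);
  cs_row : forall j m, (a j + m < a j.+1 + size (w j.+1))%N ->
    (m < size (w j))%N /\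
    (nth 0 (w j) m <= nth 0 (w j.+1) (a j + m - a j.+1))%N }.

(** Without letters to choose from, the filling is either complete or impossible. *)
Lemma column_positive0 a w : column_state a w ->
  word_positive (ordered_det r (col_entry (fun j => (a j)%:Z) w (fun=> 0%N))).
Proof.
move=> cs.
have [a0|a0] := posnP (a 0%N).
  have {}a0 j : a j = 0%N.
    by elim: j => // j IHj; have := cs_part cs j; rewrite IHj leqn0 => /eqP.
  rewrite /ordered_det (bigD1 1%g) //= [X in _ + X]big1 ?addr0.
    rewrite odd_perm1 mul1r.
    suff [x ->] : exists x, \prod_(j < r) col_entry (fun j => (a j)%:Z) w (fun=> 0%N) j
        ((1%g : 'S_r) j) = uword x by exact: word_positive_uword.
    elim/big_ind: _ => [|_ _ [x ->] [y ->]|j _].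
    - by exists [::]; rewrite /uword big_nil.
    - by exists (x ++ y); rewrite uword_cat.
    - exists (rev (w j)).
      by rewrite /col_entry /= perm1 a0 add0r subrr eqxx mulr1.
  move=> s s1; have [j hj] : exists j : 'I_r, s j != j.
    apply/existsP; apply: contraNT s1; rewrite negb_exists => /forallP h.
    by apply/eqP/permP => j; rewrite perm1; have := h j; rewrite negbK => /eqP.
  rewrite (prod_split _ j) [X in _ * (_ * (X * _))]/col_entry /=.
  rewrite a0 add0r subr_eq0 eqz_nat.
  by have /negPf -> : (s j : nat) != j by []; rewrite mulr0 mul0r !mulr0.
rewrite /ordered_det big1; first exact: word_positive0.
move=> s _; case: (posnP r) => [r0|r0].
  by have [] := cs_out cs (j := 0%N); rewrite ?r0 // => a00; rewrite a00 in a0.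
rewrite (prod_split _ (Ordinal r0)) [X in _ * (_ * (X * _))]/col_entry /=.
have -> : ((a 0%N)%:Z + (s (Ordinal r0) : nat)%:Z - 0 == 0 :> int) = false by lia.
by rewrite mulr0 mul0r !mulr0.
Qed.

Lemma eq_col a a' w w' ns ns' :
  (forall j, (j < r)%N -> [/\ a j = a' j, w j = w' j & ns j = ns' j]) ->
  ordered_det r (col_entry a w ns) = ordered_det r (col_entry a' w' ns').
Proof.
by move=> h; apply: eq_ordered_det => j p /h [e1 e2 e3]; rewrite /col_entry e1 e2 e3.
Qed.

(** The recursion for [elem]: the largest letter n is put in column i, or it is
    not. *)
Lemma col_split a w ns i n : (i < r)%N -> ns i = n.+1 ->
  ordered_det r (col_entry a w ns) =
  ordered_det r (col_entry (upd a i (a i - 1)) (upd w i (n :: w i)) (upd ns i n)) +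
  ordered_det r (col_entry a w (upd ns i n)).
Proof.
move=> ir nsi; apply: (ordered_det_add ir) => [p|j p /negPf ji|j p /negPf ji].
- rewrite /col_entry /upd eqxx nsi /= mulrDr rev_cons -cats1 uword_cat.
  rewrite /uword big_seq1 !mulrA; congr (_ * elem _ _ _ + _); lia.
- by rewrite /col_entry /upd ji.
- by rewrite /col_entry /upd ji.
Qed.

(** When columns i and i.+1 have equally many boxes left, the letter n may not be
    placed in column i alone. Algebraically the rows i and i.+1 of the determinant
    then get the same indices, and they can be exchanged: by [column_pass], the
    letters already placed in column i.+1 move to the left of both factors
    [elem], which commute. *)
Lemma column_vanish n i a w : (n < N)%N -> (i < r)%N -> column_state a w ->
  a i = a i.+1 -> all (leq n.+1) (w i) -> all (leq n.+1) (w i.+1) ->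
  ordered_det r (col_entry (upd (fun j => (a j)%:Z) i ((a i)%:Z - 1))
    (upd w i (n :: w i)) (upd (fun j => if (j < i.+1)%N then n.+1 else n) i n)) = 0.
Proof.
move=> nN ir cs ai hi hi1.
(* without a next column, column i has no box left *)
have [i1r|i1r] := ltnP i.+1 r; last first.
  have ai0 : a i = 0%N.
    by rewrite ai; case: (cs_out cs i1r).
  rewrite /ordered_det big1 // => s _.
  rewrite (prod_split _ (Ordinal ir)) [X in _ * (_ * (X * _))]/col_entry /=.
  rewrite /upd eqxx ai0 elem_neg ?mulr0 ?mul0r ?mulr0 //.
  by have := ltn_ord (s (Ordinal ir)); lia.
pose x := n :: w i; pose s := size (w i.+1).
have row m : (m < s)%N -> (m < size (w i))%N /\ (nth 0 (w i) m <= nth 0 (w i.+1) m)%N.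
  move=> ms; have := cs_row cs (j := i) (m := m); rewrite ai addKn; apply.
  by rewrite ltn_add2l.
have ss : (s <= size (w i))%N.
  by case: s row => // s' /(_ s' (ltnSn _)) [].
have sx : sorted ltn x.
  by rewrite /x /= path_min_sorted // (cs_sorted cs).
have [X hX] : exists X, forall k,
    uword (rev (take s x)) * elem u n k * uword (rev (w i.+1)) = X * elem u n k.
  apply: column_pass.
  - exact: take_sorted.
  - apply/allP => y /mem_take; rewrite inE => /orP[/eqP->//|/(allP hi)]; exact: ltnW.
  - have sz : size (take s x) = s by rewrite size_takel //= ltnW.
    rewrite all2E sz eqxx /=; apply/(all_nthP (0%N, 0%N)) => m.
    rewrite size_zip sz minnn => ms; rewrite nth_zip //= nth_take //.
    case: m ms => [|m] ms /=; first by apply: (allP hi1); rewrite mem_nth.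
    have [_ /leq_ltn_trans] := row m (ltnW ms); apply.
    by rewrite (sorted_ltn_nth ltn_trans) ?inE ?(cs_sorted cs) // ltnW.
  - exact: (cs_lt cs).
have xE : uword (rev x) = uword (rev (drop s x)) * uword (rev (take s x)).
  by rewrite -uword_cat -rev_cat cat_take_drop.
apply: (ordered_det_alt i1r) => p q.
rewrite /col_entry /upd eqxx (_ : i.+1 == i = false); last by lia.
rewrite ltnn -/x xE.
have E k l : uword (rev (drop s x)) * uword (rev (take s x)) * elem u n k
    * (uword (rev (w i.+1)) * elem u n l) =
    uword (rev (drop s x)) * X * (elem u n k * elem u n l).
  rewrite !mulrA -[_ * X * _]mulrA -hX !mulrA //.
rewrite !E (elem_comm hFG) ?(ltnW nN) //; congr (_ * (elem _ _ _ * elem _ _ _)); lia.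
Qed.

Lemma column_state_add n i a w : (n < N)%N -> (i < r)%N -> column_state a w ->
  (a i.+1 < a i)%N -> all (leq n.+1) (w i) -> all (leq n) (w i.+1) ->
  column_state (upd a i (a i).-1) (upd w i (n :: w i)).
Proof.
move=> nN ir cs ai hi hi1; split=> j.
- have := cs_part cs j; rewrite /upd.
  case: (j =P i) => [->|_]; last by case: eqP => // ->; lia.
  by rewrite (_ : (i.+1 == i) = false); lia.
- move=> rj; have := cs_out cs rj; rewrite /upd; case: eqP => // ji; lia.
- rewrite /upd; case: eqP => _; last exact: (cs_sorted cs).
  by rewrite /= path_min_sorted // (cs_sorted cs).
- by rewrite /upd; case: eqP => _ /=; rewrite ?nN (cs_lt cs).
- move=> m; rewrite /upd; case: (j =P i) => [->|ji].
    rewrite (_ : (i.+1 == i) = false); last by lia.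
    case: m => [|m] /=.
      move=> h; split=> //; apply: (allP hi1); apply: mem_nth; rewrite ltn_subLR; [exact: h|lia].
    move=> h; have [|h1 h2] := cs_row cs (j := i) (m := m); first by lia.
    by split=> //; apply: leq_trans h2 _; apply/eq_leq; congr nth; lia.
  case: eqP => [ji1|_]; last exact: (cs_row cs).
  move=> h; have [|h1 h2] := cs_row cs (j := j) (m := m).
    by move: h; rewrite ji1 /=; lia.
  split=> //; rewrite -ji1 in ai *; have := cs_part cs j => aj.
  by rewrite (_ : (_ - _)%N = (a j + m - a j.+1).+1) //; lia.
Qed.

(** Decide whether n goes into column i. If that choice is not compatible with the
    shape, the corresponding determinant vanishes by [column_vanish]. The
    disjunction says that column i.+1 has not received n in the present round,
    unless this has made it strictly shorter than column i. *)
Lemma column_step n i a w : (n < N)%N -> (i < r)%N -> column_state a w ->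
  (forall j, (j < i.+1)%N -> all (leq n.+1) (w j)) ->
  (forall j, (i.+1 <= j)%N -> all (leq n) (w j)) ->
  all (leq n.+1) (w i.+1) \/ (a i.+1 < a i)%N ->
  (forall a' w', column_state a' w' ->
    (forall j, (j < i)%N -> all (leq n.+1) (w' j)) ->
    (forall j, (i <= j)%N -> all (leq n) (w' j)) ->
    (forall j, i = j.+1 -> all (leq n.+1) (w' i) \/ (a' i < a' j)%N) ->
    word_positive (ordered_det r (col_entry (fun j => (a' j)%:Z) w'
      (fun j => if (j < i)%N then n.+1 else n)))) ->
  word_positive (ordered_det r (col_entry (fun j => (a j)%:Z) w
    (fun j => if (j < i.+1)%N then n.+1 else n))).
Proof.
move=> nN ir cs hl hr hb IH.
rewrite (@col_split _ _ _ i n) //; last by rewrite ltnSn.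
apply: word_positiveD; last first.
  rewrite (_ : ordered_det _ _ = ordered_det r (col_entry (fun j => (a j)%:Z) w
      (fun j => if (j < i)%N then n.+1 else n))).
    apply: IH => // j.
    + by move=> ji; apply: hl; lia.
    + rewrite leq_eqVlt => /orP[/eqP<-|]; last exact: hr.
      by apply: sub_all (hl i (ltnSn i)) => x; exact: ltnW.
    + by left; apply: hl.
  apply: eq_col => j _; split=> //; rewrite /upd ltnS leq_eqVlt.
  by case: eqP => [->|//]; rewrite ltnn.
have := cs_part cs i; rewrite leq_eqVlt => /orP[/eqP ai|ai].
  rewrite column_vanish //; [exact: word_positive0|exact: hl|].
  by case: hb => //; rewrite ai ltnn.
rewrite (_ : ordered_det _ _ = ordered_det r (col_entry
    (fun j => (upd a i (a i).-1 j)%:Z) (upd w i (n :: w i))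
      (fun j => if (j < i)%N then n.+1 else n))).
  apply: IH; rewrite /upd.
  + by apply: column_state_add => //; [exact: hl|exact: hr].
  + by move=> j ji; rewrite ltn_eqF //; apply: hl; lia.
  + move=> j; case: eqP => [-> _ /=|].
      by rewrite leqnn; apply: sub_all (hl i (ltnSn i)) => x; exact: ltnW.
    by move=> ji ij; apply: hr; lia.
  + move=> j ij; right; rewrite eqxx; rewrite (_ : j == i = false); last by lia.
    by have := cs_part cs j; rewrite -ij; lia.
apply: eq_col => j _; split=> //; rewrite /upd.
  by case: eqP => // _; lia.
by rewrite ltnS leq_eqVlt; case: eqP => [->|//]; rewrite ltnn.
Qed.

(** The letters are placed from the largest one down, and each letter visits the
    columns from right to left: column j has already been visited by n when
    i <= j. *)
Lemma column_positive n i a w : (n < N)%N || (n <= N)%N && (i == 0)%N -> (i <= r)%N ->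
  column_state a w ->
  (forall j, (j < i)%N -> all (leq n.+1) (w j)) ->
  (forall j, (i <= j)%N -> all (leq n) (w j)) ->
  (forall j, i = j.+1 -> all (leq n.+1) (w i) \/ (a i < a j)%N) ->
  word_positive (ordered_det r (col_entry (fun j => (a j)%:Z) w
    (fun j => if (j < i)%N then n.+1 else n))).
Proof.
elim: n i a w => [|n IHn] i a w.
all: elim: i a w => [|i IHi] a w nN ir cs hl hr hb.
all: try (by apply: column_step => //; [lia|exact: hb|];
  move=> a' w' cs' hl' hr' hb'; apply: IHi => //; lia).
- exact: column_positive0.
- rewrite (_ : ordered_det _ _ = ordered_det r (col_entry (fun j => (a j)%:Z) w
    (fun j => if (j < r)%N then n.+1 else n))); last first.
    by apply: eq_col => j ->.
  apply: IHn => //.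
  + lia.
  + by move=> j jr; apply: hr.
  + by move=> j jr; have [_ ->] := cs_out cs jr.
  + by move=> j _; left; have [_ ->] := cs_out cs (leqnn r).
Qed.

(** Filling the tableau completely turns the determinant into the sum of the
    column readings of the semistandard tableaux with column lengths a_j. *)
Lemma jacobi_trudi_positive (a : nat -> nat) : (forall j, (a j.+1 <= a j)%N) ->
  (forall j, (r <= j)%N -> a j = 0%N) ->
  word_positive (ordered_det r (fun j p => elem u N ((a j)%:Z + p%:Z - j%:Z))).
Proof.
move=> ha ar.
rewrite (_ : ordered_det _ _ = ordered_det r (col_entry (fun j => (a j)%:Z)
    (fun=> [::]) (fun j => if (j < 0)%N then N.+1 else N))).
  apply: (@column_positive N 0 a (fun=> [::])) => //; first by rewrite leqnn orbT.
  split=> //= j; first by move/ar.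
  by move=> m; have := ha j; lia.
by apply: eq_ordered_det => j p _; rewrite /col_entry /uword big_nil mul1r.
Qed.
End Positivity.

(** * Block-sorted words and products of elementary or complete functions *)

Section BlockWords.
Local Open Scope nat_scope.

Definition letters_le n (w : seq nat) := all (fun a => 0 < a <= n) w.

Fixpoint words_le n k : seq (seq nat) :=
  if k is k'.+1 then [seq x :: w | x <- iota 1 n, w <- words_le n k'] else [:: [::]].

Lemma mem_words_le n k w : (w \in words_le n k) = (size w == k) && letters_le n w.
Proof.
elim: k w => [|k IHk] [|x w] //=.
  by apply/allpairsP => -[[y v] []].
rewrite eqSS; apply/allpairsP/idP => [[[y v] /= [yn vk [-> ->]]]|].
  by move: vk yn; rewrite IHk mem_iota => /andP[-> ->]; rewrite andbT /=; lia.
case/and3P => sw xn wn; exists (x, w); rewrite /= IHk sw wn mem_iota; split=> //; lia.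
Qed.

Lemma words_le_uniq n k : uniq (words_le n k).
Proof.
elim: k => //= k IHk; apply: allpairs_uniq => //; first exact: iota_uniq.
by move=> [x w] [y v] _ _ [-> ->].
Qed.

Definition sorted_words (e : rel nat) n k := [seq w <- words_le n k | sorted e w].

Fixpoint block_words e n (b : seq nat) : seq (seq nat) :=
  if b is k :: b' then [seq v ++ w | v <- sorted_words e n k, w <- block_words e n b']
  else [:: [::]].

Lemma mem_sorted_words e n k w :
  (w \in sorted_words e n k) = [&& sorted e w, size w == k & letters_le n w].
Proof. by rewrite mem_filter mem_words_le. Qed.

Lemma mem_block_words e n b w : w \in block_words e n b <->
  [/\ size w = sumn b, letters_le n w & all (sorted e) (reshape b w)].
Proof.
elim: b w => [|k b IHb] w /=.
  by rewrite inE; split=> [/eqP ->|[/size0nil ->]].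
split=> [/allpairsP[[v x] /= [+ /IHb[sx lx ax] ->]]|[sw lw /andP[sv ax]]].
  rewrite mem_sorted_words => /and3P[sv /eqP kv lv].
  rewrite size_cat kv sx take_size_cat // drop_size_cat // sv ax.
  by split=> //; rewrite /letters_le all_cat; apply/andP.
have kw : k <= size w by rewrite sw leq_addr.
apply/allpairsP; exists (take k w, drop k w); rewrite /= cat_take_drop; split=> //.
  rewrite mem_sorted_words sv size_takel // eqxx /=.
  by move: lw; rewrite -{1}(cat_take_drop k w) /letters_le all_cat => /andP[].
apply/IHb; split=> //; first by rewrite size_drop sw addKn.
by move: lw; rewrite -{1}(cat_take_drop k w) /letters_le all_cat => /andP[].
Qed.

Lemma block_words_uniq e n b : uniq (block_words e n b).
Proof.
elim: b => //= k b IHb; apply: allpairs_uniq => //.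
  by apply: filter_uniq; exact: words_le_uniq.
move=> [v w] [v' w'] /allpairsP[[x y] /= [+ _ [-> _]]] /allpairsP[[x' y'] /= [+ _ [-> _]]].
rewrite !mem_sorted_words => /and3P[_ /eqP sx _] /and3P[_ /eqP sx' _] /eqP.
by rewrite eqseq_cat ?sx ?sx' // => /andP[/eqP -> /eqP ->].
Qed.

End BlockWords.

Section SortedSums.
Variables (A : nzRingType) (u : nat -> A).

(** Letters of words start from 1, and those of the alphabet [u] from 0. *)
Definition word_op (w : seq nat) : A := \prod_(a <- w) u a.-1.

Lemma word_op_cat v w : word_op (v ++ w) = word_op v * word_op w.
Proof. exact: big_cat. Qed.

Lemma word_op_uword w : word_op [seq a.+1 | a <- w] = uword u w.
Proof. by rewrite /word_op big_map. Qed.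

Lemma block_words_prod e n b :
  \sum_(w <- block_words e n b) word_op w =
  \prod_(k <- b) \sum_(w <- sorted_words e n k) word_op w.
Proof.
elim: b => [|k b IHb] /=; first by rewrite big_seq1 /word_op !big_nil.
rewrite big_allpairs_dep big_cons -IHb mulr_suml; apply: eq_bigr => v _.
by rewrite mulr_sumr; apply: eq_bigr => w _; rewrite word_op_cat.
Qed.

Fixpoint hom (n k : nat) : A :=
  if n is n'.+1 then \sum_(i < k.+1) hom n' (k - i) * u n' ^+ i else (k == 0%N)%:R.

Lemma hom_n0 n : hom n 0 = 1.
Proof. by elim: n => //= n IHn; rewrite big_ord_recl big_ord0 addr0 IHn mulr1. Qed.

Lemma homS n k : hom n.+1 k.+1 = hom n k.+1 + hom n.+1 k * u n.
Proof.
rewrite /= big_ord_recl subn0 mulr1; congr (_ + _); rewrite mulr_suml.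
by apply: eq_bigr => i _; rewrite lift0 subSS exprSr mulrA.
Qed.

Arguments hom : simpl never.

Lemma perm_sum_word_op (s t : seq (seq nat)) : uniq s -> uniq t -> s =i t ->
  \sum_(w <- s) word_op w = \sum_(w <- t) word_op w.
Proof. by move=> us ut st; apply/perm_big/uniq_perm. Qed.

(** A strictly decreasing word either starts with its largest possible letter or
    avoids it. *)
Lemma elem_sum n k : elem u n k%:Z = \sum_(w <- sorted_words gtn n k) word_op w.
Proof.
elim: n k => [|n IHn] [|k] /=; rewrite ?eqxx.
- by rewrite /sorted_words /= big_seq1 /word_op big_nil.
- by rewrite /sorted_words /= big_nil.
- by rewrite elem_neg // mulr0 add0r IHn /sorted_words /=.
rewrite (_ : k.+1%:Z - 1 = k) ?IHn; last by lia.
transitivity (\sum_(w <- [seq n.+1 :: w | w <- sorted_words gtn n k] ++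
    sorted_words gtn n k.+1) word_op w).
  rewrite big_cat big_map mulr_sumr; congr (_ + _).
  by apply: eq_bigr => w _; rewrite /word_op big_cons.
apply: perm_sum_word_op.
- rewrite cat_uniq map_inj_uniq ?filter_uniq ?words_le_uniq //; last by move=> ? ? [].
  rewrite andbT; apply/hasPn => w; rewrite mem_sorted_words => /and3P[_ _ lw].
  apply/mapP => -[v _ E]; move: lw; rewrite E /= ltnn //.
- by rewrite filter_uniq ?words_le_uniq.
move=> w; rewrite mem_cat [in LHS]mem_sorted_words [in RHS]mem_sorted_words.
case: w => [|x w]; first by rewrite /= orbF; apply/mapP => -[].
rewrite /= eqSS; apply/orP/idP => [[/mapP[v]|]|].
- rewrite mem_sorted_words => /and3P[sv /eqP <- lv] [-> ->]; rewrite eqxx /=.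
  apply/and3P; split; last by apply: sub_all lv => a; lia.
    by rewrite path_min_sorted //; apply: sub_all lv => a /=; lia.
  by rewrite leqnn.
- by case/and4P => -> -> xn lw /=; apply/andP; split; [lia|apply: sub_all lw => a; lia].
case/and4P => pw sw xn lw.
have lt : all (gtn x) w by apply: (order_path_min _ pw) => a b c /=; lia.
have [xn'|xn'] := eqVneq x n.+1.
  left; apply/mapP; exists w; last by rewrite xn'.
  rewrite mem_sorted_words (path_sorted pw) sw /=; apply/allP => a aw.
  by have := allP lw a aw; have /= := allP lt a aw; lia.
right; rewrite pw sw /=; apply/andP; split; first by lia.
by apply/allP => a aw; have := allP lw a aw; have /= := allP lt a aw; lia.
Qed.

(** A weakly increasing word either ends with its largest possible letter or avoids
    it. *)
Lemma hom_sum n k : hom n k = \sum_(w <- sorted_words leq n k) word_op w.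
Proof.
elim: n k => [|n IHn].
  by case=> [|k]; rewrite /sorted_words /= ?big_seq1 ?big_nil // /word_op big_nil.
elim=> [|k IHk].
  by rewrite hom_n0 /sorted_words /= big_seq1 /word_op big_nil.
rewrite homS IHk IHn addrC.
transitivity (\sum_(w <- [seq rcons w n.+1 | w <- sorted_words leq n.+1 k] ++
    sorted_words leq n k.+1) word_op w).
  rewrite big_cat big_map mulr_suml; congr (_ + _).
  by apply: eq_bigr => w _; rewrite -cats1 word_op_cat /word_op big_seq1.
apply: perm_sum_word_op.
- rewrite cat_uniq map_inj_uniq ?filter_uniq ?words_le_uniq //; last first.
    by move=> v w; exact: rcons_injl.
  rewrite andbT; apply/hasPn => w; rewrite mem_sorted_words => /and3P[_ _ lw].
  apply/mapP => -[v _ E]; move: lw; rewrite E /letters_le all_rcons ltnn //.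
- by rewrite filter_uniq ?words_le_uniq.
move=> w; rewrite mem_cat [in LHS]mem_sorted_words [in RHS]mem_sorted_words.
case/lastP: w => [|w x]; first by rewrite /= orbF; apply/mapP => -[[]].
rewrite size_rcons eqSS /letters_le all_rcons -/(letters_le n w) -/(letters_le n.+1 w).
have srt (y : nat) v : sorted leq (rcons v y) = sorted leq v && all (geq y) v.
  by rewrite !(sorted_pairwise leq_trans) pairwise_rcons andbC.
apply/orP/idP => [[/mapP[v]|]|].
- rewrite mem_sorted_words => /and3P[sv /eqP <- lv] /rcons_inj[-> ->]; rewrite eqxx /=.
  rewrite srt sv all_rcons /= leqnn /=; apply/andP; split; last exact: lv.
  by apply: sub_all lv => a /=; lia.
- case/and4P => -> -> /andP[x0 xn] lw; rewrite all_rcons /= x0 leqW //=.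
  by apply: sub_all lw => a; lia.
rewrite srt all_rcons => /and4P[/andP[sw gw] kw xn lw].
have [xn'|xn'] := eqVneq x n.+1.
  left; apply/mapP; exists w; last by rewrite xn'.
  by rewrite mem_sorted_words sw kw.
right; rewrite sw gw kw /=; apply/andP; split; first by lia.
by apply/allP => a aw; have := allP lw a aw; have /= := allP gw a aw; lia.
Qed.

(** The series H(t) and E(-t) are inverse to each other: the factor of the largest
    letter is the last one of H(t) and the first one of E(-t), so these factors
    cancel one letter after the other. *)
Lemma hom_elem n k : \sum_(i < k.+1) (-1) ^+ i * (hom n (k - i) * elem u n i%:Z) =
  (k == 0%N)%:R.
Proof.
elim: n k => [|n IHn] k.
  rewrite big_ord_recl /= subn0 mul1r mulr1 big1 ?addr0 // => i _.
  by rewrite mulr0 mulr0.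
case: k => [|k].
  by rewrite big_ord_recl big_ord0 hom_n0 elem0 !mulr1 addr0.
rewrite -IHn /=.
transitivity (\sum_(i < k.+2) (-1) ^+ i * (hom n.+1 (k.+1 - i) * (u n * elem u n (i%:Z - 1)))
   + \sum_(i < k.+2) (-1) ^+ i * (hom n.+1 (k.+1 - i) * elem u n i%:Z)).
  by rewrite -big_split; apply: eq_bigr => i _ /=; rewrite -!mulrDr.
rewrite big_ord_recl elem_neg // !mulr0 add0r.
rewrite [X in _ + X]big_ord_recr [in RHS]big_ord_recr /= subnn !hom_n0 addrA; congr (_ + _).
rewrite -big_split; apply: eq_bigr => i _ /=.
rewrite /bump leq0n add1n (_ : i.+1%:Z - 1 = i) /=; last by lia.
rewrite subSS subSn; last by have := ltn_ord i; lia.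
rewrite homS exprS mulN1r mulNr mulrDl mulrDr -[X in _ + (_ + _ * X)]mulrA.
by rewrite addrCA addNr addr0.
Qed.
End SortedSums.

(** * The Pieri rule for Jacobi-Trudi determinants *)

Section Shapes.
Variables r' B' : nat.
Notation r := r'.+1.
Notation B := B'.+1.
(** Shapes have a fixed number of rows, padded with zeros, and a fixed bound on the
    parts, so that they form a finite type. *)
Definition shape_vec := {ffun 'I_r -> 'I_B}.
Implicit Types f g : shape_vec.

Definition part_at f (k : nat) : nat := if insub k is Some i then val (f i) else 0%N.
Definition weight f : nat := (\sum_i f i)%N.
Definition is_shape f := [forall i : 'I_r, (0 < i)%N ==> (f i <= part_at f i.-1)%N].
Definition hstrip f g := [forall i : 'I_r,
  (f i <= g i)%N && ((0 < i)%N ==> (g i <= part_at f i.-1)%N)].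
Definition vstrip f g := [forall i : 'I_r, (f i <= g i <= (f i).+1)%N].

Lemma part_atE f (i : 'I_r) : part_at f i = f i.
Proof. by rewrite /part_at valK. Qed.
End Shapes.

Section Pieri.
Variables (C : comNzRingType) (e : int -> C) (r' B' N : nat).
Notation r := r'.+1.
Notation B := B'.+1.
Hypothesis e_neg : forall k : int, k < 0 -> e k = 0.
Hypothesis e0 : e 0 = 1.
Hypothesis e_gt : forall k : int, N%:Z < k -> e k = 0.
Hypothesis hB : (N + r <= B)%N.
Implicit Types f g : shape_vec r' B'.

Definition jacobi_trudi f : C :=
  \det (\matrix_(i < r, j < r) e ((f i)%:Z + j%:Z - i%:Z)).

(** The condition on one row of the larger shape of a horizontal strip. It depends
    on that row only, which is why sums over strips are determinants. *)
Definition strip_row f (i : 'I_r) (m : nat) :=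
  (f i <= m)%N && ((0 < i)%N ==> (m <= part_at f i.-1)%N).

Definition row_mx_poly (Q : 'I_r -> pred nat) : 'M[{poly C}]_r :=
  \matrix_(i, j) \sum_(m < B | Q i m) e (m%:Z + j%:Z - i%:Z) *: 'X^m.

(** Multilinearity in the rows: a sum over shapes whose rows vary independently is
    a single determinant, with t marking the weight. *)
Lemma det_row_mx_poly (Q : 'I_r -> pred nat) :
  \det (row_mx_poly Q) =
  \sum_(g : shape_vec r' B' | [forall i, Q i (g i)]) jacobi_trudi g *: 'X^(weight g).
Proof.
rewrite /determinant.
transitivity (\sum_(s : 'S_r) \sum_(g : shape_vec r' B' | [forall i, Q i (g i)])
   (-1) ^+ s * \prod_(i < r) (e ((g i)%:Z + (s i)%:Z - i%:Z) *: 'X^(g i) : {poly C})).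
  apply: eq_bigr => s _; rewrite -mulr_sumr; congr (_ * _).
  under eq_bigr => i _ do rewrite mxE.
  rewrite (bigA_distr_big_dep _ (fun (i : 'I_r) (m : 'I_B) =>
     e (m%:Z + (s i)%:Z - i%:Z) *: 'X^m : {poly C})) /=.
  apply: eq_bigl => g; apply/familyP/forallP => h i; exact: h.
rewrite exchange_big; apply: eq_bigr => g _ /=.
rewrite /jacobi_trudi /determinant scaler_suml; apply: eq_bigr => s _.
rewrite scaler_prod prodrXr !mulr_sign.
under [in RHS]eq_bigr => i _ do rewrite mxE.
by case: ifP => _; rewrite ?scaleNr.
Qed.

Definition shift_mx : 'M[{poly C}]_r := \matrix_(i, j) ((i : nat) == j.+1)%:R.
(** Unitriangular: multiplying by it on the left subtracts t times the previous row
    from each row, and on the right t times the next column from each column. *)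
Definition step_mx : 'M[{poly C}]_r := 1%:M - 'X *: shift_mx.

Lemma det_step_mx : \det step_mx = 1.
Proof.
rewrite det_trig; last first.
  apply/is_trig_mxP => i j ij; rewrite !mxE -val_eqE ltn_eqF //=.
  by rewrite (_ : _ == _.+1 = false) ?mulr0 ?subr0 //; lia.
rewrite big1 // => i _; rewrite !mxE eqxx (_ : _ == _.+1 = false) ?mulr0 ?subr0 //.
lia.
Qed.

Lemma step_mx_row (M : 'M[{poly C}]_r) i j :
  (step_mx *m M) i j = M i j - 'X * (if (0 < i)%N then M (inord i.-1) j else 0).
Proof.
rewrite mulmxBl mul1mx -scalemxAl !mxE; congr (_ - 'X * _).
case: ifP => i0.
  have hi : (i.-1 < r)%N by have := ltn_ord i; lia.
  rewrite (bigD1 (inord i.-1)) //= mxE inordK // prednK // eqxx mul1r.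
  rewrite big1 ?addr0 // => k; rewrite -val_eqE /= inordK // mxE => ki.
  by rewrite (_ : _ == _.+1 = false) ?mul0r //; lia.
by rewrite big1 // => k _; rewrite mxE (_ : _ == _.+1 = false) ?mul0r //; lia.
Qed.

Lemma step_mx_col (M : 'M[{poly C}]_r) i j :
  (M *m step_mx) i j = M i j - 'X * (if (j.+1 < r)%N then M i (inord j.+1) else 0).
Proof.
rewrite mulmxBr mulmx1 -scalemxAr !mxE; congr (_ - 'X * _).
case: ifP => j1.
  rewrite (bigD1 (inord j.+1)) //= mxE inordK // eqxx mulr1.
  rewrite big1 ?addr0 // => k; rewrite -val_eqE /= inordK // mxE => /negPf ->.
  by rewrite mulr0.
rewrite big1 // => k _; rewrite mxE (_ : _ == _.+1 = false) ?mulr0 //.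
by have := ltn_ord k; lia.
Qed.

Let geq_row f (i : 'I_r) (m : nat) := (f i <= m)%N.

(** The condition on t discards the term m = B of the shifted sum. *)
Lemma row_shift (a : nat) (t : int) : N%:Z < B%:Z + t ->
  'X * (\sum_(m < B | (a <= m)%N) e (m%:Z + (t + 1)) *: ('X^m : {poly C})) =
  \sum_(m < B | (a < m)%N) e (m%:Z + t) *: 'X^m.
Proof.
move=> tB; pose F (m : nat) : {poly C} := e (m%:Z + t) *: 'X^m.
rewrite (_ : \sum_(_ < _ | (_ < _)%N) _ = \sum_(a.+1 <= m < B) F m); last by rewrite big_geq_mkord.
rewrite (_ : _ * _ = \sum_(a <= m < B) F m.+1); last first.
  rewrite big_geq_mkord mulr_sumr; apply: eq_bigr => m _.
  by rewrite /F -scalerAr exprS; congr (e _ *: _); lia.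
have [aB|Ba] := ltnP a B; last by rewrite !big_geq //; lia.
rewrite -[RHS]addr0 -[X in _ = _ + X](_ : F B = 0); last first.
  by rewrite /F e_gt ?scale0r //; lia.
by rewrite -(@big_nat_recr _ _ _ B a.+1) // big_add1.
Qed.

(** In the matrix without upper bounds, the terms m > f_{i-1} of row i are t times
    row i-1. So imposing the upper bounds of a strip amounts to row operations. *)
Lemma det_strip_rows f : is_shape f ->
  \det (row_mx_poly (strip_row f)) = \det (row_mx_poly (geq_row f)).
Proof.
move=> /forallP hf.
rewrite -[RHS]mul1r -det_step_mx -det_mulmx; congr (\det _).
apply/matrixP => i j; rewrite step_mx_row !mxE /strip_row.
case: ifP => [i0|/negbT i0]; last first.
  rewrite mulr0 subr0; apply: eq_bigl => m.
  by rewrite andbT.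
have hi : (i.-1 < r)%N by have := ltn_ord i; lia.
have fi := hf i; rewrite i0 /= in fi.
pose k : 'I_r := inord i.-1.
have kE : (k : nat) = i.-1 by rewrite inordK.
have pE : part_at f i.-1 = f k by rewrite -kE part_atE.
rewrite -/k /geq_row pE; rewrite pE in fi.
apply/eqP; rewrite eq_sym subr_eq; apply/eqP.
have jr := ltn_ord j; have ir := ltn_ord i.
rewrite (eq_bigr (fun m : 'I_B => e (m%:Z + (j%:Z - i%:Z + 1)) *: 'X^m)
  (P := fun m : 'I_B => (f k <= m)%N)); last first.
  by move=> m _; congr (e _ *: _); rewrite kE; lia.
rewrite row_shift; last by lia.
under eq_bigr => m _ do rewrite -addrA.
rewrite (bigID (fun m : 'I_B => (m <= f k)%N)) /=; congr (_ + _).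
  by apply: eq_big => m; [lia | rewrite addrA].
by apply: eq_bigl => m; lia.
Qed.

(** Column operations reduce all columns but the last to single terms. The last row,
    where f is zero, then has only its last entry, which is E(t). *)
Lemma det_full_rows f : (f ord_max = 0 :> nat) ->
  \det (row_mx_poly (geq_row f)) =
  (\sum_(m < B) e m%:Z *: 'X^m) * (jacobi_trudi f *: 'X^(weight f)).
Proof.
move=> f0; pose Q : 'M[{poly C}]_r :=
  \matrix_(i, j) (e ((f i)%:Z + j%:Z - i%:Z) *: 'X^(f i)).
have -> : jacobi_trudi f *: 'X^(weight f) = \det Q.
  rewrite /jacobi_trudi /determinant scaler_suml; apply: eq_bigr => s _.
  under [in RHS]eq_bigr => i _ do rewrite mxE.
  rewrite scaler_prod prodrXr !mulr_sign.
  under eq_bigr => i _ do rewrite mxE.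
  by case: ifP => _; rewrite ?scaleNr.
rewrite -[LHS]mulr1 -det_step_mx -det_mulmx; set M := _ *m _.
have MQ (i j : 'I_r) : (j < r')%N -> M i j = Q i j.
  move=> jr; rewrite /M step_mx_col !mxE ltnS jr inordK ?ltnS // /geq_row.
  rewrite [in 'X * _](eq_bigr (fun m : 'I_B => e (m%:Z + (j%:Z - i%:Z + 1)) *: 'X^m));
    last by move=> m _; congr (e _ *: _); lia.
  have ir := ltn_ord i.
  rewrite row_shift; last by lia.
  rewrite (bigD1 (f i)) //= -addrA -[RHS]addr0; congr (_ + _).
  apply/eqP; rewrite subr_eq0; apply/eqP/eq_big => m; last by rewrite addrA.
  by rewrite -val_eqE /=; lia.
rewrite (expand_det_row M ord_max) (expand_det_row Q ord_max).
rewrite (bigD1 ord_max) //= [X in _ = _ * X](bigD1 ord_max) //=.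
rewrite big1 ?addr0; last first.
  move=> j jm; have jr : (j < r')%N.
    by move: jm (ltn_ord j); rewrite -val_eqE /=; lia.
  by rewrite MQ // mxE f0 e_neg ?scale0r ?mul0r //; move: jr => /=; lia.
rewrite [X in _ = _ * (_ + X)]big1 ?addr0; last first.
  move=> j jm; have jr : (j < r')%N.
    by move: jm (ltn_ord j); rewrite -val_eqE /=; lia.
  by rewrite mxE f0 e_neg ?scale0r ?mul0r //; move: jr => /=; lia.
rewrite [RHS]mulrA; congr (_ * _).
  rewrite /M step_mx_col ltnn mulr0 subr0 !mxE f0 add0r subrr e0 scale1r expr0 mulr1.
  by apply: eq_big => m; rewrite /geq_row ?f0 // => _; congr (e _ *: _); lia.
rewrite /cofactor; congr (_ * \det _); apply/matrixP => i j.
do 2 rewrite [LHS]mxE [RHS]mxE; rewrite MQ // /lift /= /bump.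
by have := ltn_ord j; rewrite /=; lia.
Qed.

(** Compare the coefficients of t^(|f| + k) in the two evaluations of the same
    determinant. An empty last row leaves room for the strip. *)
Lemma pieri_strip f k : is_shape f -> (f ord_max = 0 :> nat) -> (k < B)%N ->
  jacobi_trudi f * e k%:Z =
  \sum_(g : shape_vec r' B' | hstrip f g && (weight g == weight f + k)%N)
    jacobi_trudi g.
Proof.
move=> hf f0 kB; have := det_full_rows f0; rewrite -det_strip_rows // det_row_mx_poly.
move/(congr1 (coefp (weight f + k))); rewrite /coefp /= => E.
have <- : ((\sum_(m < B) e m%:Z *: 'X^m) * (jacobi_trudi f *: 'X^(weight f)))`_(weight f + k)
    = jacobi_trudi f * e k%:Z.
  rewrite -scalerAr coefZ coefMXn ltnNge leq_addr /= addKn.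
  rewrite coef_sum (bigD1 (Ordinal kB)) //= coefZ coefXn eqxx mulr1 big1 ?addr0 //.
  by move=> m; rewrite -val_eqE /= => mk; rewrite coefZ coefXn eq_sym (negPf mk) mulr0.
rewrite -E coef_sum big_mkcondr /=; apply: eq_bigr => g _.
by rewrite coefZ coefXn eq_sym; case: eqP; rewrite ?mulr1 ?mulr0.
Qed.
End Pieri.

(** * Strips, conjugate shapes and the dual Pieri rule *)

Lemma card_ord_lt n m : (m <= n)%N -> #|[pred i : 'I_n | (i < m)%N]| = m.
Proof.
by move=> mn; rewrite -sum1_card -(big_ord_widen _ (fun=> 1%N) mn) sum_nat_const card_ord muln1.
Qed.

Section ShapeTheory.
Variables r' B' : nat.
Notation r := r'.+1.
Notation B := B'.+1.
Notation F := (shape_vec r' B').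
Implicit Types f g : F.

Lemma hstripP f g : reflect
  ((forall i, (f i <= g i)%N) /\ (forall i j : 'I_r, j = i.+1 :> nat -> (g j <= f i)%N))
  (hstrip f g).
Proof.
apply: (iffP forallP) => [h|[h1 h2] i]; first split=> [i|i j ji].
- by have /andP[] := h i.
- by have := h j; rewrite ji /= part_atE => /andP[].
rewrite h1 /=; apply/implyP => i0.
have hi : (i.-1 < r)%N by have := ltn_ord i; lia.
by rewrite -[i.-1]/(val (Ordinal hi)) part_atE h2 //= prednK.
Qed.

Lemma is_shapeP f : reflect (forall i j : 'I_r, j = i.+1 :> nat -> (f j <= f i)%N)
  (is_shape f).
Proof.
apply: (iffP forallP) => [h i j ji|h i].
  by have := h j; rewrite ji /= part_atE.
apply/implyP => i0; have hi : (i.-1 < r)%N by have := ltn_ord i; lia.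
by rewrite -[i.-1]/(val (Ordinal hi)) part_atE h //= prednK.
Qed.

Lemma shape_mono f (i j : 'I_r) : is_shape f -> (i <= j)%N -> (f j <= f i)%N.
Proof.
move=> /is_shapeP h; move: i j; suff: forall d (i j : 'I_r), j = (i + d)%N :> nat -> (f j <= f i)%N.
  by move=> hd i j ij; apply: (hd (j - i)%N); rewrite subnKC.
elim=> [|d IHd] i j ij.
  by rewrite (_ : j = i) //; apply: val_inj; rewrite /= ij addn0.
have hi : (i + d < r)%N by have := ltn_ord j; lia.
apply: leq_trans (IHd i (Ordinal hi) erefl).
by apply: h; rewrite ij addnS.
Qed.

Lemma hstrip_shape f g : hstrip f g -> is_shape f /\ is_shape g.
Proof.
move=> /hstripP[h1 h2]; split; apply/is_shapeP => i j ij.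
  by apply: leq_trans (h1 j) (h2 i j ij).
by apply: leq_trans (h2 i j ij) (h1 i).
Qed.

Lemma hstrip_weight f g : hstrip f g -> (weight f <= weight g)%N.
Proof. by move=> /hstripP[h _]; apply: leq_sum => i _. Qed.

Lemma leq_weight f i : (f i <= weight f)%N.
Proof. by rewrite /weight (bigD1 i) //= leq_addr. Qed.

Lemma shape_last f : is_shape f -> (weight f <= r')%N -> f ord_max = 0%N :> nat.
Proof.
move=> sf wf; apply/eqP; rewrite -leqn0 leqNgt; apply/negP => f0.
suff: (r <= weight f)%N by lia.
rewrite -[X in (X <= _)%N]card_ord -sum1_card; apply: leq_sum => i _.
by apply: leq_trans f0 _; apply: shape_mono => //; rewrite -ltnS.
Qed.

Lemma weight0 f : weight f = 0%N -> forall i, f i = 0%N :> nat.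
Proof. by move=> f0 i; have := leq_weight f i; rewrite f0 leqn0 => /eqP. Qed.

Definition conj_shape f : F := [ffun j : 'I_r => inord #|[pred i : 'I_r | (j < f i)%N]|].

(** An initial segment is determined by its cardinality. *)
Lemma card_initial (P : pred 'I_r) (i : 'I_r) :
  (forall i j : 'I_r, (i <= j)%N -> P j -> P i) -> (i < #|P|)%N = P i.
Proof.
move=> hP; apply/idP/idP => [|Pi]; last first.
  rewrite -[X in (X <= _)%N](@card_ord_lt r); last by have := ltn_ord i.
  by apply/subset_leq_card/fintype.subsetP => k; rewrite !inE ltnS => /hP; apply.
apply: contraLR => nPi; rewrite -leqNgt -[X in (_ <= X)%N](@card_ord_lt r); last by have := ltn_ord i; lia.
apply/subset_leq_card/fintype.subsetP => k Pk; rewrite !inE ltnNge.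
by apply: contra nPi => /hP; apply.
Qed.

Hypothesis rB : (r < B)%N.

Lemma card_lt_bound (P : pred 'I_r) : (#|P| < B)%N.
Proof. by apply: leq_ltn_trans rB; rewrite -[X in (_ <= X)%N]card_ord max_card. Qed.

Lemma conj_shapeE f (i j : 'I_r) : is_shape f -> (i < conj_shape f j)%N = (j < f i)%N.
Proof.
move=> sf; rewrite ffunE inordK ?card_lt_bound // card_initial //= => a b ab /leq_trans; apply.
exact: shape_mono.
Qed.

Lemma leq_test a b : (a <= r)%N -> (forall i : 'I_r, (i < a)%N -> (i < b)%N) -> (a <= b)%N.
Proof.
case: a => // a ar h; exact: (h (Ordinal ar)).
Qed.

Lemma conj_le_r f j : (conj_shape f j <= r)%N.
Proof.
rewrite ffunE inordK ?card_lt_bound //.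
by rewrite -[X in (_ <= X)%N]card_ord max_card.
Qed.

Lemma conj_is_shape f : is_shape f -> is_shape (conj_shape f).
Proof.
move=> sf; apply/is_shapeP => i j ij; apply: leq_test (conj_le_r f j) _ => k.
by rewrite !conj_shapeE // ij; exact: ltnW.
Qed.

Lemma conj_weight f : is_shape f -> (weight f <= r')%N -> weight (conj_shape f) = weight f.
Proof.
move=> sf wf; rewrite /weight.
under eq_bigr => j _.
  rewrite ffunE inordK ?card_lt_bound //.
  rewrite -sum1_card big_mkcond /=; over.
rewrite exchange_big; apply: eq_bigr => i _ /=.
have fr : (f i <= r)%N by have := leq_weight f i; lia.
by rewrite -big_mkcond -(big_ord_widen _ (fun=> 1%N) fr) sum_nat_const card_ord muln1.
Qed.

Lemma conj_shapeK f : is_shape f -> (weight f <= r')%N -> conj_shape (conj_shape f) = f.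
Proof.
move=> sf wf; apply/ffunP => i; apply: val_inj => /=.
have fr : (f i <= r)%N by have := leq_weight f i; lia.
have sc := conj_is_shape sf.
apply/eqP; rewrite eqn_leq; apply/andP; split; apply: leq_test => //; try exact: conj_le_r.
  by move=> j; rewrite conj_shapeE // conj_shapeE.
by move=> j; rewrite conj_shapeE // conj_shapeE.
Qed.

Lemma conj_strip f g : is_shape f -> is_shape g ->
  (weight f <= r')%N -> (weight g <= r')%N ->
  vstrip (conj_shape f) (conj_shape g) = hstrip f g.
Proof.
move=> sf sg wf wg.
have fr i : (f i <= r)%N by have := leq_weight f i; lia.
have gr i : (g i <= r)%N by have := leq_weight g i; lia.
apply/forallP/hstripP => [h|[h1 h2] j].
  split=> [i|i j ij].
    apply: leq_test => // j; rewrite -(conj_shapeE i j sf) -(conj_shapeE i j sg).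
    move=> /leq_trans; apply.
    by have /andP[] := h j.
  apply: leq_test => // k; rewrite -(conj_shapeE j k sg) -(conj_shapeE i k sf).
  have /andP[_] := h k.
  by rewrite ij => h1 h2; have := leq_trans h2 h1.
apply/andP; split; apply: leq_test; try exact: conj_le_r.
  by move=> i; rewrite (conj_shapeE i j sf) (conj_shapeE i j sg) => /leq_trans; apply.
case=> -[//|i] ir; rewrite (conj_shapeE _ j sg) ltnS.
rewrite -[i.+1]/(Ordinal (ltnW ir)).+1 (conj_shapeE _ j sf).
by move=> /leq_trans; apply; apply: h2.
Qed.

End ShapeTheory.

Section Chains.
Variables r' B' : nat.
Notation r := r'.+1.
Notation B := B'.+1.
Notation F := (shape_vec r' B').
Implicit Types f g : F.

(** The first entry of the list is the size of the last strip. *)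
Fixpoint strip_chains (b : seq nat) f : nat :=
  if b is k :: b' then
    (\sum_(g : F | hstrip g f && (weight f == weight g + k)%N) strip_chains b' g)%N
  else (weight f == 0)%N.

(** Iterating the Pieri rule. This is stated for any family J, because it is also
    applied to conjugate shapes. *)
Lemma chain_expansion (C : comNzRingType) (p : nat -> C) (J : F -> C) :
  (forall f, weight f = 0%N -> J f = 1) ->
  (forall f k, is_shape f -> (weight f + k <= r')%N ->
    J f * p k = \sum_(g : F | hstrip f g && (weight g == weight f + k)%N) J g) ->
  forall b, (sumn b <= r')%N ->
  \prod_(k <- b) p k =
  \sum_(f : F | is_shape f && (weight f == sumn b)) (strip_chains b f)%:R * J f.
Proof.
move=> J0 hJ; elim=> [|k b IHb] /= hb.
  pose z : F := [ffun=> ord0].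
  have wz : weight z = 0%N by rewrite /weight big1 // => i _; rewrite ffunE.
  rewrite big_nil (bigD1 z) /=; last first.
    rewrite wz eqxx andbT; apply/is_shapeP => i j _; rewrite !ffunE //.
  rewrite wz eqxx mul1r J0 // big1 ?addr0 // => f /andP[/andP[_ /eqP wf]].
  case/eqP; apply/ffunP => i; apply: val_inj; rewrite ffunE; exact: weight0.
rewrite big_cons IHb; last by lia.
rewrite mulr_sumr.
under eq_bigr => g /andP[sg /eqP wg].
  rewrite mulrC -mulrA hJ //; last by lia.
  rewrite mulr_sumr; over.
rewrite (exchange_big_dep (fun f => is_shape f && (weight f == k + sumn b)%N)) /=; last first.
  by move=> g f /andP[_ /eqP->] /andP[/hstrip_shape[_ ->] /eqP->]; rewrite addnC eqxx.
apply: eq_bigr => f /andP[sf /eqP wf].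
rewrite natr_sum mulr_suml; apply: eq_bigl => g.
apply/idP/idP => [/andP[/andP[_ /eqP wg] /andP[-> _]]|/andP[h /eqP wg]].
  by rewrite wf wg addnC eqxx.
have [-> _] := hstrip_shape h; rewrite h wg eqxx /= !andbT.
by apply/eqP; lia.
Qed.
End Chains.

Section DualPieri.
Variables (C : comNzRingType) (e : int -> C) (h : nat -> C) (r' B' N : nat).
Notation r := r'.+1.
Notation B := B'.+1.
Notation F := (shape_vec r' B').
Hypothesis e_neg : forall k : int, k < 0 -> e k = 0.
Hypothesis e0 : e 0 = 1.
Hypothesis e_gt : forall k : int, N%:Z < k -> e k = 0.
Hypothesis hB : (N + r <= B)%N.
Hypothesis h0 : h 0 = 1.
Hypothesis he : forall k, (0 < k)%N ->
  \sum_(i < k.+1) (-1) ^+ i * (h (k - i)%N * e i%:Z) = 0.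
Implicit Types f g : F.

Lemma pieri_hstrip f k : is_shape f -> (weight f + k <= r')%N ->
  jacobi_trudi e f * e k%:Z =
  \sum_(g : F | hstrip f g && (weight g == weight f + k)%N) jacobi_trudi e g.
Proof.
move=> sf wf; apply: (pieri_strip e_neg e0 e_gt hB) => //; last by lia.
by apply: shape_last => //; lia.
Qed.

(** The choices for the rows of v are independent, so the sum is a product over
    rows. In the last row where f and g differ, both values f_i and f_i + 1 are
    allowed or none is, and the factor of that row is zero. *)
Lemma strip_toggle f g : is_shape f -> f != g ->
  \sum_(v : F | vstrip f v && hstrip v g) (-1) ^+ weight v = 0 :> C.
Proof.
move=> sf fg.
pose Q (i : 'I_r) (x : 'I_B) := [&& (f i <= x <= (f i).+1)%N, (x <= g i)%N &
  [forall j : 'I_r, (j == i.+1 :> nat) ==> (g j <= x)%N]].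
rewrite (eq_bigl (mem (family Q))) => [|v]; last first.
  apply/andP/familyP => [[/forallP v1 /hstripP[v2 v3]] i|hQ].
    rewrite -topredE /= /Q v1 v2 /=; apply/forallP => j; apply/implyP => /eqP; exact: v3.
  split; first by apply/forallP => i; have := hQ i; rewrite -topredE => /and3P[].
  apply/hstripP; split=> [i|i j ij]; have := hQ i; rewrite -topredE => /and3P[] //.
  by move=> _ _ /forallP/(_ j); rewrite ij eqxx.
under eq_bigr => v _ do rewrite /weight -prodrXr.
rewrite -(bigA_distr_big_dep _ (fun (i : 'I_r) (x : 'I_B) => (-1) ^+ x)) /=.
have [i0 hi0] : exists i, f i != g i.
  apply/existsP; apply: contraNT fg; rewrite negb_exists => /forallP E.
  by apply/eqP/ffunP => i; have := E i; rewrite negbK => /eqP.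
(* i is the last row where the two shapes differ *)
case: (@arg_maxnP _ i0 (fun i => f i != g i) (fun i => i) hi0) => i fgi imax.
rewrite (bigD1 i) //= (_ : \sum_(_ | _) _ = 0) ?mul0r //.
move: fgi; rewrite -val_eqE neq_ltn /= => /orP[fgi|gfi]; last first.
  by rewrite big1 // => x; rewrite /Q => /and3P[]; lia.
have hf1 : ((f i).+1 < B)%N by have := ltn_ord (g i); lia.
have next (j : 'I_r) : j = i.+1 :> nat -> (g j <= f i)%N.
  move=> ji; have /eqP <- : f j == g j.
    by apply: contraT => /imax; rewrite /= ji ltnn.
  by move/is_shapeP : sf; apply.
rewrite (bigD1 (f i)) /=; last first.
  rewrite /Q leqnn leqnSn (ltnW fgi) /=; apply/forallP => j; apply/implyP => /eqP; exact: next.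
rewrite (bigD1 (Ordinal hf1)) /=; last first.
  rewrite -val_eqE /= (gtn_eqF (ltnSn _)) /Q /= leqnSn leqnn fgi /= andbT.
  apply/forallP => j; apply/implyP => /eqP /next; exact: leqW.
rewrite big1 ?addr0 ?exprS ?mulN1r ?subrr // => x.
by rewrite -!val_eqE /= /Q => /andP[/andP[/and3P[]]]; lia.
Qed.

Let vsum f k := \sum_(g : F | [&& is_shape g, vstrip f g &
  weight g == weight f + k]%N) jacobi_trudi e g.

(** Add a vertical strip and then a horizontal one: the signed number of ways to go
    from f to a larger shape is zero by [strip_toggle]. *)
Lemma vsum_elem f k : is_shape f -> (weight f + k <= r')%N -> (0 < k)%N ->
  \sum_(i < k.+1) (-1) ^+ i * (vsum f (k - i) * e i%:Z) = 0.
Proof.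
move=> sf wf k0.
transitivity (\sum_(m : F | (weight m == weight f + k)%N)
   ((-1) ^+ weight m * jacobi_trudi e m *
     \sum_(v : F | vstrip f v && hstrip v m) (-1) ^+ weight v)); last first.
  rewrite big1 // => m /eqP wm; rewrite strip_toggle ?mulr0 //.
  by apply/eqP => fm; move: wm; rewrite fm; lia.
have vw v : vstrip f v -> (weight f <= weight v)%N.
  by move=> /forallP hv; apply: leq_sum => i _; have /andP[] := hv i.
under [RHS]eq_bigr => m _ do rewrite mulr_sumr.
rewrite (exchange_big_dep (fun v => [&& is_shape v, vstrip f v &
  (weight v <= weight f + k)%N])) /=; last first.
  move=> m v /eqP <- /andP[-> hv]; have [-> _] := hstrip_shape hv.
  by rewrite hstrip_weight.
rewrite (partition_big (fun v : F => inord (weight f + k - weight v) : 'I_k.+1) predT) //=.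
apply: eq_bigr => i _; have ik := ltn_ord i.
rewrite mulr_suml mulr_sumr.
apply: eq_big => v.
  case: (is_shape v) => //=; case: (boolP (vstrip f v)) => //= /vw hv.
  apply/eqP/andP => [wv|[wv /eqP/(congr1 val)]].
    split; first by lia.
    by apply/eqP/val_inj; rewrite /= inordK; lia.
  by rewrite /= inordK; lia.
move=> /and3P[sv vv /eqP wv].
rewrite pieri_hstrip //; last by lia.
rewrite mulr_sumr; apply: eq_big => m.
  by rewrite vv /= andbC; congr (_ && _); apply/eqP/eqP; lia.
move=> /andP[_ /eqP wm].
rewrite [RHS]mulrAC -exprD wm; congr (_ * _).
rewrite -[LHS]signr_odd -[RHS]signr_odd; congr (_ ^+ nat_of_bool _).
by rewrite !oddD; case: (odd (weight v)); case: (odd i).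
Qed.

(** The recursion [vsum_elem] for sums over vertical strips is also the one
    satisfied by the products with h_k. *)
Lemma pieri_vstrip f k : is_shape f -> (weight f + k <= r')%N ->
  jacobi_trudi e f * h k = vsum f k.
Proof.
move=> sf; elim/ltn_ind: k => -[|k] IHk wf.
  rewrite h0 mulr1 /vsum (bigD1 f) /=; last first.
    by rewrite sf addn0 eqxx andbT; apply/forallP => i; rewrite leqnn leqnSn.
  rewrite big1 ?addr0 // => g /andP[/and3P[_ /forallP vg /eqP wg] gf].
  case/eqP: gf; apply/ffunP => i; apply: val_inj => /=; apply/eqP.
  rewrite eqn_leq andbC; have /andP[-> _] /= := vg i.
  rewrite leqNgt; apply/negP => fg; suff: (weight f < weight g)%N by lia.
  rewrite /weight (bigD1 i) // [X in (_ < X)%N](bigD1 i) //= -addSn.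
  by apply: leq_add => //; apply: leq_sum => j _; have /andP[] := vg j.
have E1 := vsum_elem sf wf (ltn0Sn k).
have := congr1 (fun x => jacobi_trudi e f * x) (he (ltn0Sn k)).
rewrite mulr0 mulr_sumr => /(etrans E1 \o esym) /=.
rewrite big_ord_recl [in RHS]big_ord_recl /= !subn0 !expr0 !mul1r e0 !mulr1.
rewrite (_ : \sum_(i < k.+1) _ = \sum_(i < k.+1) jacobi_trudi e f *
    ((-1) ^+ lift ord0 i * (h (k.+1 - lift ord0 i)%N * e (lift ord0 i)%:Z))).
  by move=> /addIr ->.
apply: eq_bigr => i _; have := ltn_ord i => ik; rewrite -IHk /=; [|rewrite /bump; lia..].
by rewrite [RHS]mulrCA !mulrA.
Qed.

Lemma pieri_conj f k : (r < B)%N -> is_shape f -> (weight f + k <= r')%N ->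
  jacobi_trudi e (conj_shape f) * h k =
  \sum_(g : F | hstrip f g && (weight g == weight f + k)%N)
    jacobi_trudi e (conj_shape g).
Proof.
move=> rB sf wf; rewrite pieri_vstrip; first last.
- by rewrite conj_weight //; lia.
- exact: conj_is_shape.
rewrite /vsum (reindex_onto (@conj_shape r' B') (@conj_shape r' B')) /=; last first.
  move=> g /and3P[sg _ /eqP]; rewrite (conj_weight rB sf); last by lia.
  by move=> wg; rewrite conj_shapeK //; lia.
apply: eq_bigl => g; rewrite (conj_weight rB sf); last by lia.
apply/idP/idP => [/andP[/and3P[sg vg /eqP wg] /eqP gK]|/andP[hg /eqP wg]].
  have sg' : is_shape g by rewrite -gK conj_is_shape.
  have wg' : (weight g <= r')%N.
    by have := conj_weight rB sg; rewrite gK => ->; lia.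
  rewrite conj_weight // in wg.
  by rewrite -conj_strip // ?vg ?wg ?eqxx //; lia.
have [_ sg] := hstrip_shape hg.
rewrite conj_is_shape // conj_strip // ?hg ?conj_weight ?conj_shapeK ?wg ?eqxx //; lia.
Qed.
End DualPieri.

(** * Expansion of products into noncommutative Schur functions *)

Section Bicommutant.
Variables (A : nzRingType) (G : A -> Prop).

(** The elements commuting with everything that commutes with G. When the elements
    of G commute pairwise this is a commutative ring that contains G, in which the
    theory of determinants is available. *)
Definition bicommutant : {pred A} :=
  fun x => `[< forall y, (forall g, G g -> g * y = y * g) -> x * y = y * x >].

Lemma bicommutantP x : reflect
  (forall y, (forall g, G g -> g * y = y * g) -> x * y = y * x) (x \in bicommutant).
Proof. exact: asboolP. Qed.

Lemma bicommutant_subring : subring_closed bicommutant.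
Proof.
split=> [|x y /bicommutantP hx /bicommutantP hy|x y /bicommutantP hx /bicommutantP hy].
- by apply/bicommutantP => z _; rewrite mul1r mulr1.
- by apply/bicommutantP => z hz; rewrite mulrBl mulrBr hx // hy.
- by apply/bicommutantP => z hz; rewrite -mulrA hy // mulrA hx // mulrA.
Qed.

HB.instance Definition _ := GRing.isSubringClosed.Build A bicommutant bicommutant_subring.

Hypothesis commG : forall g h, G g -> G h -> g * h = h * g.

Lemma bicommutant_gen g : G g -> g \in bicommutant.
Proof. by move=> Gg; apply/bicommutantP => y; apply. Qed.

Lemma bicommutant_comm x y : x \in bicommutant -> y \in bicommutant -> x * y = y * x.
Proof.
move=> /bicommutantP hx /bicommutantP hy; apply: hx => g Gg.
by apply/esym/hy => h Gh; exact: commG.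
Qed.

(** The commutativity of G is a parameter of the type, so that the commutative ring
    structure can be inferred from the type alone. *)
Record bicomm (c : forall g h, G g -> G h -> g * h = h * g) :=
  Bicomm { bicomm_val :> A; _ : bicomm_val \in bicommutant }.
End Bicommutant.

Section BicommRing.
Variables (A : nzRingType) (G : A -> Prop).
Variable c : forall g h, G g -> G h -> g * h = h * g.
HB.instance Definition _ := [isSub for @bicomm_val A G c].
HB.instance Definition _ := [Choice of bicomm c by <:].
HB.instance Definition _ := [SubChoice_isSubNzRing of bicomm c by <:].

Lemma bicomm_mulC : commutative (@GRing.mul (bicomm c)).
Proof. by move=> x y; apply: val_inj; apply: (bicommutant_comm c); exact: valP. Qed.

HB.instance Definition _ := GRing.PzRing_hasCommutativeMul.Build (bicomm c) bicomm_mulC.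

Definition bval (x : bicomm c) : A := bicomm_val x.

Lemma bval_zmod : zmod_morphism bval. Proof. by []. Qed.
Lemma bval_monoid : monoid_morphism bval. Proof. by []. Qed.
HB.instance Definition _ := GRing.isZmodMorphism.Build (bicomm c) A bval bval_zmod.
HB.instance Definition _ := GRing.isMonoidMorphism.Build (bicomm c) A bval bval_monoid.
End BicommRing.

Local Notation shapes n := (shape_vec n (n + n).+1).

Section Expansion.
Variables (A : nzRingType) (u : nat -> A) (n : nat).
Hypothesis hFG : fomin_greene u n.

(** The noncommutative Schur function with column lengths f. *)
Definition schur_op (f : shapes n) : A :=
  ordered_det n.+1 (fun j p => elem u n ((part_at f j)%:Z + p%:Z - j%:Z)).

Lemma schur_op_positive f : is_shape f -> word_positive u (schur_op f).
Proof.
move=> sf; apply: jacobi_trudi_positive => // j.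
  rewrite /part_at; case: insubP => //= i ji ij; have jn : (j < n.+1)%N by lia.
  by rewrite insubT /=; move/is_shapeP : sf; apply; rewrite ij.
by rewrite leqNgt => nj; rewrite /part_at insubF //; apply/negbTE.
Qed.

Definition elem_fam (x : A) : Prop := exists k, x = elem u n k.

Lemma elem_fam_comm x y : elem_fam x -> elem_fam y -> x * y = y * x.
Proof. by move=> [p ->] [q ->]; apply: (elem_comm hFG). Qed.

Notation C := (bicomm elem_fam_comm).

Definition elemC (k : int) : C :=
  Bicomm elem_fam_comm (bicommutant_gen (ex_intro _ k erefl)).

(** The relation with the elementary functions expresses h_k through the e_i and
    the h_j with j < k. *)
Lemma hom_in k : hom u n k \in bicommutant elem_fam.
Proof.
elim/ltn_ind: k => -[|k] IHk; first by rewrite hom_n0 rpred1.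
have := hom_elem u n k.+1; rewrite big_ord_recl /= subn0 mul1r elem0 mulr1.
move/eqP; rewrite addr_eq0 => /eqP ->; rewrite rpredN; apply: rpred_sum => i _.
apply: rpredM; first by rewrite rpredX // rpredN rpred1.
apply: rpredM; first by apply: IHk; rewrite /bump; lia.
by apply: bicommutant_gen; exists (bump 0 i).
Qed.

Definition homC k : C := Bicomm elem_fam_comm (hom_in k).

Lemma jacobi_trudiC f : bval (jacobi_trudi elemC f) = schur_op f.
Proof.
rewrite /jacobi_trudi /determinant rmorph_sum; apply: eq_bigr => s _.
rewrite rmorphM rmorph_sign rmorph_prod; congr (_ * _).
by apply: eq_bigr => i _; rewrite mxE /= part_atE.
Qed.

Let nB : (n + n.+1 <= (n + n).+2)%N. Proof. lia. Qed.
Let rB : (n.+1 < (n + n).+2)%N. Proof. lia. Qed.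

Lemma elemC_neg (k : int) : k < 0 -> elemC k = 0.
Proof. by move=> k0; apply: val_inj; rewrite /= elem_neg. Qed.
Lemma elemC0 : elemC 0 = 1.
Proof. by apply: val_inj; rewrite /= elem0. Qed.
Lemma elemC_gt (k : int) : n%:Z < k -> elemC k = 0.
Proof. by move=> k0; apply: val_inj; rewrite /= elem_gt. Qed.
Lemma homC0 : homC 0 = 1.
Proof. by apply: val_inj; rewrite /= hom_n0. Qed.
Lemma hom_elemC k : (0 < k)%N ->
  \sum_(i < k.+1) (-1) ^+ i * (homC (k - i)%N * elemC i%:Z) = 0.
Proof.
case: k => // k _; apply: val_inj; apply: etrans (hom_elem u n k.+1).
rewrite -[LHS]/(bval _) rmorph_sum.
by apply: eq_bigr => i _; rewrite rmorphM rmorph_sign rmorphM.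
Qed.

Lemma jacobi_trudi0 (f : shapes n) : weight f = 0%N -> jacobi_trudi elemC f = 1.
Proof.
move=> /weight0 f0; rewrite /jacobi_trudi -det_tr det_trig; last first.
  apply/is_trig_mxP => i j ij; rewrite !mxE f0 elemC_neg //; lia.
by rewrite big1 // => i _; rewrite !mxE f0 add0r subrr elemC0.
Qed.

(** The list is reversed because [strip_chains] peels the last strip first; the
    factors commute. *)
Lemma elem_expansion b : sumn b = n ->
  \prod_(k <- b) elem u n k%:Z =
  \sum_(f : shapes n | is_shape f && (weight f == n))
    (strip_chains (rev b) f)%:R * schur_op f.
Proof.
move=> bn; transitivity (bval (\prod_(k <- rev b) elemC k%:Z)).
  rewrite (perm_big b) ?rmorph_prod //; by rewrite perm_rev.
have sb : sumn (rev b) = n by rewrite sumn_rev.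
rewrite (chain_expansion (J := fun f : shapes n => jacobi_trudi elemC f) (B' := (n + n).+1) (r' := n)); first last.
- by rewrite sb.
- move=> f k; exact: (pieri_hstrip elemC_neg elemC0 elemC_gt nB).
- exact: jacobi_trudi0.
rewrite sb rmorph_sum; apply: eq_bigr => f _.
by rewrite rmorphM rmorph_nat /= jacobi_trudiC.
Qed.

Lemma hom_expansion b : sumn b = n ->
  \prod_(k <- b) hom u n k =
  \sum_(f : shapes n | is_shape f && (weight f == n))
    (strip_chains (rev b) f)%:R * schur_op (conj_shape f).
Proof.
move=> bn; transitivity (bval (\prod_(k <- rev b) homC k)).
  rewrite (perm_big b) ?rmorph_prod //; by rewrite perm_rev.
have sb : sumn (rev b) = n by rewrite sumn_rev.
rewrite (chain_expansion (J := fun f : shapes n => jacobi_trudi elemC (conj_shape f))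
  (B' := (n + n).+1) (r' := n)); first last.
- by rewrite sb.
- move=> f k sf wf; exact: (pieri_conj elemC_neg elemC0 elemC_gt nB homC0 hom_elemC).
- move=> f f0; apply: jacobi_trudi0; rewrite conj_weight ?f0 //.
  by apply/is_shapeP => i j _; rewrite !(weight0 f0).
rewrite sb rmorph_sum; apply: eq_bigr => f _.
by rewrite rmorphM rmorph_nat /= jacobi_trudiC.
Qed.

Lemma elem_prod_perm b b' : perm_eq b b' ->
  \prod_(k <- b) elem u n k%:Z = \prod_(k <- b') elem u n k%:Z.
Proof.
move=> bb'; transitivity (bval (\prod_(k <- b) elemC k%:Z)); first by rewrite rmorph_prod.
by rewrite (perm_big b' bb') rmorph_prod.
Qed.

Lemma hom_prod_perm b b' : perm_eq b b' ->
  \prod_(k <- b) hom u n k = \prod_(k <- b') hom u n k.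
Proof.
move=> bb'; transitivity (bval (\prod_(k <- b) homC k)); first by rewrite rmorph_prod.
by rewrite (perm_big b' bb') rmorph_prod.
Qed.
End Expansion.

(** * Semistandard tableaux as chains of horizontal strips *)

Section Tableaux.
Variables r' B' : nat.
Notation r := r'.+1.
Notation B := B'.+1.
Notation F := (shape_vec r' B').
Notation filling := {ffun 'I_r -> seq nat}.
Implicit Types (f g : F) (P : filling) (p : seq (nat * nat)).
Local Open Scope nat_scope.

Definition content p y := \sum_(xk <- p) (xk.1 == y) * xk.2.

(** Tableaux padded with empty rows, so that the rows are indexed by a fixed
    type. The multiplicities of the entries are listed in p. *)
Record tableau p f P : Prop := {
  tab_size : forall i, size (P i) = f i;
  tab_row : forall i, sorted leq (P i);
  tab_col : forall i j : 'I_r, j = i.+1 :> nat -> forall c, c < f j ->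
    nth 0 (P i) c < nth 0 (P j) c;
  tab_content : forall y, \sum_i count_mem y (P i) = content p y }.

Definition extend x f P : filling := [ffun i => P i ++ nseq (f i - size (P i)) x].
Definition remove x P : filling := [ffun i => [seq y <- P i | y != x]].

Fixpoint tableaux p f : seq filling :=
  if p is (x, k) :: p' then
    [seq extend x f P | g <- enum [pred g : F | hstrip g f & weight f == weight g + k],
                        P <- tableaux p' g]
  else if weight f == 0 then [:: [ffun=> [::]]] else [::].

Lemma size_tableaux p f : size (tableaux p f) = strip_chains (unzip2 p) f.
Proof.
elim: p f => [|[x k] p IHp] f /=; first by case: eqP.
rewrite size_allpairs_dep sumnE big_map big_enum /=.
by apply: eq_bigr => g _; rewrite IHp.
Qed.

Definition keys_lt x p := all (fun yk : nat * nat => yk.1 < x) p.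

Lemma content_out p x : keys_lt x p -> forall y, x <= y -> content p y = 0.
Proof.
move=> /allP h y xy; rewrite /content big1_seq // => yk /= /h /=.
by case: eqP => [->|]; lia.
Qed.

Lemma tableau_entry p f P x : tableau p f P -> keys_lt x p ->
  forall i y, y \in P i -> y < x.
Proof.
move=> tP kx i y yP; rewrite ltnNge; apply/negP => xy.
have := tab_content tP y; rewrite (content_out kx xy) (bigD1 i) //=.
by move/eqP; rewrite addn_eq0 => /andP[/eqP/count_memPn]; rewrite yP.
Qed.

Lemma removeK x P f i : (forall y, y \in P i -> y != x) -> remove x (extend x f P) i = P i.
Proof.
move=> h; rewrite !ffunE filter_cat filter_nseq eqxx /= cats0.
by apply/all_filterP/allP.
Qed.

(** The new entries x exceed all others, so the columns stay strictly increasing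
    exactly because no two new boxes are in one column. *)
Lemma tableau_extend x k p f g P : keys_lt x p -> hstrip g f ->
  weight f = weight g + k -> tableau p g P -> tableau ((x, k) :: p) f (extend x f P).
Proof.
move=> kx /hstripP[h1 h2] wfg tP; have ent := tableau_entry tP kx.
split=> [i|i|i j ij c cf|y].
- by rewrite ffunE size_cat size_nseq (tab_size tP) subnKC.
- rewrite ffunE (sorted_pairwise leq_trans) pairwise_cat.
  rewrite -!(sorted_pairwise leq_trans) (tab_row tP) /=; apply/andP; split.
    apply/allrelP => y z /ent yx; rewrite mem_nseq => /andP[_ /eqP->]; exact: ltnW.
  by elim: (f i - _) => //= n; case: n => //= n ->; rewrite leqnn.
- rewrite !ffunE; have cg : c < g i by apply: leq_trans cf (h2 i j ij).
  rewrite nth_cat (tab_size tP) cg nth_cat (tab_size tP).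
  case: (ltnP c (g j)) => cj; first exact: (tab_col tP ij).
  rewrite nth_nseq (_ : c - g j < f j - g j); last by lia.
  by apply: ent (mem_nth _ _); rewrite (tab_size tP).
- rewrite /content big_cons /= -/(content p y) -(tab_content tP).
  under eq_bigr => i _ do rewrite ffunE count_cat count_nseq (tab_size tP).
  rewrite big_split /= addnC; congr (_ + _).
  rewrite -big_distrr /=; congr (_ * _).
  move: wfg; rewrite /weight => wfg.
  have : \sum_i (f i - g i) + \sum_i (g i : nat) = \sum_i (f i : nat).
    by rewrite -big_split /=; apply: eq_bigr => i _; rewrite subnK.
  by rewrite wfg addnC => /addnI.
Qed.

Lemma sorted_max x (s : seq nat) : sorted leq s -> all (geq x) s ->
  s = [seq y <- s | y != x] ++ nseq (count_mem x s) x.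
Proof.
elim: s => //= y s IHs ps /andP[yx sx].
case: (y =P x) => [yx'|_] /=; last first.
  by rewrite add0n -IHs //; exact: path_sorted ps.
rewrite {}yx' ?add1n /= in ps *.
have E : all (pred1 x) s.
  apply/allP => z zs; have xz := allP (order_path_min leq_trans ps) z zs.
  by have := allP sx z zs; rewrite /= => zx; rewrite eqn_leq zx xz.
have /all_pred1P Es := E; rewrite {1}Es; move: E; rewrite all_count => /eqP ->.
rewrite (_ : [seq _ <- s | _] = [::]) //.
by rewrite Es; elim: (size s) => //= n ->; rewrite eqxx.
Qed.

Lemma tableau_keys_le x k p f P : keys_lt x p -> tableau ((x, k) :: p) f P ->
  forall i, all (geq x) (P i).
Proof.
move=> kx tP i; apply/allP => y yP /=; rewrite -ltnS.
apply: (tableau_entry tP) yP => /=; rewrite ltnSn /=.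
by apply: sub_all kx => yk; exact: leqW.
Qed.

Lemma extend_remove x k p f P : keys_lt x p -> tableau ((x, k) :: p) f P ->
  extend x f (remove x P) = P.
Proof.
move=> kx tP; apply/ffunP => i; rewrite !ffunE.
rewrite [in RHS](sorted_max (tab_row tP i) (tableau_keys_le kx tP i)).
congr (_ ++ nseq _ _); rewrite -(tab_size tP) size_filter.
by rewrite -(count_predC (pred1 x) (P i)) addnK.
Qed.

(** The boxes of the largest entry x form a horizontal strip, since x occurs at
    most once in a column and only at the end of a row. *)
Lemma tableau_remove x k p f P : keys_lt x p -> is_shape f ->
  tableau ((x, k) :: p) f P ->
  exists g, [/\ hstrip g f, weight f = weight g + k & tableau p g (remove x P)].
Proof.
move=> kx /is_shapeP sf tP; have ent := tableau_keys_le kx tP.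
pose g : F := [ffun i => inord (size (remove x P i))].
have PE i := sorted_max (tab_row tP i) (ent i).
have gE i : g i = size (remove x P i) :> nat.
  rewrite ffunE inordK // ffunE size_filter.
  apply: leq_ltn_trans (count_size _ _) _; rewrite (tab_size tP); exact: ltn_ord.
have gf i : g i <= f i.
  by rewrite gE ffunE size_filter -(tab_size tP) count_size.
have nthP i c : nth 0 (P i) c = if c < g i then nth 0 (remove x P i) c
    else if c < f i then x else 0.
  rewrite [in LHS]PE nth_cat gE ffunE; case: ltnP => // gc.
  have sz := congr1 size (PE i); rewrite size_cat size_nseq (tab_size tP) in sz.
  by rewrite nth_nseq sz; congr (if _ then _ else _); apply/idP/idP; lia.
have hgf : hstrip g f.
  apply/hstripP; split=> // i j ij; rewrite leqNgt; apply/negP => gfj.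
  have := tab_col tP ij gfj; rewrite !nthP ltnn.
  rewrite (_ : g i < f i); last by apply: leq_trans gfj (sf i j ij).
  case: ifP => gj; last by case: ifP => //; rewrite ?ltnn.
  have : nth 0 (remove x P j) (g i) \in P j.
    have := mem_nth 0 (s := remove x P j) (n := g i); rewrite -gE => /(_ gj).
    by rewrite ffunE mem_filter => /andP[].
  by move/(allP (ent j)) => /=; rewrite leqNgt => /negP h /h.
exists g; split=> //.
  have := tab_content tP x; rewrite /content big_cons /= -/(content p x) eqxx mul1n.
  rewrite (content_out kx) // addn0 => <-.
  rewrite /weight -big_split; apply: eq_bigr => i _ /=.
  by rewrite gE ffunE -(tab_size tP) size_filter -(count_predC (pred1 x) (P i)) addnC.
split=> [i|i|i j ij c cg|y]; rewrite ?gE //.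
- by rewrite ffunE; apply: (sorted_filter leq_trans); exact: (tab_row tP).
- have cf : c < f j by apply: leq_trans cg (gf j).
  have /hstripP[_ /(_ i j ij) h2] := hgf.
  by have := tab_col tP ij cf; rewrite !nthP cg (leq_trans cf h2).
have := tab_content tP y; rewrite /content big_cons /= -/(content p y).
case: (eqVneq x y) => [<- _|xy].
  rewrite (content_out kx) // big1 // => i _.
  by rewrite ffunE; apply/count_memPn; rewrite mem_filter eqxx.
rewrite mul0n add0n => <-; apply: eq_bigr => i _.
rewrite ffunE count_filter; apply: eq_count => z /=.
by case: (eqVneq z y) => // ->; rewrite eq_sym xy.
Qed.

Fixpoint desc_keys p := if p is (x, _) :: p' then keys_lt x p' && desc_keys p' else true.

Lemma mem_tableaux p f P : desc_keys p -> is_shape f -> 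
  reflect (tableau p f P) (P \in tableaux p f).
Proof.
elim: p f P => [|[x k] p IHp] f P /=.
  move=> _ sf; case: (eqVneq (weight f) 0) => wf.
    have f0 := weight0 wf.
    rewrite inE; apply: (iffP eqP) => [->|tP].
      split=> [i|i|i j ij c|y]; rewrite ?ffunE ?f0 //.
      by rewrite /content big_nil big1 // => i _; rewrite ffunE.
    apply/ffunP => i; rewrite ffunE; apply/nilP.
    by rewrite /nilp (tab_size tP) f0.
  rewrite in_nil; apply: ReflectF => tP; case/eqP: wf.
  rewrite /weight big1 // => i _; rewrite -(tab_size tP).
  case E : (P i) => [//|y s]; have := tab_content tP y.
  by rewrite /content big_nil (bigD1 i) //= E /= eqxx.
move=> /andP[kx dp] sf; apply: (iffP allpairsPdep).
  move=> [g [Q [+ + ->]]]; rewrite mem_enum inE => /andP[hg /eqP wg].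
  have [sg _] := hstrip_shape hg.
  by move/(IHp _ _ dp sg) => tQ; exact: (tableau_extend kx hg wg tQ).
move=> tP; have [g [hg wg tQ]] := tableau_remove kx sf tP.
have [sg _] := hstrip_shape hg.
exists g, (remove x P); split; first by rewrite mem_enum inE hg wg /=.
  exact/(IHp _ _ dp sg).
by rewrite (extend_remove kx tP).
Qed.

Lemma tableaux_uniq p f : desc_keys p -> uniq (tableaux p f).
Proof.
elim: p f => [|[x k] p IHp] f /=; first by case: eqP.
move=> /andP[kx dp]; apply: allpairs_uniq_dep.
- exact: enum_uniq.
- by move=> g _; exact: IHp.
have key (g : F) P : existT (fun _ : F => filling) g P \in
   [seq existT (fun _ : F => filling) g Q | g <- enum [pred g : F | hstrip g f & weight f == weight g + k],
                        Q <- tableaux p g] -> tableau p g P.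
  case/allpairsPdep => g' [Q [+ + E]]; rewrite mem_enum inE => /andP[hg _].
  have [sg _] := hstrip_shape hg.
  have Eg : g = g' := congr1 (@tag _ _) E.
  have EP : P = Q := congr1 (fun z => tagged z : filling) E.
  by rewrite Eg EP => /(mem_tableaux _ dp sg).
move=> [g P] [g' P'] /key tP /key tP' /= E.
have EP : P = P'.
  apply/ffunP => i; have := congr1 (fun Q => remove x Q i) E.
  rewrite !removeK // => y.
    by move/(tableau_entry tP' kx); rewrite ltn_neqAle => /andP[].
  by move/(tableau_entry tP kx); rewrite ltn_neqAle => /andP[].
have -> : g = g'.
  by apply/ffunP => i; apply: val_inj => /=; rewrite -(tab_size tP) -(tab_size tP') EP.
by rewrite EP.
Qed.
End Tableaux.

Definition support (m : monomial) : seq nat := sort leq (finsupp m).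
Definition exponents (m : monomial) : seq nat := [seq m i | i <- support m].

Lemma support_sorted m : sorted ltn (support m).
Proof.
by rewrite ltn_sorted_uniq_leq sort_uniq fset_uniq /= sort_sorted //; exact: leq_total.
Qed.

Lemma mem_support m i : (i \in support m) = (m i != 0%N).
Proof. by rewrite mem_sort mem_finsupp. Qed.

(** The variables in decreasing order, with their exponents: the largest entry of a
    tableau is removed first. *)
Definition keyed (m : monomial) := rev [seq (x, m x) | x <- support m].

Lemma keyed_desc m : desc_keys (keyed m).
Proof.
rewrite /keyed; have := support_sorted m.
elim/last_ind: (support m) => //= s x IHs sx.
rewrite map_rcons rev_rcons /= IHs ?andbT; last first.
  by move: sx; rewrite -cats1 => /cat_sorted2[].
rewrite /keys_lt all_rev all_map; apply/allP => y ys /=.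
by move: sx; rewrite (sorted_pairwise ltn_trans) pairwise_rcons => /andP[/allP/(_ y ys)].
Qed.

Lemma content_keyed m y : content (keyed m) y = m y.
Proof.
rewrite /content big_rev big_map /=.
have us : uniq (support m) by rewrite sort_uniq fset_uniq.
have [ys|] := boolP (y \in support m).
  rewrite (bigD1_seq y) //= eqxx mul1n big1_seq ?addn0 // => x /andP[xy _].
  by rewrite (negPf xy) mul0n.
move=> ys; rewrite big1_seq; last first.
  move=> x /= xs; case: eqP => [xy|]; last by rewrite mul0n.
  by rewrite -xy xs in ys.
by move: ys; rewrite mem_support negbK => /eqP ->.
Qed.

Lemma unzip2_keyed m : unzip2 (keyed m) = rev (exponents m).
Proof. by rewrite /unzip2 map_rev -map_comp. Qed.

Lemma fsbig_list (V : nmodType) (T : choiceType) (A : set T) (s : seq T) (f : T -> V) :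
  uniq s -> (forall i, i \in s -> A i) -> (forall i, A i -> i \notin s -> f i = 0) ->
  \sum_(i \in A) f i = \sum_(i <- s) f i.
Proof.
move=> us sA f0; rewrite (fsbigE s f us sA f0) [LHS]big_seq_cond [RHS]big_seq_cond.
apply: eq_bigl => i; rewrite andbT; case: (boolP (i \in s)) => //= ins.
by apply: mem_set; exact: sA.
Qed.

Section SchurChains.
Variables (k : fieldType) (r' B' : nat).
Notation r := r'.+1.
Notation F := (shape_vec r' B').
Variables (l : seq nat) (f : F).
Hypothesis lP : is_partition l.
Hypothesis lr : (size l <= r)%N.
Hypothesis fl : forall i : 'I_r, f i = nth 0%N l i :> nat.

Definition rows_of (P : {ffun 'I_r -> seq nat}) := mkseq (fun i => P (inord i)) (size l).

Lemma partition_shape : is_shape f.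
Proof.
apply/is_shapeP => i j ij; rewrite !fl ij.
have [jl|jl] := ltnP i.+1 (size l); last by rewrite nth_default.
by move/andP: lP => [/(sortedP 0%N)/(_ i jl)].
Qed.

Lemma rows_of_tableau (m : monomial) T :
  reflect (semistandard l T /\ m = seq_mset (flatten T))
    (T \in [seq rows_of P | P <- tableaux (keyed m) f]).
Proof.
have sf := partition_shape.
have il i : (i < size l)%N -> ((inord i : 'I_r) = i :> nat).
  by move=> il; rewrite inordK //; lia.
apply: (iffP mapP) => [[P /(mem_tableaux _ (keyed_desc m) sf) tP ->]|].
  have out (i : 'I_r) : (size l <= i)%N -> P i = [::].
    by move=> li; apply/nilP; rewrite /nilp (tab_size tP) fl nth_default.
  split.
    split.
    - apply: (@eq_from_nth _ 0%N); rewrite size_map size_mkseq // => i hi.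
      by rewrite (nth_map [::]) ?size_mkseq // nth_mkseq // (tab_size tP) fl il.
    - apply/(all_nthP [::]) => i; rewrite size_mkseq => hi.
      by rewrite nth_mkseq //; exact: (tab_row tP).
    - move=> i j; rewrite size_mkseq => hi; rewrite !nth_mkseq //; last by exact: ltnW.
      rewrite (tab_size tP) => hj; apply: (tab_col tP) => //.
      by rewrite !il // ltnW.
  apply/msetP => y; rewrite mset_seqE -(content_keyed m) -(tab_content tP).
  rewrite count_flatten sumnE big_map /rows_of /mkseq big_map.
  rewrite (_ : iota 0 _ = index_iota 0 (size l)) ?big_mkord; last by rewrite /index_iota subn0.
  rewrite (big_ord_widen _ (fun i => count_mem y (P (inord i))) lr).
  rewrite [LHS](bigID (fun i : 'I_r => i < size l)%N) /= [X in (_ + X)%N]big1 ?addn0.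
    by apply: eq_bigr => i _; rewrite inord_val.
  by move=> i; rewrite -leqNgt => /out ->.
move=> [[sT rT cT] mT].
have szT : size T = size l by rewrite -sT size_map.
have nT i : size (nth [::] T i) = nth 0%N l i.
  have [iT|iT] := ltnP i (size T); first by rewrite -sT (nth_map [::]).
  by rewrite !nth_default // -szT.
exists [ffun i : 'I_r => nth [::] T i]; last first.
  apply: (@eq_from_nth _ [::]); rewrite ?size_mkseq // => i iT.
  by rewrite nth_mkseq -?szT // ffunE il // -szT.
apply/(mem_tableaux _ (keyed_desc m) sf); split=> [i|i|i j ij c cf|y]; rewrite ?ffunE.
- by rewrite nT fl.
- have [iT|iT] := ltnP i (size T); first by move/(all_nthP [::]) : rT; apply.
  by rewrite nth_default.
- rewrite ij; apply: cT; last by rewrite nT -ij -fl.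
  rewrite szT ltnNge -ij; apply/negP => lj.
  by move: cf; rewrite fl nth_default.
rewrite content_keyed mT mset_seqE count_flatten sumnE big_map.
rewrite (big_nth [::]) big_mkord szT.
rewrite (big_ord_widen _ (fun i => count_mem y (nth [::] T i)) lr).
rewrite [LHS](bigID (fun i : 'I_r => i < size l)%N) /= [X in (_ + X)%N]big1 ?addn0.
  by apply: eq_bigr => i _; rewrite ffunE.
by move=> i; rewrite -leqNgt -szT => li; rewrite ffunE nth_default.
Qed.

(** Removing the largest entries successively, a tableau becomes a chain of
    horizontal strips with the exponents as sizes. *)
Lemma schur_chains (m : monomial) :
  schur k l m = (strip_chains (rev (exponents m)) f)%:R.
Proof.
have sf := partition_shape.
rewrite /schur (@fsbig_list _ _ _ [seq rows_of P | P <- tableaux (keyed m) f]) /=.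
- rewrite -unzip2_keyed -size_tableaux.
  rewrite (eq_big_seq (fun=> 1)) => [|T /(rows_of_tableau m)[_ <-]]; last by rewrite eqxx.
  by rewrite big_const_seq count_predT size_map iter_addr_0.
- rewrite map_inj_in_uniq ?tableaux_uniq ?keyed_desc // => P Q.
  move=> /(mem_tableaux _ (keyed_desc m) sf) tP /(mem_tableaux _ (keyed_desc m) sf) tQ.
  move=> PQ; apply/ffunP => i; have [il|li] := ltnP i (size l); last first.
    have out (P' : {ffun 'I_r -> seq nat}) : tableau (keyed m) f P' -> P' i = [::].
      by move=> t; apply/nilP; rewrite /nilp (tab_size t) fl nth_default.
    by rewrite !out.
  have := congr1 (nth [::] ^~ i) PQ; rewrite /rows_of /= !nth_mkseq //.
  by rewrite inord_val.
- by move=> T /= /rows_of_tableau[].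
- move=> T /= sT TP; case: eqP => // mT; case/negP: TP.
  exact/rows_of_tableau.
Qed.
End SchurChains.

(** * Coefficients of the images of words *)

Section Blocks.
Local Open Scope nat_scope.

Lemma comp_set_cons x y b :
  comp_set (x :: y :: b) = x :: [seq x + c | c <- comp_set (y :: b)].
Proof.
rewrite /comp_set /= addn0; congr (_ :: _).
by rewrite (iotaDl 1 1) -!map_comp; apply: eq_map => j.
Qed.

(** Positions that do not separate blocks carry the relation e. *)
Definition sorted_between (e : rel nat) (b w : seq nat) :=
  forall i, 0 < i < size w -> i \notin comp_set b -> e (nth 0 w i.-1) (nth 0 w i).

Lemma sorted_blocks (e : rel nat) b w : composition b -> size w = sumn b ->
  reflect (sorted_between e b w) (all (sorted e) (reshape b w)).
Proof.
elim: b w => [|x [|y b] IHb] w /=.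
- move=> _ /size0nil ->; apply: ReflectT => i; rewrite /= ltn0 andbF //.
- rewrite addn0 andbT => _ sw; rewrite take_oversize ?sw //.
  apply: (iffP (sortedP 0)) => h i.
    by case: i => // i /= iw _; apply: h.
  by move=> iw; apply: (h i.+1).
rewrite /composition inE negb_or => /andP[x0 cb] sw.
have xw : x <= size w by rewrite sw leq_addr.
have sd : size (drop x w) = sumn (y :: b) by rewrite size_drop sw /= addKn.
have IH := IHb (drop x w) cb sd.
have lb c : c \in comp_set (y :: b) -> 0 < c.
  move=> /mapP[j]; rewrite mem_iota => /andP[j0 _] ->.
  move: cb j0; rewrite /composition; case: j => //= j; case: y {IHb sd sw IH} => //=.
change (reflect (sorted_between e (x :: y :: b) w)
  (sorted e (take x w) && all (sorted e) (reshape (y :: b) (drop x w)))).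
have mem i : (i \in comp_set (x :: y :: b)) = (i == x) || (x < i) && (i - x \in comp_set (y :: b)).
  rewrite comp_set_cons inE; congr (_ || _); apply/mapP/andP => [[c /[dup] /lb c0 cin ->]|[xi h]].
    by rewrite addKn cin; split=> //; lia.
  by exists (i - x) => //; rewrite subnKC // ltnW.
apply: (iffP andP) => [[/(sortedP 0) h1 /IH h2] i|h].
  move=> iw; rewrite mem negb_or negb_and -leqNgt => /andP[ix h3].
  case: (ltngtP i x) ix h3 => // [ix _ _|xi _ /= h3].
    have := h1 i.-1; rewrite size_takel // prednK; last by lia.
    by rewrite !nth_take //; [apply|lia].
  have := h2 (i - x); rewrite size_drop !nth_drop.
  rewrite subnKC ?(ltnW xi) // (_ : x + (i - x).-1 = i.-1); last by lia.
  by apply=> //; lia.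
split.
  apply/(sortedP 0) => i; rewrite size_takel // => ix.
  rewrite !nth_take //; last by lia.
  by apply: (h i.+1); [lia | rewrite mem; lia].
apply/IH => i; rewrite size_drop !nth_drop => iw ib.
have := h (x + i); rewrite (_ : (x + i).-1 = x + i.-1); last by lia.
apply; first by lia.
by rewrite mem addKn (negPf ib) andbF orbF; lia.
Qed.

Lemma descents_sub b w : composition b -> size w = sumn b ->
  {subset comp_set (descent_comp w) <= comp_set b} <-> all (sorted leq) (reshape b w).
Proof.
move=> cb sw; have [_ _ dw] := comp_of_descents w.
split=> [h|/(sorted_blocks _ cb sw) h i].
  apply/sorted_blocks => // i iw ib; rewrite leqNgt; apply: contra ib => di.
  by apply: h; rewrite dw mem_filter di mem_iota; lia.
rewrite dw mem_filter mem_iota => /andP[di iw]; apply: contraLR di => ib.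
by rewrite -leqNgt; apply: h => //; lia.
Qed.

Lemma ascents_sub b w : composition b -> size w = sumn b ->
  {subset comp_set (comp_compl (descent_comp w)) <= comp_set b} <->
  all (sorted gtn) (reshape b w).
Proof.
move=> cb sw; have [_ sd dw] := comp_of_descents w.
have [_ _ cw] := comp_complP (descent_comp w).
have E i : (i \in comp_set (comp_compl (descent_comp w))) =
    (0 < i < size w) && ~~ (nth 0 w i.-1 > nth 0 w i).
  rewrite cw mem_filter dw mem_filter !mem_iota sd.
  have -> : (1 <= i < 1 + (size w).-1) = (0 < i < size w) by lia.
  by case: (0 < i < size w); rewrite ?andbF ?andbT.
split=> [h|/(sorted_blocks _ cb sw) h i].
  apply/sorted_blocks => // i iw ib; rewrite /=; apply: contraR ib => di.
  by apply: h; rewrite E iw.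
rewrite E => /andP[iw di]; apply: contraR di => ib; exact: h.
Qed.
End Blocks.

Section Coefficients.
Variable k : fieldType.

Lemma exponents_composition m : composition (exponents m).
Proof.
apply/negP => /mapP[i]; rewrite mem_support => mi E.
by rewrite -E eqxx in mi.
Qed.

Lemma count_monomial i a y : size i = size a ->
  monomial_of i a y = (\sum_(p <- zip i a) (p.1 == y) * p.2)%N.
Proof.
move=> _; rewrite /monomial_of mset_seqE count_flatten -map_comp sumnE big_map.
by apply: eq_bigr => p _; rewrite /= count_nseq.
Qed.

Lemma monomial_of_nth i a j : sorted ltn i -> size i = size a -> (j < size i)%N ->
  monomial_of i a (nth 0%N i j) = nth 0%N a j.
Proof.
move=> si sz ji; rewrite count_monomial // (big_nth (0, 0)%N) size_zip sz minnn.
rewrite big_mkord -sz (bigD1 (Ordinal ji)) //= nth_zip //= eqxx mul1n big1 ?addn0 //.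
move=> c; rewrite -val_eqE /= nth_zip //= => cj.
rewrite nth_uniq ?(negPf cj) ?mul0n //.
by apply: sorted_uniq si; [exact: ltn_trans | exact: ltnn].
Qed.

Lemma monomial_of_out i a y : size i = size a -> y \notin i -> monomial_of i a y = 0%N.
Proof.
move=> sz yi; rewrite count_monomial // big1_seq // => p /= pz.
case: eqP => // E; case/negP: yi; rewrite -E; move: pz => /(map_f fst).
by rewrite -/(unzip1 _) unzip1_zip // sz.
Qed.

Lemma monomial_ofP i a m : composition a -> sorted ltn i -> size i = size a ->
  (m == monomial_of i a) = (i == support m) && (a == exponents m).
Proof.
move=> ca si sz; apply/eqP/andP => [->|[/eqP -> /eqP ->]].
  have E : i = support (monomial_of i a).
    apply: (irr_sorted_eq ltn_trans ltnn) => //; first exact: support_sorted.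
    move=> y; rewrite mem_support; apply/idP/idP => [yi|]; last first.
      by apply: contraR => /(monomial_of_out sz) ->.
    rewrite -(nth_index 0%N yi) monomial_of_nth // ?index_mem //.
    apply: contraNneq ca => <-; apply: mem_nth; by rewrite -sz index_mem.
  rewrite -E eqxx; split=> //; rewrite /exponents -E; apply/eqP.
  apply: (@eq_from_nth _ 0%N); first by rewrite size_map.
  by move=> j ja; rewrite (nth_map 0%N) ?sz // monomial_of_nth // sz.
have szm : size (support m) = size (exponents m) by rewrite size_map.
apply/msetP => y; have [ys|ys] := boolP (y \in support m); last first.
  by rewrite monomial_of_out //; move: ys; rewrite mem_support negbK => /eqP.
rewrite -{2}(nth_index 0%N ys) monomial_of_nth ?index_mem //; last exact: support_sorted.
by rewrite (nth_map 0%N) ?index_mem // nth_index.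
Qed.

(** The variables and the composition are both determined by the monomial. *)
Lemma Mqsym_coef a m : composition a -> Mqsym k a m = (a == exponents m)%:R.
Proof.
move=> ca; rewrite /Mqsym; have [E|ne] := boolP (a == exponents m).
  rewrite (@fsbig_list _ _ _ [:: support m]) //.
  - rewrite big_seq1 monomial_ofP //; [|exact: support_sorted|].
      by rewrite E eqxx.
    by rewrite (eqP E) size_map.
  - move=> i; rewrite inE => /eqP ->; split; first exact: support_sorted.
    by rewrite (eqP E) size_map.
  - move=> i /= [si sz]; rewrite inE monomial_ofP // => /negPf ->; by [].
rewrite fsbig1 // => i [si sz].
by rewrite monomial_ofP // (negPf ne) andbF.
Qed.

Lemma Lqsym_coef a m : Lqsym k a m =
  ((sumn (exponents m) == sumn a) && all (mem (comp_set (exponents m))) (comp_set a))%:R.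
Proof.
rewrite /Lqsym; case: andP => [[/eqP h1 /allP h2]|h].
  rewrite (@fsbig_list _ _ _ [:: exponents m]) //.
  - by rewrite big_seq1 Mqsym_coef ?eqxx // exponents_composition.
  - move=> b; rewrite inE => /eqP ->; split=> //; exact: exponents_composition.
  - move=> b /= [cb _ _]; rewrite inE Mqsym_coef // => /negPf ->; by [].
rewrite fsbig1 // => b [cb sb hb]; rewrite Mqsym_coef //; case: eqP => // E.
by case: h; rewrite -E sb eqxx; split=> //; apply/allP.
Qed.

(** Functions on packed words become functions on all words, which can then be
    multiplied by letters. *)
Definition extend0 (g : wseries k) (w : seq nat) : k :=
  if insub w is Some p then g p else 0.

(** So the alphabet 1, ..., n is enough in degree n. *)
Lemma packed_letters (w : seq nat) : packed w -> letters_le (size w) w.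
Proof.
move=> /eqP ps; rewrite /letters_le {2}ps all_map; apply/allP => x xs /=.
apply: (@leq_trans (size (sort leq (undup w)))).
  by rewrite index_mem mem_sort mem_undup.
by rewrite size_sort size_undup.
Qed.

Lemma sum_packed (L : seq (seq nat)) (g : wseries k) :
  \sum_(w <- L) extend0 g w = \sum_(w <- pmap insub L : seq pword) g w.
Proof.
elim: L => [|w L IHL] /=; first by rewrite !big_nil.
rewrite big_cons IHL /extend0; case: insubP => [p _ _|_] /=; last by rewrite add0r.
by rewrite big_cons.
Qed.

(** Stated for both maps at once: u gives the image of a word, and e is the relation
    required between consecutive letters of a block. *)
Lemma psi_coef (u : pword -> pseries k) (e : rel nat) (L : seq (seq nat)) g m :
  (forall w : pword, u w m = (size (val w) == sumn (exponents m))%:R *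
     (all (sorted e) (reshape (exponents m) (val w)))%:R) ->
  uniq L ->
  (forall w, w \in L <-> [/\ size w = sumn (exponents m),
     letters_le (sumn (exponents m)) w & all (sorted e) (reshape (exponents m) w)]) ->
  formal_sum setT g u m = \sum_(w <- L) extend0 g w.
Proof.
move=> hu uL mL; rewrite sum_packed /formal_sum.
rewrite (@fsbig_list _ _ _ (pmap insub L)) //.
- apply: eq_big_seq => w; rewrite mem_pmap_sub => /mL[sw _ h].
  by rewrite hu sw eqxx h !mulr1.
- exact: pmap_sub_uniq.
- move=> w _; rewrite mem_pmap_sub => wL; rewrite hu.
  case: eqP => sw; last by rewrite mul0r mulr0.
  case: (boolP (all _ _)) => h; last by rewrite !mulr0.
  case/negP: wL; apply/mL; split=> //; rewrite -sw; exact/packed_letters/valP.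
Qed.

Lemma psi_le_coef L g m : uniq L ->
  (forall w, w \in L <-> [/\ size w = sumn (exponents m),
     letters_le (sumn (exponents m)) w & all (sorted leq) (reshape (exponents m) w)]) ->
  psi_le k g m = \sum_(w <- L) extend0 g w.
Proof.
apply: psi_coef => w; rewrite Lqsym_coef; have [_ -> _] := comp_of_descents (val w).
rewrite eq_sym -natrM mulnb; congr (_%:R : k); congr nat_of_bool.
case: eqP => //= sw; have := descents_sub (exponents_composition m) sw.
by move=> h; apply/allP/idP => /h.
Qed.

Lemma psi_gt_coef L g m : uniq L ->
  (forall w, w \in L <-> [/\ size w = sumn (exponents m),
     letters_le (sumn (exponents m)) w & all (sorted gtn) (reshape (exponents m) w)]) ->
  psi_gt k g m = \sum_(w <- L) extend0 g w.
Proof.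
apply: psi_coef => w; rewrite Lqsym_coef.
have [_ -> _] := comp_complP (descent_comp (val w)).
have [_ -> _] := comp_of_descents (val w).
rewrite eq_sym -natrM mulnb; congr (_%:R : k); congr nat_of_bool.
case: eqP => //= sw; have := ascents_sub (exponents_composition m) sw.
by move=> h; apply/allP/idP => /h.
Qed.
End Coefficients.

(** * Criteria for symmetry and Schur positivity *)

Local Open Scope classical_set_scope.
Local Open Scope ring_scope.

Section Criteria.
Variable k : fieldType.

Lemma msym_exponents l m : msym k l m = (perm_eq (exponents m) l)%:R.
Proof.
rewrite /msym; congr (_%:R : k); congr nat_of_bool.
have /permPl -> // : perm_eq (exponents m) [seq m i | i <- finsupp m].
by apply: perm_map; rewrite perm_sort.
Qed.

Lemma exponents_monomial a : composition a ->
  exponents (monomial_of (iota 0 (size a)) a) = a.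
Proof.
move=> ca; have := @monomial_ofP (iota 0 (size a)) a _ ca (iota_ltn_sorted _ _)
  (size_iota _ _); move=> /(_ (monomial_of (iota 0 (size a)) a)).
by rewrite eqxx => /esym/andP[_ /eqP].
Qed.

Lemma sort_composition a : composition a -> is_partition (sort geq a).
Proof.
move=> ca; rewrite /is_partition mem_sort; apply/andP; split; last exact: ca.
by apply: sort_sorted => x y; exact: leq_total.
Qed.

(** The monomial symmetric functions are the indicators of the sets of monomials
    with the same exponents up to order. *)
Lemma SymhatP (f : pseries k) : Symhat k f <->
  (forall m m', perm_eq (exponents m) (exponents m') -> f m = f m').
Proof.
split=> [[c ->] m m' mm'|hf].
  apply: eq_fsbigr => l _; rewrite !msym_exponents; congr (_ * (nat_of_bool _)%:R).
  by have /permPl -> := mm'.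
(* the coefficient of a monomial symmetric function is read off at the monomial
   x_0^{l_0} x_1^{l_1} ... *)
exists (fun l => f (monomial_of (iota 0 (size l)) l)); apply/funext => m.
have cm := exponents_composition m.
pose l := sort geq (exponents m).
have ml : perm_eq (exponents m) l by rewrite perm_sym perm_sort.
have lP : is_partition l by exact: sort_composition.
rewrite /formal_sum (@fsbig_list _ _ _ [:: l]) //.
- rewrite big_seq1 msym_exponents ml mulr1; apply: hf.
  by rewrite exponents_monomial //; case/andP: lP.
- by move=> l'; rewrite inE => /eqP ->.
move=> l' /andP[sl' _]; rewrite inE msym_exponents => ll'.
case: (boolP (perm_eq _ _)) => [ml'|]; last by rewrite mulr0.
case/eqP: ll'; apply: (@sorted_eq _ geq) => //.
- by move=> a b c /=; lia.
- by move=> a b /andP[/= ab ba]; apply/eqP; rewrite eqn_leq ab ba.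
- by case/andP: lP.
- by apply: perm_trans ml; rewrite perm_sym.
Qed.

Section ShapeLists.
Variables n B' : nat.
Implicit Types f : shape_vec n B'.

Definition part_list f : seq nat :=
  mkseq (part_at f) #|[pred i : 'I_n.+1 | (0 < f i)%N]|.

Lemma part_list_size f : (size (part_list f) <= n.+1)%N.
Proof. by rewrite size_mkseq -[X in (_ <= X)%N]card_ord max_card. Qed.

Lemma part_list_nth f (i : 'I_n.+1) : is_shape f -> nth 0%N (part_list f) i = f i.
Proof.
move=> sf; have ci : (i < #|[pred i : 'I_n.+1 | (0 < f i)%N]|)%N = (0 < f i)%N.
  by rewrite card_initial // => a b ab /= /leq_trans; apply; exact: shape_mono.
have [h|h] := boolP (0 < f i)%N; first by rewrite nth_mkseq ?ci // part_atE.
rewrite nth_default; last by rewrite size_mkseq leqNgt ci.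
by apply/esym/eqP; rewrite -leqn0 leqNgt.
Qed.

Lemma part_list_partition f : is_shape f -> is_partition (part_list f).
Proof.
move=> sf; have sz := part_list_size f.
have nthE i : (i < size (part_list f))%N ->
    exists2 j : 'I_n.+1, j = i :> nat & nth 0%N (part_list f) i = f j.
  move=> il; exists (Ordinal (leq_trans il sz)) => //.
  by rewrite -part_list_nth.
apply/andP; split.
  apply/(sortedP 0%N) => i il; have [j ji ->] := nthE _ il.
  have [j' ji' ->] := nthE _ (ltnW il).
  by apply: shape_mono => //; rewrite ji ji'.
apply/negP => /(nthP 0%N)[i il]; have [j ji ->] := nthE _ il => f0.
suff : (0 < f j)%N by rewrite f0.
have := il; rewrite size_mkseq -ji card_initial // => a b ab /= /leq_trans; apply.
exact: shape_mono.
Qed.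

Lemma sumn_nth (l : seq nat) : (size l <= n.+1)%N ->
  sumn l = (\sum_(i < n.+1) nth 0 l i)%N.
Proof.
move=> ln; rewrite sumnE (big_nth 0%N) big_mkord (big_ord_widen _ _ ln).
rewrite [RHS](bigID (fun i : 'I_n.+1 => i < size l)%N) /= [X in (_ + X)%N]big1 ?addn0 //.
by move=> i; rewrite -leqNgt => h; rewrite nth_default.
Qed.

Lemma part_list_sumn f : is_shape f -> sumn (part_list f) = weight f.
Proof.
move=> sf; rewrite sumn_nth ?part_list_size //.
by apply: eq_bigr => i _; rewrite part_list_nth.
Qed.

Lemma shape_of_partition l : (n <= B')%N -> is_partition l -> sumn l = n ->
  exists f : shape_vec n B', [/\ is_shape f, weight f = n & part_list f = l].
Proof.
move=> nB /[dup] lP /andP[sl l0] ln.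
have szl : (size l <= n.+1)%N.
  by have := composition_size l0; rewrite ln; lia.
pose f : shape_vec n B' := [ffun i : 'I_n.+1 => inord (nth 0%N l i)].
have fE (i : 'I_n.+1) : f i = nth 0%N l i :> nat.
  rewrite ffunE inordK // ltnS; have [il|li] := ltnP i (size l); last by rewrite nth_default.
  by apply: leq_trans nB; apply: leq_trans (eq_leq ln); apply: sumn_geq; apply: mem_nth.
exists f; have sf : is_shape f by apply: (partition_shape lP fE).
split=> //.
  by apply: etrans ln; rewrite sumn_nth //; apply: eq_bigr => i _; rewrite fE.
have sz : size (part_list f) = size l.
  rewrite size_mkseq -[RHS](@card_ord_lt n.+1) //; apply: eq_card => i.
  rewrite !inE fE; have [il|li] := ltnP i (size l); last by rewrite nth_default.
  by rewrite lt0n; apply: contraNneq l0 => <-; exact: mem_nth.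
apply: (@eq_from_nth _ 0%N) => // i il.
have hi : (i < n.+1)%N by apply: leq_trans il (part_list_size f).
by rewrite -[i]/(val (Ordinal hi)) part_list_nth // fE.
Qed.

End ShapeLists.

Lemma monomial_sumn (m : monomial) : size m = sumn (exponents m).
Proof.
have mE : m = monomial_of (support m) (exponents m).
  apply/eqP; rewrite monomial_ofP ?eqxx ?exponents_composition ?support_sorted //.
  by rewrite size_map.
by rewrite {1}mE size_monomial_of // size_map.
Qed.

Lemma schur_sumn l m : schur k l m != 0 -> sumn l = sumn (exponents m).
Proof.
move=> /eqP sl; apply: contra_notP sl => ml; rewrite /schur fsbig1 // => T [sT _ _].
case: eqP => // mT; case: ml.
by rewrite -monomial_sumn mT size_seq_mset size_flatten sT.
Qed.

Definition all_shapes n := [seq f <- enum {: shapes n} | is_shape f & weight f == n].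

(** Schur functions of degree n are indexed by partitions of n and by shapes of
    weight n; the shapes live in a type that depends on n, whence the passage
    through the list of parts. *)
Lemma schur_positive_expansion (f : pseries k) (D : forall n, shapes n -> k) :
  (forall m, f m = \sum_(g : shapes (sumn (exponents m)) |
      is_shape g && (weight g == sumn (exponents m)))
    (strip_chains (rev (exponents m)) g)%:R * D _ g) ->
  (forall n (g : shapes n), is_shape g -> weight g = n -> exists c : nat, D n g = c%:R) ->
  schur_positive f.
Proof.
move=> hf hD.
pose P l c := forall n (g : shapes n), is_shape g -> weight g = n ->
  part_list g = l -> D n g = c%:R.
have [c hc] : exists c, forall l, P l (c l).
  suff /choice[c] : forall l, exists c, P l c by exists c.
  move=> l.
  have [[n [g [sg wg gl]]]|ne] := pselect (exists n (g : shapes n),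
      [/\ is_shape g, weight g = n & part_list g = l]); last first.
    by exists 0%N => n g sg wg gl; case: ne; exists n, g.
  have [c Dc] := hD n g sg wg; exists c => n' g' sg' wg' gl'.
  have nn' : n = n' by rewrite -wg -wg' -!part_list_sumn // gl gl'.
  subst n'.
  suff <- : g = g' by [].
  by apply/ffunP => i; apply: val_inj; rewrite /= -!part_list_nth // gl gl'.
exists c; apply/funext => m; rewrite hf; set n := sumn (exponents m).
rewrite /formal_sum (@fsbig_list _ _ _ [seq part_list g | g <- all_shapes n]).
- rewrite big_map big_filter big_enum_cond; apply: eq_bigr => g /andP[sg /eqP wg].
  rewrite (@schur_chains k n _ _ g) ?part_list_partition ?part_list_size //; last first.
    by move=> i; rewrite part_list_nth.
  by rewrite mulrC (hc (part_list g)).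
- rewrite map_inj_in_uniq; [exact/filter_uniq/enum_uniq|move=> g g'].
  rewrite !mem_filter => /andP[/andP[sg _] _] /andP[/andP[sg' _] _] E.
  by apply/ffunP => i; apply: val_inj; rewrite /= -!part_list_nth // E.
- by move=> l /mapP[g]; rewrite mem_filter => /andP[/andP[sg _] _] ->; exact: part_list_partition.
move=> l lP ll; apply/eqP; rewrite mulf_eq0; apply/orP; right.
apply: contraNT ll => /schur_sumn ln; apply/mapP.
have [|g [sg wg gl]] := @shape_of_partition n (n + n).+1 l _ lP ln; first by lia.
by exists g => //; rewrite mem_filter sg wg eqxx mem_enum.
Qed.
End Criteria.

(** * Words acting on functions on classes *)

Section EndoRing.
Variable k : fieldType.

Local Notation V := (seq nat -> k).

(** Additive operators on functions on words, a ring under composition. *)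
Record endo := Endo { endo_fun :> V -> V;
  endo_add : forall f g, endo_fun (f + g) = endo_fun f + endo_fun g }.

HB.instance Definition _ := gen_eqMixin endo.
HB.instance Definition _ := gen_choiceMixin endo.

Lemma endoP (x y : endo) : (forall f, x f = y f) -> x = y.
Proof.
case: x => x hx; case: y => y hy /= h.
have E : x = y by apply/funext.
by rewrite E in hx *; congr Endo; exact: Prop_irrelevance.
Qed.

Definition endo0 := @Endo (fun=> 0) (fun _ _ => esym (addr0 0)).
Lemma endoD_add (x y : endo) f g : x (f + g) + y (f + g) = x f + y f + (x g + y g).
Proof. by rewrite !endo_add addrACA. Qed.
Definition endoD x y := Endo (endoD_add x y).
Lemma endoN_add (x : endo) f g : - x (f + g) = - x f + - x g.
Proof. by rewrite endo_add opprD. Qed.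
Definition endoN x := Endo (endoN_add x).
Definition endo1 := @Endo id (fun _ _ => erefl).
Lemma endoM_add (x y : endo) f g : x (y (f + g)) = x (y f) + x (y g).
Proof. by rewrite !endo_add. Qed.
Definition endoM x y := Endo (endoM_add x y).

Lemma endo_addA : associative endoD.
Proof. by move=> x y z; apply: endoP => f /=; rewrite addrA. Qed.
Lemma endo_addC : commutative endoD.
Proof. by move=> x y; apply: endoP => f /=; rewrite addrC. Qed.
Lemma endo_add0 : left_id endo0 endoD.
Proof. by move=> x; apply: endoP => f /=; rewrite add0r. Qed.
Lemma endo_addN : left_inverse endo0 endoN endoD.
Proof. by move=> x; apply: endoP => f /=; rewrite addNr. Qed.

HB.instance Definition _ := GRing.isZmodule.Build endo
  endo_addA endo_addC endo_add0 endo_addN.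

Lemma endo_mulA : associative endoM. Proof. by move=> x y z; apply: endoP. Qed.
Lemma endo_mul1 : left_id endo1 endoM. Proof. by move=> x; apply: endoP. Qed.
Lemma endo_mulr1 : right_id endo1 endoM. Proof. by move=> x; apply: endoP. Qed.
Lemma endo_mulDl : left_distributive endoM +%R.
Proof. by move=> x y z; apply: endoP. Qed.
Lemma endo_mulDr : right_distributive endoM +%R.
Proof. by move=> x y z; apply: endoP => f /=; rewrite endo_add. Qed.
Lemma endo1_neq0 : endo1 != 0 :> endo.
Proof.
apply/eqP => /(congr1 (fun x : endo => x (fun=> 1) [::])) /= /eqP.
by rewrite oner_eq0.
Qed.

HB.instance Definition _ := GRing.Zmodule_isNzRing.Build endo
  endo_mulA endo_mul1 endo_mulr1 endo_mulDl endo_mulDr endo1_neq0.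

Definition value (g : V) (x : endo) : k := x g [::].

Lemma value_zmod g : zmod_morphism (value g). Proof. by []. Qed.
HB.instance Definition _ g := GRing.isZmodMorphism.Build endo k (value g) (value_zmod g).

Variable R : seq nat -> seq nat -> Prop.
Hypothesis hR : word_relation R.
Hypothesis hcat : forall v v' w w', R v v' -> R w w' -> R (v ++ w) (v' ++ w').

(** Right multiplication by a letter is composed with the choice of a
    representative, so that related words act in the same way. *)
Definition canon (w : seq nat) : seq nat := xget [::] [set v | R w v].

Lemma canon_rel w : is_word w -> R w (canon w).
Proof. by move=> hw; apply: (@xgetPex _ [::] [set v | R w v]); exists w; exact: wrel_refl. Qed.

Lemma canon_eq v w : R v w -> canon v = canon w.
Proof.
move=> vw; rewrite /canon; congr (xget _ _); apply/funext => x; apply/propext.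
split; [exact/(wrel_trans hR)/(wrel_sym hR) | exact: (wrel_trans hR)].
Qed.

Lemma is_word_cat v w : is_word (v ++ w) = is_word v && is_word w.
Proof. by rewrite /is_word mem_cat negb_or. Qed.

(** Multiplies the class of x by the letter a.+1 on the right. *)
Definition letter_fun a (f : V) : V :=
  fun x => if is_word x then f (canon (rcons x a.+1)) else 0.
Lemma letter_fun_add a f g : letter_fun a (f + g) = letter_fun a f + letter_fun a g.
Proof.
apply/funext => x; rewrite -[RHS]/(letter_fun a f x + letter_fun a g x) /letter_fun.
by case: ifP; rewrite ?addr0.
Qed.
Definition letter_op a := Endo (letter_fun_add a).

Lemma is_word_succ w : is_word [seq a.+1 | a <- w].
Proof. by apply/mapP => -[]. Qed.

Lemma uword_act w f x : w != [::] ->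
  uword letter_op w f x = if is_word x then f (canon (x ++ [seq a.+1 | a <- w])) else 0.
Proof.
elim: w x => // a w IHw x _; rewrite uword_cons.
rewrite -[LHS]/(letter_fun a (uword letter_op w f) x) /letter_fun; case: ifP => // wx.
have wxa : is_word (rcons x a.+1) by rewrite -cats1 is_word_cat wx.
case: w IHw => [_|b w IHw]; first by rewrite /uword big_nil cats1.
have Ra := canon_rel wxa; have [_ wc] := wrel_word hR Ra.
rewrite IHw // wc -(cat_rcons a.+1); congr (f _); apply: canon_eq.
apply: hcat; first exact: (wrel_sym hR).
by apply: (wrel_refl hR); exact: is_word_succ.
Qed.

Lemma uword_rel v w : v != [::] -> w != [::] ->
  R [seq a.+1 | a <- v] [seq a.+1 | a <- w] ->
  uword letter_op v = uword letter_op w.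
Proof.
move=> v0 w0 vw; apply: endoP => f; apply/funext => x.
rewrite !uword_act //; case: ifP => // wx; congr (f _); apply: canon_eq.
by apply: hcat => //; exact: wrel_refl.
Qed.

Definition class_fun (g : V) := forall v w, R v w -> g v = g w.

Lemma value_uword g w : class_fun g -> value g (uword letter_op w) = g [seq a.+1 | a <- w].
Proof.
move=> hg; case: w => [|a w]; first by rewrite /uword big_nil.
rewrite /value uword_act //=; apply/hg/(wrel_sym hR)/canon_rel.
exact: (is_word_succ (a :: w)).
Qed.

Lemma value_word_op g w : is_word w -> class_fun g -> value g (word_op letter_op w) = g w.
Proof.
move=> hw hg; have -> : w = [seq a.+1 | a <- [seq a.-1 | a <- w]].
  rewrite -map_comp map_id_in // => a aw /=; rewrite prednK // lt0n.
  by apply: contraNneq hw => <-.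
by rewrite word_op_uword value_uword.
Qed.

(** In the third relation the terms match as aba = baa and bba = bab in the first
    case, and as aba = bab and bba = ba = baa in the second one. *)
Lemma knuth_fomin_greene N : extends R knuth \/ extends R kknuth ->
  fomin_greene letter_op N.
Proof.
have uE a b c : letter_op a * letter_op b * letter_op c = uword letter_op [:: a; b; c].
  by rewrite /uword !big_cons big_nil mulr1 mulrA.
case=> hK; split=> [a b c abc _|a b c abc _|a b ab]; rewrite !uE.
- by apply: uword_rel => //; apply: hK; apply: cc_step; apply: knuth_bac; lia.
- by apply: uword_rel => //; apply: hK; apply: cc_step; apply: knuth_acb; lia.
- congr (_ + _); apply: uword_rel => //; apply: hK.
    by apply: cc_step; apply: knuth_aba; lia.
  by apply: cc_sym; apply: cc_step; apply: knuth_bab; lia.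
- by apply: uword_rel => //; apply: hK; apply: cc_step; apply: kknuth_bac; lia.
- by apply: uword_rel => //; apply: hK; apply: cc_step; apply: kknuth_acb; lia.
rewrite addrC; congr (_ + _); apply: uword_rel => //; apply: hK; last first.
  by apply: cc_step; apply: kknuth_aba; lia.
apply: (@cc_trans _ _ ([:: b.+1] ++ [:: a.+1])).
  rewrite -[map _ _]/([:: b.+1; b.+1] ++ [:: a.+1]).
  apply: cc_cat; last by apply: cc_refl.
  by apply: cc_sym; apply: cc_step; apply: kknuth_aa.
rewrite -[map _ _]/([:: b.+1] ++ [:: a.+1; a.+1]).
apply: cc_cat; first by apply: cc_refl.
by apply: cc_step; apply: kknuth_aa.
Qed.

Lemma packed_ext v w : v =i w -> packed v = packed w.
Proof.
move=> vw; have E : sort leq (undup v) = sort leq (undup w).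
  apply/perm_sortP; [exact: leq_total|exact: leq_trans|exact: anti_leq|].
  by apply: uniq_perm; rewrite ?undup_uniq // => x; rewrite !mem_undup.
have P s : packed s = all (fun x => x == (index x (sort leq (undup s))).+1) s.
  rewrite /packed /fl_word -{1}[s]map_id; apply/eqP/allP => [/eq_in_map h x /h /eqP|h] //.
  by apply/eq_in_map => x /h /eqP.
by rewrite !P E; exact: eq_all_r.
Qed.

Lemma extend0_class (g : wseries k) :
  (forall v w : pword, R (val v) (val w) -> g v = g w) -> class_fun (extend0 g).
Proof.
move=> hg v w vw; have := packed_ext (wrel_letters hR vw); rewrite /extend0.
case: insubP => [p pv pE|/negPf ->] E; last first.
  by case: insubP => // q; rewrite -E.
case: insubP => [q _ qE|]; last by rewrite -E pv.
by apply: hg; rewrite pE qE.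
Qed.
End EndoRing.

Section Forward.
Variables (k : fieldType) (R : seq nat -> seq nat -> Prop).
Hypothesis hR : word_relation R.
Hypothesis hcat : forall v v' w w', R v v' -> R w w' -> R (v ++ w) (v' ++ w').

Local Notation u := (letter_op k R).

(** These are the elements of the space spanned by the classes. *)
Definition class_invariant (g : wseries k) :=
  forall v w : pword, R (val v) (val w) -> g v = g w.

Lemma kappa_invariant E : is_class R E -> class_invariant (kappa k E).
Proof.
move=> [p ->] v w vw; congr (nat_of_bool _)%:R; apply: asbool_equiv_eq => /=; split=> h.
  exact: (wrel_trans hR) h vw.
exact: (wrel_trans hR) h (wrel_sym hR vw).
Qed.

Lemma Khat_invariant g : Khat k R g -> class_invariant g.
Proof.
move=> [c ->] v w vw; apply: eq_fsbigr => E; rewrite inE => hE.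
by rewrite (kappa_invariant hE vw).
Qed.

Lemma is_word_letters n w : letters_le n w -> is_word w.
Proof. by move=> lw; apply/negP => /(allP lw). Qed.

Lemma block_sum_value e n b g : class_invariant g ->
  \sum_(w <- block_words e n b) extend0 g w =
  value (extend0 g) (\prod_(x <- b) \sum_(w <- sorted_words e n x) word_op u w).
Proof.
move=> hg; rewrite -block_words_prod raddf_sum /=; apply: eq_big_seq => w.
move=> /mem_block_words[_ lw _].
rewrite (value_word_op hR hcat) //; first exact: is_word_letters lw.
exact: extend0_class.
Qed.

Lemma psi_gt_value g m : class_invariant g ->
  psi_gt k g m = value (extend0 g)
    (\prod_(x <- exponents m) elem u (sumn (exponents m)) x%:Z).
Proof.
move=> hg; rewrite (psi_gt_coef _ (block_words_uniq gtn (sumn (exponents m)) (exponents m))).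
  rewrite block_sum_value //; congr (value _ _).
  by apply: eq_bigr => x _; rewrite elem_sum.
by move=> w; exact: mem_block_words.
Qed.

Lemma psi_le_value g m : class_invariant g ->
  psi_le k g m = value (extend0 g)
    (\prod_(x <- exponents m) hom u (sumn (exponents m)) x).
Proof.
move=> hg; rewrite (psi_le_coef _ (block_words_uniq leq (sumn (exponents m)) (exponents m))).
  rewrite block_sum_value //; congr (value _ _).
  by apply: eq_bigr => x _; rewrite hom_sum.
by move=> w; exact: mem_block_words.
Qed.

Hypothesis hK : extends R knuth \/ extends R kknuth.
Let FG n : fomin_greene u n := knuth_fomin_greene k hR hcat n hK.

Lemma psi_gt_symmetric g : class_invariant g -> Symhat k (psi_gt k g).
Proof.
move=> hg; apply/SymhatP => m m' mm'; rewrite !psi_gt_value //.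
rewrite (perm_sumn mm'); congr (value _ _); exact: (elem_prod_perm (FG _)).
Qed.

Lemma psi_le_symmetric g : class_invariant g -> Symhat k (psi_le k g).
Proof.
move=> hg; apply/SymhatP => m m' mm'; rewrite !psi_le_value //.
rewrite (perm_sumn mm'); congr (value _ _); exact: (hom_prod_perm (FG _)).
Qed.

Lemma kappa_value E x : is_class R E -> word_positive u x ->
  exists c : nat, value (extend0 (kappa k E)) x = c%:R.
Proof.
move=> hE [W ->]; rewrite raddf_sum /=.
elim: W => [|w W [c IHW]]; first by exists 0%N; rewrite big_nil.
rewrite big_cons IHW (value_uword hR hcat); last exact/extend0_class/kappa_invariant.
rewrite /extend0; case: insubP => [p _ _|_]; last by exists c; rewrite add0r.
by exists (`[< E p >] + c)%N; rewrite natrD.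
Qed.

Lemma value_natM g (c : nat) x : value (k := k) g (c%:R * x) = c%:R * value g x.
Proof. by rewrite mulr_natl raddfMn mulr_natl. Qed.

Lemma psi_gt_schur_positive E : is_class R E -> schur_positive (psi_gt k (kappa k E)).
Proof.
move=> hE; have hg := kappa_invariant hE.
apply: (@schur_positive_expansion _ _
  (fun n f => value (extend0 (kappa k E)) (schur_op u f))) => [m|n f sf wf]; last first.
  by apply: kappa_value => //; apply: (schur_op_positive (FG n)).
rewrite psi_gt_value // (elem_expansion (FG _)) // raddf_sum.
by apply: eq_bigr => f _; exact: value_natM.
Qed.

Lemma psi_le_schur_positive E : is_class R E -> schur_positive (psi_le k (kappa k E)).
Proof.
move=> hE; have hg := kappa_invariant hE.
apply: (@schur_positive_expansion _ _
  (fun n f => value (extend0 (kappa k E)) (schur_op u (conj_shape f)))) => [m|n f sf wf];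
  last first.
  apply: kappa_value => //; apply: (schur_op_positive (FG n)).
  by apply: conj_is_shape => //; lia.
rewrite psi_le_value // (hom_expansion (FG _)) // raddf_sum.
by apply: eq_bigr => f _; exact: value_natM.
Qed.
End Forward.

(** * From symmetry to Knuth or K-Knuth equivalence *)

Section Converse.
Variables (R : seq nat -> seq nat -> Prop).
Hypothesis hR : word_relation R.
Hypothesis hRalg : uniformly_algebraic R.

Lemma extends_closure G : (forall v w, G v w -> R v w) -> extends R (congruence_closure G).
Proof.
move=> hG v w; elim=> {v w} [v w /hG //|w|v w _|u v w _ uv _ vw|v v' w w' _ vv' _ ww'].
- exact: wrel_refl.
- exact: wrel_sym.
- exact: (wrel_trans hR) uv vw.
- exact: ualg_cat.
Qed.

Lemma rel_three x y a b c : (0 < a)%N -> (a < b)%N -> (b < c)%N ->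
  wmin x = 1%N -> wmax x = 3%N -> R x y ->
  R (map (nth 0%N [:: 0; a; b; c]%N) x) (map (nth 0%N [:: 0; a; b; c]%N) y).
Proof.
move=> a0 ab bc x1 x3; apply: (ualg_map hRalg); rewrite x1 x3; split.
  by case=> [|[|[|[|i]]]] //= _; lia.
by case=> [|[|[|[|i]]]] [|[|[|[|j]]]] //=; lia.
Qed.

Lemma rel_two x y a b : (0 < a)%N -> (a < b)%N -> wmin x = 1%N -> wmax x = 2%N -> R x y ->
  R (map (nth 0%N [:: 0; a; b]%N) x) (map (nth 0%N [:: 0; a; b]%N) y).
Proof.
move=> a0 ab x1 x2; apply: (ualg_map hRalg); rewrite x1 x2; split.
  by case=> [|[|[|i]]] //= _; lia.
by case=> [|[|[|i]]] [|[|[|j]]] //=; lia.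
Qed.

(** If two distinct letters always commute, all Knuth relations hold. *)
Lemma extends_commutative : R [:: 2; 1]%N [:: 1; 2]%N -> extends R knuth.
Proof.
move=> h12; have com a b : (0 < a)%N -> (a < b)%N -> R [:: b; a] [:: a; b].
  move=> a0 ab; apply: (rel_two a0 ab _ _ h12).
    by rewrite /wmin !big_cons big_nil.
  by rewrite /wmax !big_cons big_nil.
have one a : (0 < a)%N -> R [:: a] [:: a].
  by move=> a0; apply: (wrel_refl hR); rewrite /is_word inE; lia.
apply: extends_closure => _ _ [a b c a0 ab bc|a b c a0 ab bc|a b a0 ab|a b a0 ab].
- apply: (@ualg_cat _ hRalg ([:: b]) ([:: b]) ([:: a; c]) ([:: c; a])).
    by apply: one; lia.
  by apply: (wrel_sym hR); apply: com; lia.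
- apply: (@ualg_cat _ hRalg ([:: a; c]) ([:: c; a]) ([:: b]) ([:: b])).
    by apply: (wrel_sym hR); apply: com; lia.
  by apply: one; lia.
- apply: (@ualg_cat _ hRalg ([:: a; b]) ([:: b; a]) ([:: a]) ([:: a])).
    by apply: (wrel_sym hR); apply: com.
  exact: one.
apply: (@ualg_cat _ hRalg ([:: b]) ([:: b]) ([:: a; b]) ([:: b; a])).
  by apply: one; lia.
by apply: (wrel_sym hR); apply: com.
Qed.

Definition related (v w : seq nat) : nat := `[< R v w >].

Lemma related1 v w : R v w -> related v w = 1%N.
Proof. by move=> h; rewrite /related asboolT. Qed.

Lemma relatedP v w : (0 < related v w)%N -> R v w.
Proof. by rewrite /related lt0b => /asboolP. Qed.

(** If 213 is related to 132, the restriction to the letters 1 and 2 makes letters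
    commute. Otherwise the first equation forces the three-letter relations. In the
    second one, either 121 is related to 211 and 221 to 212, which is Knuth
    equivalence, or 121 is related to 212 and 221 to 211; restricting the latter to
    the letter 1 gives 1 related to 11, which completes K-Knuth equivalence. *)
Lemma extends_of_counts :
  (forall v, v \in [:: [:: 2; 1; 3]; [:: 1; 3; 2]]%N ->
    related v [:: 1; 3; 2] + related v [:: 2; 3; 1] = related v [:: 2; 1; 3] + related v [:: 3; 1; 2])%N ->
  (forall v, v \in [:: [:: 1; 2; 1]; [:: 2; 2; 1]]%N ->
    related v [:: 1; 2; 1] + related v [:: 2; 2; 1] = related v [:: 2; 1; 1] + related v [:: 2; 1; 2])%N ->
  extends R knuth \/ extends R kknuth.
Proof.
move=> h3 h2.
have refl w : is_word w -> related w w = 1%N by move=> ww; apply/related1/(wrel_refl hR).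
have sym v w : R v w -> R w v := @wrel_sym _ hR v w.
have trans v w x : R v w -> R w x -> R v x := @wrel_trans _ hR v w x.
(* only this case makes letters commute *)
have [h|n132] := pselect (R [:: 2; 1; 3]%N [:: 1; 3; 2]%N).
  left; apply: extends_commutative.
  apply: (@ualg_restrict _ hRalg (fun i => 0 < i < 3)%N _ _ _ h).
  by split=> [i|i j l] //=; lia.
have E3 v : related v [:: 2; 1; 3]%N = 0%N \/
    related v [:: 1; 3; 2]%N = 0%N.
  case: (posnP (related v [:: 2; 1; 3]%N)) => [->|/relatedP h]; first by left.
  case: (posnP (related v [:: 1; 3; 2]%N)) => [->|/relatedP h']; first by right.
  by case: n132; apply: trans h'; apply: sym.
have bac : R [:: 2; 1; 3]%N [:: 2; 3; 1]%N.
  have := h3 [:: 2; 1; 3]%N isT; have := E3 [:: 2; 1; 3]%N; rewrite refl // => -[//|->].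
  by move=> H; apply: relatedP; lia.
have acb : R [:: 1; 3; 2]%N [:: 3; 1; 2]%N.
  have := h3 [:: 1; 3; 2]%N isT; have := E3 [:: 1; 3; 2]%N; rewrite refl // => -[->|//].
  by move=> H; apply: relatedP; lia.
have Rbac a b c : (0 < a)%N -> (a < b)%N -> (b < c)%N -> R [:: b; a; c] [:: b; c; a].
  move=> a0 ab bc; apply: (rel_three a0 ab bc _ _ bac).
    by rewrite /wmin !big_cons big_nil.
  by rewrite /wmax !big_cons big_nil.
have Racb a b c : (0 < a)%N -> (a < b)%N -> (b < c)%N -> R [:: a; c; b] [:: c; a; b].
  move=> a0 ab bc; apply: (rel_three a0 ab bc _ _ acb).
    by rewrite /wmin !big_cons big_nil.
  by rewrite /wmax !big_cons big_nil.
have two x y a b : R x y -> (0 < a)%N -> (a < b)%N -> wmin x = 1%N -> wmax x = 2%N ->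
    R (map (nth 0%N [:: 0; a; b]%N) x) (map (nth 0%N [:: 0; a; b]%N) y).
  by move=> xy a0 ab x1 x2; apply: rel_two xy.
have K : R [:: 1; 2; 1]%N [:: 2; 1; 1]%N -> R [:: 2; 1; 2]%N [:: 2; 2; 1]%N ->
    extends R knuth.
  move=> aba bab; apply: extends_closure => _ _ [a b c||a b a0 ab|a b a0 ab]; first exact: Rbac.
  - exact: Racb.
  - by apply: (two _ _ _ _ aba) => //; rewrite ?/wmin ?/wmax !big_cons big_nil.
  - by apply: (two _ _ _ _ bab) => //; rewrite ?/wmin ?/wmax !big_cons big_nil.
have KK : R [:: 1; 2; 1]%N [:: 2; 1; 2]%N -> R [:: 2; 2; 1]%N [:: 2; 1; 1]%N ->
    extends R kknuth.
  move=> aba bba; apply: extends_closure => _ _ [a b c||a b a0 ab|a a0]; first exact: Rbac.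
  - exact: Racb.
  - by apply: (two _ _ _ _ aba) => //; rewrite ?/wmin ?/wmax !big_cons big_nil.
  have h1 : R [:: 1]%N [:: 1; 1]%N.
    apply: (@ualg_restrict _ hRalg (fun i => 0 < i < 2)%N _ _ _ bba).
    by split=> [i|i j l] //=; lia.
  have -> : [:: a] = map (fun=> a) [:: 1]%N by [].
  have -> : [:: a; a] = map (fun=> a) [:: 1; 1]%N by [].
  apply: (ualg_map hRalg) h1; rewrite /wmin /wmax !big_cons !big_nil /=.
  by split=> // i j; lia.
have := h2 [:: 1; 2; 1]%N isT; have := h2 [:: 2; 2; 1]%N isT; rewrite !refl // => H2 H1.
have le1 v w : (related v w <= 1)%N by exact: leq_b1.
have := (le1 [:: 1; 2; 1]%N [:: 2; 1; 1]%N, le1 [:: 1; 2; 1]%N [:: 2; 1; 2]%N).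
have := (le1 [:: 2; 2; 1]%N [:: 2; 1; 1]%N, le1 [:: 2; 2; 1]%N [:: 2; 1; 2]%N).
move=> [l1 l2] [l3 l4].
have [h12|h12] := pselect (R [:: 1; 2; 1]%N [:: 2; 2; 1]%N).
  rewrite (related1 h12) in H1; left; apply: K; first by apply: relatedP; lia.
  apply: (trans _ [:: 1; 2; 1]%N) => //.
  by apply: sym; apply: relatedP; lia.
have i12 : related [:: 1; 2; 1]%N [:: 2; 2; 1]%N = 0%N by rewrite /related asboolF.
have i21 : related [:: 2; 2; 1]%N [:: 1; 2; 1]%N = 0%N.
  by rewrite /related asboolF // => /sym.
rewrite i12 in H1; rewrite i21 in H2.
case: (posnP (related [:: 1; 2; 1]%N [:: 2; 1; 1]%N)) => [z|/relatedP h].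
  have a1 : R [:: 1; 2; 1]%N [:: 2; 1; 2]%N by apply: relatedP; lia.
  right; apply: KK => //; apply: relatedP.
  have : related [:: 2; 2; 1]%N [:: 2; 1; 2]%N = 0%N; last by lia.
  by rewrite /related asboolF // => h; apply: h12; exact: (trans _ _ _ a1 (sym _ _ h)).
left; apply: K => //; apply/sym; apply: relatedP.
have : related [:: 2; 2; 1]%N [:: 2; 1; 1]%N = 0%N; last by lia.
by rewrite /related asboolF // => h'; apply: h12; exact: (trans _ _ _ h (sym _ _ h')).
Qed.
End Converse.

Section Main.
Variables (k : fieldType) (R : seq nat -> seq nat -> Prop).
Hypothesis hk : [pchar k] =i pred0.
Hypothesis hR : word_relation R.
Hypothesis hRalg : uniformly_algebraic R.

Definition class_of (v : pword) : set pword := [set w | R (val v) (val w)].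

Lemma Khat_kappa v : Khat k R (kappa k (class_of v)).
Proof.
exists (fun E => `[< E = class_of v >]%:R); apply/funext => w.
rewrite /formal_sum (@fsbig_list _ _ _ [:: class_of v]) //.
- by rewrite big_seq1 asboolT // mul1r.
- by move=> E; rewrite inE => /eqP ->; exists v.
by move=> E _; rewrite inE => Ev; rewrite asboolF ?mul0r //; apply/eqP.
Qed.

Lemma extend0_kappa (v : pword) w :
  extend0 (kappa k (class_of v)) w = (related R (val v) w)%:R.
Proof.
rewrite /extend0; case: insubP => [p _ <-|] //.
move=> nw; rewrite /related asboolF // => vw; case/negP: nw.
by rewrite -(packed_ext (wrel_letters hR vw)) (valP v).
Qed.

Lemma natr_inj (a b : nat) : a%:R = b%:R :> k -> a = b.
Proof.
have h := (pcharf0P k).1 hk.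
wlog ab : a b / (a <= b)%N => [H|/esym/eqP].
  by case: (leqP a b) => [/H//|/ltnW/H h1 /esym/h1].
by rewrite -subr_eq0 -natrB // h subn_eq0 => ba; apply/eqP; rewrite eqn_leq ab.
Qed.

(** A necessary condition for being related that can be computed. *)
Definition same_letters (v w : seq nat) := all (mem v) w && all (mem w) v.

Lemma sum_related_letters v (L : seq (seq nat)) :
  \sum_(w <- L) (related R v w)%:R =
  (\sum_(w <- [seq w <- L | same_letters v w]) related R v w)%:R :> k.
Proof.
rewrite natr_sum big_filter [RHS]big_mkcond; apply: eq_bigr => w _.
case: ifPn => // /negP vw; rewrite /related asboolF // => h; apply: vw.
have E := wrel_letters hR h.
by apply/andP; split; apply/allP => x /=; rewrite E.
Qed.

(** The two sides are the coefficients of the image of the class of v at the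
    monomials x_0 x_1^2 and x_0^2 x_1. *)
Lemma symmetric_counts (e : rel nat) (psi : wseries k -> pseries k) :
  (forall g m, psi g m = \sum_(w <- block_words e (sumn (exponents m)) (exponents m))
     extend0 g w) ->
  psi @` Khat k R `<=` Symhat k -> forall v, packed v ->
  (\sum_(w <- [seq w <- block_words e 3 [:: 1; 2] | same_letters v w]) related R v w =
   \sum_(w <- [seq w <- block_words e 3 [:: 2; 1] | same_letters v w]) related R v w)%N.
Proof.
move=> hpsi hS v pv; apply: natr_inj; rewrite -!sum_related_letters.
pose p : pword := Sub v pv.
have : Symhat k (psi (kappa k (class_of p))).
  by apply: hS; exists (kappa k (class_of p)) => //; exact: Khat_kappa.
move/SymhatP => /(_ (monomial_of [:: 0; 1]%N [:: 1; 2]%N) (monomial_of [:: 0; 1]%N [:: 2; 1]%N)).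
rewrite !hpsi (exponents_monomial (a := [:: 1; 2]%N)) // (exponents_monomial (a := [:: 2; 1]%N)) //.
move=> /(_ isT); under eq_bigr => w _ do rewrite extend0_kappa.
by under [in RHS]eq_bigr => w _ do rewrite extend0_kappa.
Qed.

Lemma extends_of_symmetric_gt : psi_gt k @` Khat k R `<=` Symhat k ->
  extends R knuth \/ extends R kknuth.
Proof.
move=> hS; have H := @symmetric_counts gtn (psi_gt k) _ hS.
have {}H := H (fun g m => @psi_gt_coef k _ g m (block_words_uniq _ _ _)
  (mem_block_words _ _ _)).
apply: extends_of_counts => // v; rewrite !inE => /orP[] /eqP ->.
- have := H [:: 2; 1; 3]%N isT.
  rewrite (_ : filter _ (block_words _ _ [:: 1; 2]%N) =
    [:: [:: 1; 3; 2]; [:: 2; 3; 1]; [:: 3; 2; 1]]%N) //.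
  rewrite (_ : filter _ (block_words _ _ [:: 2; 1]%N) =
    [:: [:: 2; 1; 3]; [:: 3; 1; 2]; [:: 3; 2; 1]]%N) //.
  by rewrite !big_cons !big_nil; lia.
- have := H [:: 1; 3; 2]%N isT.
  rewrite (_ : filter _ (block_words _ _ [:: 1; 2]%N) =
    [:: [:: 1; 3; 2]; [:: 2; 3; 1]; [:: 3; 2; 1]]%N) //.
  rewrite (_ : filter _ (block_words _ _ [:: 2; 1]%N) =
    [:: [:: 2; 1; 3]; [:: 3; 1; 2]; [:: 3; 2; 1]]%N) //.
  by rewrite !big_cons !big_nil; lia.
- have := H [:: 1; 2; 1]%N isT.
  rewrite (_ : filter _ (block_words _ _ [:: 1; 2]%N) =
    [:: [:: 1; 2; 1]; [:: 2; 2; 1]]%N) //.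
  rewrite (_ : filter _ (block_words _ _ [:: 2; 1]%N) =
    [:: [:: 2; 1; 1]; [:: 2; 1; 2]]%N) //.
  by rewrite !big_cons !big_nil; lia.
- have := H [:: 2; 2; 1]%N isT.
  rewrite (_ : filter _ (block_words _ _ [:: 1; 2]%N) =
    [:: [:: 1; 2; 1]; [:: 2; 2; 1]]%N) //.
  rewrite (_ : filter _ (block_words _ _ [:: 2; 1]%N) =
    [:: [:: 2; 1; 1]; [:: 2; 1; 2]]%N) //.
  by rewrite !big_cons !big_nil; lia.
Qed.

Lemma extends_of_symmetric_le : psi_le k @` Khat k R `<=` Symhat k ->
  extends R knuth \/ extends R kknuth.
Proof.
move=> hS; have H := @symmetric_counts leq (psi_le k) _ hS.
have {}H := H (fun g m => @psi_le_coef k _ g m (block_words_uniq _ _ _)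
  (mem_block_words _ _ _)).
apply: extends_of_counts => // v; rewrite !inE => /orP[] /eqP ->.
- have := H [:: 2; 1; 3]%N isT.
  rewrite (_ : filter _ (block_words _ _ [:: 1; 2]%N) =
    [:: [:: 1; 2; 3]; [:: 2; 1; 3]; [:: 3; 1; 2]]%N) //.
  rewrite (_ : filter _ (block_words _ _ [:: 2; 1]%N) =
    [:: [:: 1; 2; 3]; [:: 1; 3; 2]; [:: 2; 3; 1]]%N) //.
  by rewrite !big_cons !big_nil; lia.
- have := H [:: 1; 3; 2]%N isT.
  rewrite (_ : filter _ (block_words _ _ [:: 1; 2]%N) =
    [:: [:: 1; 2; 3]; [:: 2; 1; 3]; [:: 3; 1; 2]]%N) //.
  rewrite (_ : filter _ (block_words _ _ [:: 2; 1]%N) =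
    [:: [:: 1; 2; 3]; [:: 1; 3; 2]; [:: 2; 3; 1]]%N) //.
  by rewrite !big_cons !big_nil; lia.
- have := H [:: 1; 2; 1]%N isT.
  rewrite (_ : filter _ (block_words _ _ [:: 1; 2]%N) =
    [:: [:: 1; 1; 2]; [:: 1; 2; 2]; [:: 2; 1; 1]; [:: 2; 1; 2]]%N) //.
  rewrite (_ : filter _ (block_words _ _ [:: 2; 1]%N) =
    [:: [:: 1; 1; 2]; [:: 1; 2; 1]; [:: 1; 2; 2]; [:: 2; 2; 1]]%N) //.
  by rewrite !big_cons !big_nil; lia.
- have := H [:: 2; 2; 1]%N isT.
  rewrite (_ : filter _ (block_words _ _ [:: 1; 2]%N) =
    [:: [:: 1; 1; 2]; [:: 1; 2; 2]; [:: 2; 1; 1]; [:: 2; 1; 2]]%N) //.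
  rewrite (_ : filter _ (block_words _ _ [:: 2; 1]%N) =
    [:: [:: 1; 1; 2]; [:: 1; 2; 1]; [:: 1; 2; 2]; [:: 2; 2; 1]]%N) //.
  by rewrite !big_cons !big_nil; lia.
Qed.

End Main.

Theorem theorem8p14 (k : fieldType) (hk : [pchar k] =i pred0)
    (R : seq nat -> seq nat -> Prop)
    (hR : word_relation R) (hRalg : uniformly_algebraic R) :
  [/\ (psi_le k @` Khat k R `<=` Symhat k <->
       psi_gt k @` Khat k R `<=` Symhat k),
      (psi_gt k @` Khat k R `<=` Symhat k <->
       extends R knuth \/ extends R kknuth)
    & (psi_le k @` Khat k R `<=` Symhat k /\
       psi_gt k @` Khat k R `<=` Symhat k /\
       (extends R knuth \/ extends R kknuth)) ->
      forall E : set pword, is_class R E ->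
        schur_positive (psi_le k (kappa k E)) /\
        schur_positive (psi_gt k (kappa k E))].
Proof.
have hcat := ualg_cat hRalg.
have gtP : extends R knuth \/ extends R kknuth -> psi_gt k @` Khat k R `<=` Symhat k.
  move=> hK _ [g hg <-]; exact: (psi_gt_symmetric hR hcat hK) (Khat_invariant hR hg).
have leP : extends R knuth \/ extends R kknuth -> psi_le k @` Khat k R `<=` Symhat k.
  move=> hK _ [g hg <-]; exact: (psi_le_symmetric hR hcat hK) (Khat_invariant hR hg).
have of_gt := @extends_of_symmetric_gt k R hk hR hRalg.
have of_le := @extends_of_symmetric_le k R hk hR hRalg.
split.
- by split=> [/of_le|/of_gt].
- by split=> [/of_gt|].
move=> [_ [_ hK]] E hE; split.
  exact: (psi_le_schur_positive k hR hcat hK hE).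
exact: (psi_gt_schur_positive k hR hcat hK hE).
Qed.
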